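(* Let $\sigma\ge2$ be an integer and let $\mathcal{T}_\sigma^*$ denote the rooted regular tree in which all vertices (including the root) have degree $\sigma+1$. Let $E$ be a cylinder event on $\mathcal{T}_\sigma^*$ (i.e. an event that depends on the status of only finitely many bonds), and suppose that $E$ is invariant under the automorphisms of the rooted tree $\mathcal{T}_\sigma^*$. Let $C$ be the invasion percolation cluster on $\mathcal{T}_\sigma$, with law $\mathbb{P}$. Then $$\lim_{\|x\|\to\infty}\mathbb{P}(\tau_xE\mid x\in C)=\mathbb{P}^*_\infty(E),$$ where $\tau_x$ denotes the shift by the vertex $x\in\mathcal{T}_\sigma$, and $\mathbb{P}^*_\infty$ denotes the law of the incipient infinite cluster on $\mathcal{T}_\sigma^*$.
   Context: $\mathcal{T}_\sigma$ is the infinite rooted tree in which every vertex has exactly $\sigma$ children (the root $o$ has degree $\sigma$, all other vertices have degree $\sigma+1$). $\|v\|$ is the graph distance of $v$ from $o$. Invasion percolation cluster (IPC): assign i.i.d. uniform $(0,1)$ weights to the edges of $\mathcal{T}_\sigma$. Let $I_0=\{o\}$ and, given $I_N$, let $I_{N+1}$ be obtained by adjoining to $I_N$ the edge in its boundary (edges with exactly one endpoint in $I_N$) with smallest weight, together with its other endpoint. Then $C=\bigcup_{N\ge 0} I_N$. Incipient infinite cluster on $\mathcal{T}_\sigma^*$: with $p_c=1/\sigma$, $\mathbb{P}^*_\infty$ is the law of the random infinite cluster of the root obtained as the limit, as $n\to\infty$, of the law of the open cluster of the root for independent bond percolation on $\mathcal{T}^*_\sigma$ with parameter $p_c$, conditioned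 on the root being connected by open edges to distance $n$ (limit of probabilities of cylinder events). Under each of the two laws, the status of a bond is whether or not it belongs to the random cluster ($C$, respectively the incipient infinite cluster). Shift: if $E$ depends only on bonds within distance $k$ of the root of $\mathcal{T}_\sigma^*$ and $\|x\|>k$, then the ball of radius $k$ around $x$ in $\mathcal{T}_\sigma$ is isomorphic to the ball of radius $k$ around the root of $\mathcal{T}^*_\sigma$, by an isomorphism sending the root to $x$; $\tau_xE$ is the event that the configuration in the ball around $x$, transported by such an isomorphism, satisfies $E$. By the invariance of $E$ this does not depend on the choice of isomorphism. *)

(* Defs.v *)
From HB Require Import structures.
From mathcomp Require Import all_boot all_order all_algebra finmap.
From mathcomp Require Import all_classical all_reals all_analysis.
Set Implicit Arguments.
Unset Strict Implicit.
Unset Printing Implicit Defensive.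
Import Order.TTheory GRing.Theory Num.Theory.
Import numFieldNormedType.Exports.
Local Open Scope classical_set_scope.
Local Open Scope ring_scope.

Section Graphs.
Variables (V : choiceType) (adj : rel V).
Implicit Types (u v x z : V) (k n : nat).

Definition walk_length u v : set nat :=
  [set n | exists p : seq V, [/\ path adj u p, last u p = v & size p = n]].

(* On a connected graph the minimum exists; the default 0 is never used. *)
Definition gdist u v : nat :=
  xget 0%N [set n | walk_length u v n /\
                    forall m, walk_length u v m -> (n <= m)%N].

Definition ball_at x k : set V := [set v | (gdist x v <= k)%N].

(* A bond is the unordered pair of its endpoints. *)
Definition bonds : set {fset V} :=
  [set e | exists u v, adj u v /\ e = [fset u; v]%fset].

Definition bonds_in_ball x k : set {fset V} :=
  [set e | bonds e /\ [set` e] `<=` ball_at x k].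

End Graphs.

(* A bond configuration is the set of bonds whose status is "in the cluster".
   Elements of {fset V} that are not bonds carry no information: all events
   considered below depend on the status of bonds only. *)
Notation config V := (set {fset V}).

Definition depends_on (V : choiceType) (B : set {fset V})
    (E : set (config V)) : Prop :=
  forall om om' : config V,
    (forall e, B e -> (om e <-> om' e)) -> E om -> E om'.

Definition cylinder (V : choiceType) (adj : rel V) : set (set (config V)) :=
  [set E | exists B, [/\ finite_set B, B `<=` bonds adj & depends_on B E]].

(* The configuration on V obtained by reading om through the map f. *)
Definition pullback (V V' : choiceType) (f : V -> V') (om : config V') :
    config V :=
  [set e | om [fset f z | z in e]%fset].

Definition rooted_automorphism (V : choiceType) (adj : rel V) (o : V)
    (g : V -> V) : Prop :=
  [/\ bijective g, g o = o & forall u v, adj (g u) (g v) = adj u v].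

Definition automorphism_invariant (V : choiceType) (adj : rel V) (o : V)
    (E : set (config V)) : Prop :=
  forall g, rooted_automorphism adj o g ->
    forall om, E (pullback g om) <-> E om.

Definition ball_iso (V V' : choiceType) (adj : rel V) (adj' : rel V')
    (k : nat) (o : V) (x : V') (phi : V -> V') : Prop :=
  [/\ phi o = x,
      set_bij (ball_at adj o k) (ball_at adj' x k) phi &
      forall u v, ball_at adj o k u -> ball_at adj o k v ->
        adj' (phi u) (phi v) = adj u v].

Definition parent_adj (V : eqType) (o : V) (parent : V -> V) : rel V :=
  fun u v => ((v != o) && (parent v == u)) || ((u != o) && (parent u == v)).

(* Vertices of T_sigma are words with the most recent letter first: the
   children of v are the words i :: v, so that behead is the parent map. *)
Definition tree (s : nat) : choiceType := seq 'I_s.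
Definition tree_root (s : nat) : tree s := [::].
Definition tree_adj (s : nat) : rel (tree s) :=
  parent_adj (tree_root s) (@behead 'I_s).
Arguments tree_adj s : clear implicits.

(* T*_sigma: None is the root, its sigma + 1 children are the Some (a, [::]),
   and the sigma children of Some (a, w) are the Some (a, i :: w). *)
Definition tree_star (s : nat) : choiceType := option ('I_s.+1 * seq 'I_s).
Definition star_root (s : nat) : tree_star s := None.
Definition parent_star (s : nat) (v : tree_star s) : tree_star s :=
  if v is Some (a, _ :: w) then Some (a, w) else None.
Definition tree_star_adj (s : nat) : rel (tree_star s) :=
  parent_adj (star_root s) (@parent_star s).
Arguments tree_star_adj s : clear implicits.

Definition tree_norm (s : nat) (x : tree s) : nat :=
  gdist (tree_adj s) (tree_root s) x.

(* The filter of ||x|| -> oo. *)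
Definition tree_infty (s : nat) : set_system (tree s) :=
  filter_from [set: nat] (fun n => [set x | (n <= tree_norm x)%N]).
Arguments tree_infty s : clear implicits.

(* tau_x E. The choice of k and of the isomorphism phi is immaterial for E
   invariant under rooted automorphisms. *)
Definition tau (s : nat) (x : tree s) (E : set (config (tree_star s))) :
    set (config (tree s)) :=
  [set om | exists (k : nat) (phi : tree_star s -> tree s),
    [/\ (k < tree_norm x)%N,
        depends_on (bonds_in_ball (tree_star_adj s) (star_root s) k) E,
        ball_iso (tree_star_adj s) (tree_adj s) k (star_root s) x phi &
        E (pullback phi om)]].

Section Probability.
Context d (T : measurableType d) (R : realType) (P : probability T R).

Definition cond_prob (A B : set T) : R := fine (P (A `&` B)) / fine (P B).

Definition mutually_independent (I : choiceType) (D : set I)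
    d' (T' : measurableType d') (X : I -> {RV P >-> T'}) : Prop :=
  forall (J : {fset I}) (A : I -> set T'),
    [set` J] `<=` D -> (forall i, measurable (A i)) ->
    P (\bigcap_(i in [set` J]) (X i @^-1` A i)) =
    (\prod_(i <- J) P (X i @^-1` A i))%E.

Definition iid_uniform01 (I : choiceType) (D : set I)
    (W : I -> {RV P >-> R}) : Prop :=
  mutually_independent D W /\
  forall i, D i -> forall A : set R, measurable A ->
    distribution P (W i) A = uniform_prob (@ltr01 R) A.

Definition bernoulli_percolation (V : choiceType) (adj : rel V) (p : R)
    (X : {fset V} -> {RV P >-> bool}) : Prop :=
  mutually_independent (bonds adj) X /\
  forall e, bonds adj e -> P [set w | X e w] = p%:E.

End Probability.

Section Invasion.
Variables (R : realType) (V : choiceType) (adj : rel V) (o : V).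

Definition edge_boundary (A : set V) : set {fset V} :=
  [set e | exists u v, [/\ adj u v, A u, ~ A v & e = [fset u; v]%fset]].

Definition lightest (w : {fset V} -> R) (B : set {fset V}) : set {fset V} :=
  [set e | B e /\ forall e', B e' -> w e <= w e'].

(* A cluster is the pair of its vertex set and its bond set. When all weights
   are distinct, which is almost sure for i.i.d. uniform weights, the lightest
   boundary edge is unique; xget only breaks ties. *)
Definition invasion_step (w : {fset V} -> R) (I : set V * set {fset V}) :
    set V * set {fset V} :=
  let e := xget fset0 (lightest w (edge_boundary I.1)) in
  (I.1 `|` [set` e], I.2 `|` [set e]).

Definition invasion (w : {fset V} -> R) (N : nat) : set V * set {fset V} :=
  iter N (invasion_step w) ([set o], set0).

Definition IPC_vertices (w : {fset V} -> R) : set V :=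
  \bigcup_N (invasion w N).1.

Definition IPC_bonds (w : {fset V} -> R) : config V :=
  \bigcup_N (invasion w N).2.

End Invasion.

Section OpenCluster.
Variables (V : choiceType) (adj : rel V) (o : V).

Definition open_connected (st : {fset V} -> bool) (u v : V) : Prop :=
  exists p : seq V,
    path (fun a b => adj a b && st [fset a; b]%fset) u p /\ last u p = v.

Definition open_cluster (st : {fset V} -> bool) : config V :=
  [set e | [/\ bonds adj e, st e &
               exists u, u \in e /\ open_connected st o u]].

Definition connected_to_distance (st : {fset V} -> bool) (n : nat) : Prop :=
  exists v, gdist adj o v = n /\ open_connected st o v.

End OpenCluster.

Notation config_space adj := (g_sigma_algebraType (cylinder adj)).

(* Q is the law of the incipient infinite cluster on T*_sigma, given critical
   bond percolation X on T*_sigma. *)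
Definition is_IIC_law (s : nat) d (T : measurableType d) (R : realType)
    (P : probability T R) (X : {fset tree_star s} -> {RV P >-> bool})
    (Q : probability (config_space (tree_star_adj s)) R) : Prop :=
  forall F : set (config (tree_star s)), cylinder (tree_star_adj s) F ->
    cond_prob P
      [set w | F (open_cluster (tree_star_adj s) (star_root s)
                    (fun e => X e w))]
      [set w | connected_to_distance (tree_star_adj s) (star_root s)
                 (fun e => X e w) n]
      @[n --> \oo] --> fine (Q F).

(* Main.v *)
(* Two facts about the invasion cluster C are used. If a vertex v of C percolates
   at level q below itself, then every bond of C below v has weight at most q,
   because from the moment v is invaded a boundary bond of weight at most q is
   available. Conversely, since there is no percolation at the critical level
   p = 1/sigma, C contains the whole p-cluster of each of its vertices.
   Let y be the ancestor of x at a fixed distance m and q > p close to p. If y is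
   in C, some ray of weights at most q leaves the path from the root to y, and no
   bond near x has weight in (p, q], then near x the cluster C coincides with the
   p-cluster, which is independent of {y in C}. The event that y is in C while no
   such ray exists is negligible: its probability decays exponentially in |y| at a
   rate smaller than p, whereas P(y in C) >= p^|y|. The bound on the rate comes
   from t (1 - t theta(t))^(sigma - 1) <= (1 - t)/(sigma - 1) for t > p.
   Hence P(tau_x E | x in C) tends to the probability of E for critical percolation
   around the root of T*_sigma, given that a fixed vertex at distance m is joined
   to the root. The incipient infinite cluster yields the same value: given that
   the root is joined to distance n, with high probability exactly one vertex at
   distance m is joined to distance n below it, and by invariance of E it does not
   matter which one. *)
Require Import Defs.
From HB Require Import structures.
From mathcomp Require Import all_boot all_order all_algebra finmap.
From mathcomp Require Import all_classical all_reals all_analysis.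
From mathcomp Require Import perm lra zify.
Import Order.TTheory GRing.Theory Num.Theory.
Import numFieldNormedType.Exports.
Set Implicit Arguments.
Unset Strict Implicit.
Unset Printing Implicit Defensive.
Local Open Scope classical_set_scope.
Local Open Scope ring_scope.

(** * Probabilities and independence *)

(** The decay rate is the main obstacle. The absence of side rays alone costs, per generation, a
    factor close to 1 when q is near p, so it has to be combined with a bound on the weights along
    the path; yet a path bond may well exceed q. The remedy is to read the path from y towards the
    root: a bond of weight above t shows that no vertex of the path above it percolates at level t,
    so from there on the absence of side rays may be imposed at level t instead of q. On a grid of
    levels of mesh e this happens only about 1/e times, which costs a constant; every other
    generation costs at most t (1 - t theta(t))^(sigma - 1), up to e. Multiplied by sigma, this is
    the mean offspring of the branching process conditioned on extinction, which is subcritical.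
    Both limits are computed as ratios, for E and for the sure event, of quantities normalised by
    P(y in C) on one side and by a survival probability on the other; the normalisations cancel.
    Independence is carried by sigma-algebras indexed by sets of vertices, a vertex other than the
    root standing for the bond to its parent, so that both trees share the same percolation
    lemmas. *)

Section ProbReal.
Context d (Omega : measurableType d) (R : realType) (P : probability Omega R).
Implicit Types A B C : set Omega.

Definition pr A : R := fine (P A).

Lemma prE A : measurable A -> P A = (pr A)%:E.
Proof. by move=> mA; rewrite /pr fineK// fin_num_measure. Qed.

Lemma pr_ge0 A : 0 <= pr A.
Proof. exact/fine_ge0. Qed.

Lemma prT : pr setT = 1.
Proof. by rewrite /pr probability_setT. Qed.

Lemma pr0 : pr set0 = 0.
Proof. by rewrite /pr measure0. Qed.

Lemma le_pr A B : measurable A -> measurable B -> A `<=` B -> pr A <= pr B.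
Proof.
by move=> mA mB AB; rewrite -lee_fin -!prE//; apply: le_measure; rewrite ?inE.
Qed.

Lemma prU A B : measurable A -> measurable B -> A `&` B = set0 ->
  pr (A `|` B) = pr A + pr B.
Proof.
move=> mA mB AB; have mAB := measurableU _ _ mA mB.
by apply: EFin_inj; rewrite EFinD -!prE// measureU.
Qed.

Lemma prDI A B : measurable A -> measurable B ->
  pr A = pr (A `\` B) + pr (A `&` B).
Proof.
move=> mA mB; have mAB := measurableI _ _ mA mB; have mABC := measurableD mA mB.
have dis : (A `\` B) `&` (A `&` B) = set0.
  by apply/seteqP; split=> w /=; tauto.
rewrite -(prU mABC mAB dis); congr pr; apply/seteqP; split=> w /=; last tauto.
by have [] := pselect (B w); tauto.
Qed.

Lemma prC A : measurable A -> pr (~` A) = 1 - pr A.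
Proof.
move=> mA; have mAC := measurableC mA; apply: EFin_inj.
by rewrite -prE// probability_setC// prE// EFinB.
Qed.

Lemma prU_le A B : measurable A -> measurable B -> pr (A `|` B) <= pr A + pr B.
Proof.
move=> mA mB; have mBA := measurableD mB mA.
have -> : A `|` B = A `|` (B `\` A).
  by apply/seteqP; split=> w /=; have [] := pselect (A w); tauto.
rewrite prU ?setDIK// lerD2l; apply: le_pr => //; exact: subDsetl.
Qed.

Lemma pr_le_sub2 A B C : measurable A -> measurable B -> measurable C ->
  A `<=` B `|` C -> pr A <= pr B + pr C.
Proof.
move=> mA mB mC ABC; apply: le_trans (prU_le mB mC).
by apply: le_pr => //; exact: measurableU.
Qed.

Lemma dist_pr A B C : measurable A -> measurable B -> measurable C ->
  A `<=` B `|` C -> B `<=` A `|` C -> `|pr A - pr B| <= pr C.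
Proof.
move=> mA mB mC h1 h2; rewrite ler_distlC.
by have := pr_le_sub2 mA mB mC h1; have := pr_le_sub2 mB mA mC h2; lra.
Qed.

Lemma pr_bigcup_seq_eq0 (I : countType) (A : I -> set Omega) :
  (forall i, measurable (A i)) -> (forall i, pr (A i) = 0) ->
  pr (\bigcup_i A i) = 0.
Proof.
move=> mA A0.
pose F n := oapp A set0 (choice.unpickle n).
have mF n : measurable (F n) by rewrite /F; case: (choice.unpickle n) => [i|] /=.
have FE : \bigcup_i A i = \bigcup_n F n.
  apply/seteqP; split=> [w [i _ Aw]|w [n _]].
    by exists (choice.pickle i) => //; rewrite /F choice.pickleK.
  by rewrite /F; case: (choice.unpickle n) => // i Aw; exists i.
rewrite /pr; suff -> : P (\bigcup_i A i) = 0%E by [].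
apply/eqP; rewrite eq_le measure_ge0 andbT FE.
apply: le_trans (measure_sigma_subadditive P mF _ _) _ => //.
  exact: bigcup_measurable.
rewrite eseries0// => n _ _; rewrite /F; case: (choice.unpickle n) => [i|]; last first.
  by rewrite /= measure0.
by rewrite /= [LHS](prE (mA i)) A0.
Qed.

Lemma pr_bigcap_cvg (F : nat -> set Omega) :
  (forall n, measurable (F n)) -> (forall n, F n.+1 `<=` F n) ->
  (fun n => pr (F n)) @ \oo --> pr (\bigcap_n F n).
Proof.
move=> mF FS; apply: fine_cvg; rewrite -prE; last exact: bigcapT_measurable.
apply: nonincreasing_cvg_mu => //.
- by rewrite [X in (X < _)%E](prE (mF 0%N)) ltry.
- exact: bigcapT_measurable.
- apply/nonincreasing_seqP => n; exact/subsetPset.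
Qed.

End ProbReal.

(** * Events determined by finitely many others *)

Section FiniteDependence.
Context (T : Type) (M : set (set T)).
Hypothesis sM : sigma_algebra setT M.

Lemma sigmaC A : M A -> M (~` A).
Proof. by move=> MA; rewrite -setTD; case: sM => _ /(_ _ MA). Qed.

Lemma sigma_bigcup (I : countType) (A : I -> set T) :
  (forall i, M (A i)) -> M (\bigcup_i A i).
Proof.
move=> MA; have [M0 _ MU] := sM.
rewrite (_ : \bigcup_i A i =
  \bigcup_n oapp A set0 (choice.unpickle n)); last first.
  apply/seteqP; split=> [w [i _ Aw]|w [n _]].
    by exists (choice.pickle i) => //; rewrite choice.pickleK.
  by case: (choice.unpickle n) => // i Aw; exists i.
by apply: MU => n; case: (choice.unpickle n).
Qed.

Lemma sigma_bigcap (I : countType) (A : I -> set T) :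
  (forall i, M (A i)) -> M (\bigcap_i A i).
Proof.
move=> MA; rewrite -[X in M X]setCK setC_bigcap; apply: sigmaC.
by apply: sigma_bigcup => i; apply: sigmaC.
Qed.

Lemma sigmaU A B : M A -> M B -> M (A `|` B).
Proof.
move=> MA MB; rewrite (_ : A `|` B = \bigcup_(b : bool) (if b then A else B)).
  by apply: sigma_bigcup => -[].
apply/seteqP; split=> [w [Aw|Bw]|w [[] _ ?]]; by [exists true|exists false|left|right].
Qed.

Lemma sigmaI A B : M A -> M B -> M (A `&` B).
Proof.
move=> MA MB; rewrite -[A `&` B]setCK setCI; apply: sigmaC.
by apply: sigmaU; apply: sigmaC.
Qed.

Lemma sigmaT : M setT.
Proof. by rewrite -setC0; apply: sigmaC; case: sM. Qed.

(** Local events of clusters have no convenient explicit description; this places them in a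
    sigma-algebra from the mere fact that finitely many of its members determine them. As [M] is
    arbitrary, it yields measurability and also membership in the field of a given set of bonds. *)
Lemma finite_dependence (J : eqType) (l : seq J) (F : J -> set T) (A : set T) :
  (forall j, j \in l -> M (F j)) ->
  (forall w w', (forall j, j \in l -> F j w <-> F j w') -> A w -> A w') ->
  M A.
Proof.
elim: l A => [|j l IH] A MF dA.
  have [->|/set0P[w Aw]] := eqVneq A set0; first by case: sM.
  rewrite (_ : A = setT); first exact: sigmaT.
  by apply/seteqP; split=> // w' _; apply: dA Aw.
(* [A1] and [A0] are the traces of [A] on [F j] and on its complement, saturated with respect to the
   remaining sets, so that the induction hypothesis applies to them. *)
pose A1 := [set w' | exists2 w, A w /\ F j w & forall i, i \in l -> F i w <-> F i w'].
pose A0 := [set w' | exists2 w, A w /\ ~ F j w & forall i, i \in l -> F i w <-> F i w'].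
have -> : A = (F j `&` A1) `|` (~` F j `&` A0).
  apply/seteqP; split=> [w Aw|w' [[Fw' [w [Aw Fw] ww']]|[Fw' [w [Aw Fw] ww']]]].
  - by have [Fw|Fw] := pselect (F j w); [left|right]; split=> //; exists w.
  - by apply: dA Aw => i; rewrite inE => /orP[/eqP->|/ww'].
  - by apply: dA Aw => i; rewrite inE => /orP[/eqP->|/ww'].
have MA A' : (forall w w', (forall i, i \in l -> F i w <-> F i w') -> A' w -> A' w') -> M A'.
  by apply: IH => i il; apply: MF; rewrite inE il orbT.
have trl w w' w'' : (forall i, i \in l -> F i w <-> F i w') ->
    (forall i, i \in l -> F i w' <-> F i w'') ->
    forall i, i \in l -> F i w <-> F i w''.
  by move=> h h' i il; rewrite h// h'.
have MFj : M (F j) by apply: MF; rewrite inE eqxx.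
apply: sigmaU; apply: sigmaI => //; try exact: sigmaC.
  by apply: MA => w w' ww' [u Au uw]; exists u => //; exact: trl uw ww'.
by apply: MA => w w' ww' [u Au uw]; exists u => //; exact: trl uw ww'.
Qed.

End FiniteDependence.

(** * Sigma-algebras indexed by sets of sites, independent over disjoint sets *)

Section IndependentFields.
Context d (Omega : measurableType d) (R : realType) (P : probability Omega R).

(** Interface through which all percolation arguments run. It is instantiated by the weights on
    T_sigma, by the statuses on T*_sigma, and by the restriction of the latter to a branch of
    T*_sigma. *)
Record indep_fields (I : Type) := IndepFields {
  fld :> set I -> set (set Omega);
  fld_sigma : forall S, sigma_algebra setT (fld S);
  fld_measurable : forall S A, fld S A -> measurable A;
  fld_sub : forall S S', S `<=` S' -> fld S `<=` fld S';
  fld_indep : forall S S' A B, S `&` S' = set0 -> fld S A -> fld S' B ->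
    pr P (A `&` B) = pr P A * pr P B }.

Context d' (T' : measurableType d') (K : choiceType) (D : set K)
  (X : K -> {RV P >-> T'}) (hX : mutually_independent D X).

Definition cylinders (S : set K) : set (set Omega) :=
  [set A | exists (J : {fset K}) (B : K -> set T'),
    [/\ [set` J] `<=` S `&` D, forall i, measurable (B i) &
        A = \bigcap_(i in [set` J]) (X i @^-1` B i)]].

Let mXB i B : measurable B -> measurable (X i @^-1` B).
Proof. by move=> mB; exact: measurable_funPTI. Qed.

Lemma cylinders_measurable S A : cylinders S A -> measurable A.
Proof.
move=> [J [B [_ mB ->]]]; apply: fin_bigcap_measurable => // i _.
exact: mXB.
Qed.

Definition pasted (J : {fset K}) (B B' : K -> set T') i :=
  if i \in J then B i else B' i.

Lemma cylinders_setI S : setI_closed (cylinders S).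
Proof.
move=> _ _ [J [B [JS mB ->]]] [J' [B' [JS' mB' ->]]].
exists (J `|` J')%fset,
  (fun i => (if i \in J then B i else setT) `&` (if i \in J' then B' i else setT)).
split.
- move=> i /=; rewrite in_fsetU => /orP[iJ|iJ]; [exact: JS|exact: JS'].
- by move=> i; apply: measurableI; case: ifP.
- apply/seteqP; split => [w [h h'] i /=|w h].
    by move=> _; split; case: ifP => // ij; [exact: h|exact: h'].
  split=> i /= ij; have := h i; rewrite /= in_fsetU ij ?orbT => /(_ isT)[] //.
Qed.

Lemma cylinders_indep S S' A B : S `&` S' = set0 ->
  cylinders S A -> cylinders S' B -> pr P (A `&` B) = pr P A * pr P B.
Proof.
move=> SS' [J [F [JS mF ->]]] [J' [F' [JS' mF' ->]]].
have JJ' i : i \in J -> i \in J' -> False.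
  by move=> /JS[Si _] /JS'[S'i _]; have : (S `&` S') i by []; rewrite SS'.
have mp : forall i, measurable (pasted J F F' i) by move=> i; rewrite /pasted; case: ifP.
pose G := pasted J F F'.
have e1 : \bigcap_(i in [set` J]) (X i @^-1` F i) = \bigcap_(i in [set` J]) (X i @^-1` G i).
  by apply: eq_bigcapr => i /= iJ; rewrite /G /pasted iJ.
have e2 : \bigcap_(i in [set` J']) (X i @^-1` F' i) = \bigcap_(i in [set` J']) (X i @^-1` G i).
  apply: eq_bigcapr => i /= iJ'; rewrite /G /pasted.
  by case: ifP => // iJ; have := JJ' _ iJ iJ'.
have mJ (L : {fset K}) : measurable (\bigcap_(i in [set` L]) (X i @^-1` G i)).
  by apply: fin_bigcap_measurable => // i _; exact: mXB.
rewrite e1 e2 -bigcap_setU -set_fsetU.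
apply: EFin_inj; rewrite EFinM -!prE//.
rewrite !hX//.
- rewrite (perm_big (J ++ J')) ?big_cat//=; apply: uniq_perm.
  + exact: fset_uniq.
  + rewrite cat_uniq !fset_uniq andbT /=; apply/hasPn => i iJ'.
    by apply/negP => /JJ'; apply.
  + by move=> i; rewrite mem_cat in_fsetU.
- by move=> i /=; rewrite in_fsetU => /orP[/JS[]|/JS'[]].
- by move=> i /JS'[].
- by move=> i /JS[].
Qed.

Definition sigma_gen (S : set K) := <<s cylinders S >>.

Lemma sigma_gen_measurable S A : sigma_gen S A -> measurable A.
Proof.
apply: smallest_sub; first exact: sigma_algebra_measurable.
exact: cylinders_measurable.
Qed.

(** Dynkin's argument: the events independent of a fixed [B] form a lambda-system, so independence
    passes from the pi-system [G] to the sigma-algebra it generates. It is applied twice below, once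
    in each argument. *)
Let indep_dynkin (G : set (set Omega)) B : measurable B ->
  G `<=` measurable -> setI_closed G ->
  (forall A, G A -> pr P (A `&` B) = pr P A * pr P B) ->
  forall A, <<s G >> A -> pr P (A `&` B) = pr P A * pr P B.
Proof.
move=> mB mG GI GB A; rewrite -(setI_closed_g_dynkin_g_sigma_algebra GI).
suff h : <<d G >> `<=` [set A | measurable A /\ pr P (A `&` B) = pr P A * pr P B].
  by move=> /h[].
apply: smallest_sub; last by move=> C GC; split; [exact: mG|exact: GB].
split.
- by split=> //; rewrite setTI prT mul1r.
- move=> C [mC CB]; split; first exact: measurableC.
  rewrite prC// mulrBl mul1r -CB [in RHS](prDI P mB mC).
  by rewrite setDE [B `&` ~` C]setIC [B `&` C]setIC addrK.
- move=> F tF hF.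
  have mF n : measurable (F n) by have [] := hF n.
  have FB n : pr P (F n `&` B) = pr P (F n) * pr P B by have [] := hF n.
  split; first exact: bigcupT_measurable.
  have mUF : measurable (\bigcup_n F n) by exact: bigcupT_measurable.
  apply: EFin_inj; rewrite EFinM -!prE//; last exact: measurableI.
  rewrite setI_bigcupl measure_bigcup//; last 2 first.
  + by move=> n _; exact: measurableI.
  + by under eq_fun do rewrite setIC; exact: trivIset_setIl.
  rewrite measure_bigcup// muleC prE// -nneseriesZl//.
  apply: eq_eseriesr => n _; rewrite [LHS](prE P (measurableI _ _ (mF n) mB)).
  by rewrite [X in (_ * X)%E](prE P (mF n)) -EFinM FB mulrC.
Qed.

Lemma sigma_gen_indep S S' A B : S `&` S' = set0 ->
  sigma_gen S A -> sigma_gen S' B -> pr P (A `&` B) = pr P A * pr P B.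
Proof.
move=> SS' SA SB; have mB := sigma_gen_measurable SB.
apply: (indep_dynkin mB (@cylinders_measurable S) (@cylinders_setI S)) SA.
move=> C SC; rewrite setIC mulrC.
have mC := cylinders_measurable SC.
apply: (indep_dynkin mC (@cylinders_measurable S') (@cylinders_setI S')) SB.
move=> C' SC'; rewrite setIC mulrC; exact: cylinders_indep SS' SC SC'.
Qed.

Lemma cylindersS S S' : S `<=` S' -> cylinders S `<=` cylinders S'.
Proof.
by move=> SS' A [J [B [JS mB ->]]]; exists J, B; split=> // i /JS[/SS'].
Qed.

Lemma sigma_gen_preimage S i B : S i -> D i -> measurable B ->
  sigma_gen S (X i @^-1` B).
Proof.
move=> Si Di mB; apply: sub_gen_smallest; exists [fset i]%fset, (fun=> B); split => //.
  by move=> j /=; rewrite inE => /eqP->.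
by rewrite set_fset1 bigcap_set1.
Qed.

Section Reindex.
Variables (I : Type) (D' : set I) (f : I -> K).
Hypotheses (f_inj : forall i j, D' i -> D' j -> f i = f j -> i = j).

Let rfld (S : set I) := sigma_gen (f @` (S `&` D')).

Let rfld_sub S S' : S `<=` S' -> rfld S `<=` rfld S'.
Proof.
move=> SS'; apply: sub_sigma_algebra2; apply: cylindersS; apply: image_subset.
by move=> i [/SS'].
Qed.

Let rfld_indep S S' A B : S `&` S' = set0 -> rfld S A -> rfld S' B ->
  pr P (A `&` B) = pr P A * pr P B.
Proof.
move=> SS'; apply: sigma_gen_indep; rewrite -subset0 => k [[i [Si Di] <-] [j [Sj Dj]]].
move=> /(f_inj Dj Di) ji; have : (S `&` S') i by split=> //; rewrite -ji.
by rewrite SS'.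
Qed.

(** Transports fields indexed by bonds to vertices, with [f] the map from a vertex to the bond above
    it; [D'] removes the root, which has no such bond. *)
Definition reindexed_fields : indep_fields I :=
  @IndepFields I rfld (fun S => smallest_sigma_algebra _ _)
    (fun S => @sigma_gen_measurable _) rfld_sub rfld_indep.

Lemma reindexed_preimage (S : set I) i B : S i -> D' i -> D (f i) -> measurable B ->
  reindexed_fields S (X (f i) @^-1` B).
Proof.
by move=> Si Di Dfi mB; apply: sigma_gen_preimage => //; exists i.
Qed.

End Reindex.
End IndependentFields.

(** * Walks and rooted trees *)

Section Walks.
Variables (V : choiceType) (adj : rel V).

Definition connected_graph := forall u v, exists n, walk_length adj u v n.

Lemma walk_length0 u v : walk_length adj u v 0 <-> u = v.
Proof.
split=> [[p [_ <- /size0nil ->]]//|->]; by exists [::].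
Qed.

Lemma walk_lengthS u v n :
  walk_length adj u v n.+1 <-> exists2 w, walk_length adj u w n & adj w v.
Proof.
split=> [[p [pp lp sp]]|[w [p [pp lp sp] wv]]].
  case/lastP: p pp lp sp => // p z; rewrite rcons_path last_rcons size_rcons.
  by move=> /andP[pp zz] <- [sp]; exists (last u p) => //; exists p.
by exists (rcons p v); rewrite rcons_path pp lp wv last_rcons size_rcons sp.
Qed.

Hypothesis conn : connected_graph.

Lemma gdistP u v :
  walk_length adj u v (gdist adj u v) /\
  forall m, walk_length adj u v m -> (gdist adj u v <= m)%N.
Proof.
have [n0 hn0] := conn u v.
have ex : exists n, `[< walk_length adj u v n >] by exists n0; apply/asboolP.
case: (ex_minnP ex) => n /asboolP hn hmin.
rewrite /gdist.
case: xgetP => [m _ []//|/(_ n)[]]; split=> // m hm.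
by apply: hmin; apply/asboolP.
Qed.

Lemma ball_atP u k v :
  ball_at adj u k v <-> exists2 n, (n <= k)%N & walk_length adj u v n.
Proof.
have [w wmin] := gdistP u v; split=> [|[n nk /wmin h]].
  by exists (gdist adj u v).
exact: leq_trans h nk.
Qed.

End Walks.

Section BallIso.
Variables (V V' : choiceType) (adj : rel V) (adj' : rel V').
Hypotheses (conn : connected_graph adj) (conn' : connected_graph adj').

Lemma ball_iso_walk k o x phi n v : ball_iso adj adj' k o x phi -> (n <= k)%N ->
  walk_length adj o v n -> walk_length adj' x (phi v) n.
Proof.
move=> [phio _ phiadj] ; elim: n v => [|n IH] v nk.
  by rewrite !walk_length0 => <-.
move=> /walk_lengthS[u ou uv]; apply/walk_lengthS; exists (phi u).
  by apply: IH => //; exact: ltnW.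
rewrite phiadj//; apply/(ball_atP conn); [exists n; rewrite // ltnW//|].
by exists n.+1 => //; apply/walk_lengthS; exists u.
Qed.

Lemma ball_iso_walk_lift k o x phi n v' : ball_iso adj adj' k o x phi ->
  (n <= k)%N -> walk_length adj' x v' n ->
  exists2 v, walk_length adj o v n & phi v = v'.
Proof.
move=> [phio phibij phiadj]; elim: n v' => [|n IH] v' nk.
  by move=> /walk_length0 <-; exists o => //; apply/walk_length0.
move=> h; have [u' xu' uv'] := (walk_lengthS _ _ _ _).1 h.
have [u ou phiu] := IH _ (ltnW nk) xu'.
have : ball_at adj' x k v' by apply/(ball_atP conn'); exists n.+1.
move=> /(set_bij_surj phibij)[v bv phiv]; exists v => //.
apply/walk_lengthS; exists u => //; rewrite -phiadj ?phiu ?phiv//.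
by apply/(ball_atP conn); exists n => //; exact: ltnW.
Qed.

Lemma ball_iso_le k k' o x phi : (k' <= k)%N ->
  ball_iso adj adj' k o x phi -> ball_iso adj adj' k' o x phi.
Proof.
move=> k'k iso; have [phio phibij phiadj] := iso.
have sub v : ball_at adj o k' v -> ball_at adj o k v by move=> /leq_trans; apply.
split=> //; last by move=> u v /sub bu /sub bv; exact: phiadj.
split.
- move=> v /(ball_atP conn)[n nk' ov]; apply/(ball_atP conn'); exists n => //.
  by apply: ball_iso_walk iso _ ov; exact: leq_trans k'k.
- move=> u v; rewrite !inE => /sub bu /sub bv.
  by apply: (set_bij_inj phibij); rewrite inE.
- move=> v' /(ball_atP conn')[n nk' xv'].
  have [v ov phiv] := ball_iso_walk_lift iso (leq_trans nk' k'k) xv'.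
  by exists v => //; apply/(ball_atP conn); exists n.
Qed.

End BallIso.

(** Common interface for T_sigma and T*_sigma. Making the root its own parent keeps iterated parents
    total and the depth formula valid at the root. *)
Definition is_rooted_tree (V : choiceType) (o : V) (parent : V -> V)
    (depth : V -> nat) : Prop :=
  [/\ parent o = o, forall v, depth (parent v) = (depth v).-1 &
      forall v, (depth v == 0%N) = (v == o)].

Section RootedTree.
Variables (V : choiceType) (o : V) (parent : V -> V) (depth : V -> nat).
Hypothesis tr : is_rooted_tree o parent depth.
Local Notation adj := (parent_adj o parent).

Definition bond v : {fset V} := [fset v; parent v]%fset.

Lemma depth_parent v : depth (parent v) = (depth v).-1. Proof. by case: tr. Qed.
Lemma depth_eq0 v : (depth v == 0%N) = (v == o). Proof. by case: tr. Qed.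
Lemma depth_root : depth o = 0%N. Proof. by apply/eqP; rewrite depth_eq0. Qed.

Lemma depth_gt0 v : (0 < depth v)%N = (v != o).
Proof. by rewrite lt0n depth_eq0. Qed.

Lemma depth_parentS v : v != o -> depth v = (depth (parent v)).+1.
Proof. by rewrite -depth_gt0 depth_parent => /prednK. Qed.

Lemma parent_adjP u v :
  reflect ((v != o /\ parent v = u) \/ (u != o /\ parent u = v)) (adj u v).
Proof.
apply: (iffP orP) => -[|].
- by move=> /andP[? /eqP]; left.
- by move=> /andP[? /eqP]; right.
- by move=> [? /eqP ?]; left; apply/andP.
- by move=> [? /eqP ?]; right; apply/andP.
Qed.

Lemma parent_adj_sym u v : adj u v = adj v u.
Proof. by rewrite /parent_adj orbC. Qed.

Lemma adj_parent v : v != o -> adj v (parent v).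
Proof. by move=> vo; apply/parent_adjP; right. Qed.

Lemma bonds_bond v : v != o -> bonds adj (bond v).
Proof. by move=> vo; exists v, (parent v); split=> //; exact: adj_parent. Qed.

Lemma bondsP e : bonds adj e <-> exists2 v, v != o & e = bond v.
Proof.
split=> [[u [v [/parent_adjP[[vo <-]|[uo <-]] ->]]]|[v vo ->]].
- by exists v => //; rewrite /bond fsetUC.
- by exists u.
- exact: bonds_bond.
Qed.

Lemma bond_eq_adj u v : adj u v -> [fset u; v]%fset = bond u /\ u != o /\ parent u = v \/
  [fset u; v]%fset = bond v /\ v != o /\ parent v = u.
Proof.
move=> /parent_adjP[[vo e]|[uo e]]; [right|left]; split; rewrite /bond ?e//.
by rewrite fsetUC.
Qed.

Lemma bond_inj u v : u != o -> v != o -> bond u = bond v -> u = v.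
Proof.
move=> uo vo e.
have : u \in bond v by rewrite -e !inE eqxx.
have : v \in bond u by rewrite e !inE eqxx.
rewrite !inE => /orP[/eqP->//|/eqP vu] /orP[/eqP//|/eqP uv].
have := depth_parentS vo; have := depth_parentS uo.
by rewrite -vu -uv; lia.
Qed.

Lemma iter_parent_depth n v : depth (iter n parent v) = (depth v - n)%N.
Proof. by elim: n => [|n IH]; rewrite ?subn0// iterS depth_parent IH -subnS. Qed.

Lemma iter_parent_root v n : (depth v <= n)%N -> iter n parent v = o.
Proof. by move=> vn; apply/eqP; rewrite -depth_eq0 iter_parent_depth subn_eq0. Qed.

Lemma tree_ind (Q : V -> Prop) : Q o ->
  (forall v, v != o -> Q (parent v) -> Q v) -> forall v, Q v.
Proof.
move=> Qo QS v; elim: {v}(depth v) {-2}v (erefl (depth v)) => [|n IH] v dv.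
  by suff -> : v = o by []; apply/eqP; rewrite -depth_eq0 dv.
have vo : v != o by rewrite -depth_gt0 dv.
by apply: QS => //; apply: IH; rewrite depth_parent dv.
Qed.

Lemma walk_root v : walk_length adj o v (depth v).
Proof.
elim/tree_ind: v => [|v vo IH]; first by rewrite depth_root walk_length0.
rewrite depth_parentS//; apply/walk_lengthS; exists (parent v) => //.
by rewrite parent_adj_sym adj_parent.
Qed.

Lemma walk_length_rev u v n : walk_length adj u v n -> walk_length adj v u n.
Proof.
elim: n u v => [|n IH] u v; first by rewrite !walk_length0.
move=> [[|w p] [] //= /andP[uw wp] lp [sp]].
apply/walk_lengthS; exists w; last by rewrite parent_adj_sym.
by apply: IH; exists p.
Qed.

Lemma tree_connected : connected_graph adj.
Proof.
move=> u v; have [p [pp lp sp]] := walk_length_rev (walk_root u).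
have [q [pq lq sq]] := walk_root v.
exists (size (p ++ q)), (p ++ q); split=> //; last by rewrite last_cat lp.
by rewrite cat_path pp lp.
Qed.

Lemma walk_depth v n : walk_length adj o v n -> (depth v <= n)%N.
Proof.
elim: n v => [|n IH] v; first by move=> /walk_length0 <-; rewrite depth_root.
move=> /walk_lengthS[u /IH un /parent_adjP[[vo vu]|[uo <-]]].
  by rewrite depth_parentS// vu.
by rewrite depth_parent; lia.
Qed.

Lemma gdist_root v : gdist adj o v = depth v.
Proof.
have [w wmin] := gdistP tree_connected o v; apply/eqP; rewrite eqn_leq.
by rewrite walk_depth// andbT wmin//; exact: walk_root.
Qed.

Lemma ball_root k v : ball_at adj o k v = (depth v <= k)%N.
Proof. by rewrite /ball_at /= gdist_root. Qed.

Lemma bonds_in_ballP k e : bonds_in_ball adj o k e <->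
  exists v, [/\ v != o, (depth v <= k)%N & e = bond v].
Proof.
split=> [[/bondsP[v vo ->] sub]|[v [vo vk ->]]].
  exists v; split=> //; rewrite -ball_root; apply: sub => /=.
  by rewrite !inE eqxx.
split; first exact: bonds_bond.
move=> u /=; rewrite ball_root !inE => /orP[/eqP->//|/eqP->].
by rewrite depth_parent; lia.
Qed.

Definition chain_open (st : {fset V} -> bool) v : Prop :=
  forall n, iter n parent v != o -> st (bond (iter n parent v)).

Lemma chain_open_root st : chain_open st o.
Proof. by move=> n; rewrite iter_parent_root ?depth_root// eqxx. Qed.

Lemma chain_openS st v : v != o ->
  chain_open st v <-> st (bond v) /\ chain_open st (parent v).
Proof.
move=> vo; split=> [h|[sv h] [|n]]; last 2 first.
- by move=> _; exact: sv.
- by rewrite iterSr; exact: h.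
by split=> [|n]; [exact: (h 0%N)|have := h n.+1; rewrite iterSr].
Qed.

(** A walk from the root may backtrack, so the proof follows it step by step: a step towards the
    root inherits the open chain, a step away from it adds the bond just crossed. *)
Lemma open_connectedP st v : open_connected adj st o v <-> chain_open st v.
Proof.
split=> [[p [pp <-]]|].
  elim/last_ind: p pp => [|p z IH]; first by move=> _; exact: chain_open_root.
  rewrite rcons_path last_rcons => /andP[/IH h /andP[/bond_eq_adj []]].
    move=> [-> [uo <-]] su; exact: ((chain_openS _ uo).1 h).2.
  by move=> [-> [zo e]] sz; apply/chain_openS => //; rewrite e.
elim/tree_ind: v => [_|v vo IH]; first by exists [::].
move=> /(chain_openS _ vo)[sv /IH[p [pp lp]]]; exists (rcons p v).
rewrite rcons_path last_rcons pp lp parent_adj_sym adj_parent//=.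
by rewrite fsetUC sv.
Qed.

Lemma open_cluster_bond st v : v != o ->
  open_cluster adj o st (bond v) <-> chain_open st v.
Proof.
move=> vo; split=> [[_ sv [u [+ /open_connectedP uo]]]|h].
  rewrite !inE => /orP[/eqP<-//|/eqP e]; apply/chain_openS => //.
  by rewrite -e.
split; [exact: bonds_bond|exact: ((chain_openS _ vo).1 h).1|].
by exists v; split; [rewrite !inE eqxx|apply/open_connectedP].
Qed.

End RootedTree.

(** * The tree seen from one of its vertices *)

Section Trees.
Variable s : nat.
Local Notation letter := 'I_s.
Local Notation "'oS'" := (star_root s).
Local Notation starp := (@parent_star s).

Definition star_depth (v : tree_star s) : nat :=
  if v is Some (_, w) then (size w).+1 else 0%N.

Lemma tree_rooted : is_rooted_tree (tree_root s) (@behead letter) size.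
Proof.
by split=> // [v|v]; rewrite ?size_behead// size_eq0.
Qed.

Lemma star_rooted : is_rooted_tree oS starp star_depth.
Proof.
by split=> // [[[a [|i w]]|]|[[a w]|]].
Qed.

Lemma tree_normE (x : tree s) : tree_norm x = size x.
Proof. exact: (gdist_root tree_rooted). Qed.

Lemma parent_morphism_automorphism (g g' : tree_star s -> tree_star s) :
  cancel g g' -> cancel g' g -> g oS = oS ->
  (forall v, starp (g v) = g (starp v)) ->
  rooted_automorphism (tree_star_adj s) oS g.
Proof.
move=> gK g'K go gp; split=> // [|u v]; first by exists g'.
have gE a b : (g a == g b) = (a == b) by apply/inj_eq/(can_inj gK).
have gE0 a : (g a == oS) = (a == oS) by rewrite -{1}go gE.
by rewrite /tree_star_adj /parent_adj !gp !gE0 !gE.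
Qed.

Section Swap.
Variables (z : letter) (a : 'I_s.+1) (w : seq letter).

(** The letter of each generation undergoes the transposition of [z] with the letter of [w] of that
    generation. Since the transposition depends on the generation only, the map is an involutive
    automorphism, and it carries the constant word [z] to [w]. The reversal of [w] is due to words
    listing the most recent letter first. *)
Fixpoint swap_word (u : seq letter) : seq letter :=
  if u is c :: u' then tperm z (nth z (rev w) (size u')) c :: swap_word u'
  else [::].

Definition swap_aut (v : tree_star s) : tree_star s :=
  if v is Some (b, u) then Some (tperm ord0 a b, swap_word u) else None.

Lemma size_swap_word u : size (swap_word u) = size u.
Proof. by elim: u => //= c u ->. Qed.

Lemma swap_wordK : involutive swap_word.
Proof. by elim=> //= c u IH; rewrite size_swap_word tpermK IH. Qed.

Lemma swap_autK : involutive swap_aut.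
Proof. by case=> [[b u]|]//=; rewrite tpermK swap_wordK. Qed.

Lemma swap_aut_automorphism :
  rooted_automorphism (tree_star_adj s) oS swap_aut.
Proof.
apply: (parent_morphism_automorphism swap_autK swap_autK) => //.
by case=> [[b [|c u]]|].
Qed.

Lemma swap_word_nseq j : (j <= size w)%N ->
  swap_word (nseq j z) = drop (size w - j) w.
Proof.
elim: j => [|j IH] jw; first by rewrite subn0 drop_size.
rewrite /= IH ?size_nseq; last exact: ltnW.
rewrite tpermL nth_rev// (drop_nth z (n := size w - j.+1)); last by lia.
by congr (_ :: drop _ _); lia.
Qed.

Lemma swap_aut_ray : swap_aut (Some (ord0, nseq (size w) z)) = Some (a, w).
Proof. by rewrite /= tpermL swap_word_nseq// subnn drop0. Qed.

Lemma swap_aut_depth v : star_depth (swap_aut v) = star_depth v.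
Proof. by case: v => [[b u]|]//=; rewrite size_swap_word. Qed.

End Swap.

Section Upward.
Variables (z : letter) (x : tree s).

Definition on_ray (v : tree_star s) : bool :=
  if v is Some (a, w) then (a == ord0) && all (pred1 z) w else true.

Definition ray (j : nat) : tree_star s :=
  if j is j'.+1 then Some (ord0, nseq j' z) else None.

(* The ball around x read from x: letter z (or ord0 for the first step) moves
   to the parent as long as the walk is on the ray from x to the root; the
   transposition exchanges z with the letter of the child it came from. *)
Fixpoint upward_word (a : 'I_s.+1) (w : seq letter) : tree s :=
  match w with
  | [::] => if unlift ord0 a is Some c then c :: x else behead x
  | c :: w' =>
    if (a == ord0) && all (pred1 z) w' then
      if c == z then behead (drop (size w').+1 x)
      else tperm z (nth z x (size w')) c :: drop (size w').+1 x
    else c :: upward_word a w'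
  end.

Definition upward (v : tree_star s) : tree s :=
  if v is Some (a, w) then upward_word a w else x.

Lemma on_rayP v : on_ray v -> v = ray (star_depth v).
Proof.
case: v => [[a w]|]//= /andP[/eqP-> aw]; congr (Some (_, _)).
exact/all_pred1P.
Qed.

Lemma on_ray_ray j : on_ray (ray j).
Proof. by case: j => //= j; rewrite all_pred1_nseq ?eqxx ?orbT. Qed.

Lemma depth_ray j : star_depth (ray j) = j.
Proof. by case: j => //= j; rewrite size_nseq. Qed.

Lemma behead_drop (T : Type) (t : seq T) j : behead (drop j t) = drop j.+1 t.
Proof. by rewrite -drop1 drop_drop add1n. Qed.

Lemma upward_ray j : upward (ray j) = drop j x.
Proof.
case: j => [|j] /=; first by rewrite drop0.
case: j => [|j] /=; first by rewrite unlift_none drop1.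
by rewrite !eqxx all_pred1_nseq ?orbT /= size_nseq behead_drop.
Qed.

Lemma parent_ray j : starp (ray j.+1) = ray j.
Proof. by case: j. Qed.

Lemma on_ray_parent v : on_ray v -> on_ray (starp v).
Proof. by case: v => [[a [|c w]]|]//= /and3P[-> _ ->]. Qed.

Lemma upward_off_ray v : ~~ on_ray v ->
  upward v != [::] /\ behead (upward v) = upward (starp v).
Proof.
case: v => [[a [|c w]]|]//=.
  by rewrite andbT; case: unliftP => [b ->|->]//; rewrite eqxx.
case: ifP => /= [/andP[/eqP-> aw] |aw nr]; last by [].
rewrite aw andbT/= => cz; rewrite (negPf cz); split=> //.
by rewrite (all_pred1P _ _ aw) size_nseq -[RHS]/(upward (ray (size w).+1)) upward_ray.
Qed.

Lemma upward_on_ray v : v != oS -> on_ray v ->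
  upward v = behead (upward (starp v)).
Proof.
rewrite -(depth_gt0 star_rooted) => + /on_rayP; case: (star_depth v) => // j _ ->.
by rewrite parent_ray !upward_ray behead_drop.
Qed.

Lemma upward_on_ray_neq0 v : v != oS -> on_ray v -> (star_depth v <= size x)%N ->
  upward (starp v) != [::].
Proof.
rewrite -(depth_gt0 star_rooted) => + /on_rayP; case: (star_depth v) => // j _ -> jx.
by rewrite parent_ray upward_ray -size_eq0 size_drop -lt0n subn_gt0.
Qed.

(** A vertex off the ray never lands on an ancestor of [x]. Where its path leaves the ray, the
    letter differs from [z], and the transposition in [upward_word] then avoids exactly the child
    through which the ray came; below that point the path only descends further. *)
Lemma upward_suffix v j : ~~ on_ray v -> (star_depth v <= size x)%N ->
  upward v <> drop j x.
Proof.
elim/(tree_ind star_rooted): v j => [//|v vo IH] j rv vx e.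
have [uv bv] := upward_off_ray rv.
have [rp|rp] := boolP (on_ray (starp v)); last first.
  apply: (IH j.+1 rp); last by rewrite -bv e behead_drop.
  by rewrite (depth_parent star_rooted); lia.
case: v vo vx rv e rp {IH uv bv} => // -[a [|c w]] _ vx rv e rp.
  move: rv e; rewrite /= andbT; case: unliftP => [b _ _ /(congr1 size)|-> //].
  by rewrite /= size_drop; lia.
move: vx rp rv e => /= vx /andP[a0 aw]; rewrite a0 aw !andbT /= => cz.
rewrite (negPf cz) => e.
have /(congr1 size) := e; rewrite /= !size_drop => ej.
have jw : j = size w by move: vx ej; move: (size w) (size x) => p q; lia.
move: e; rewrite jw (drop_nth z (n := size w)); last by lia.
move=> [/(canRL (tpermK z _))]; rewrite tpermR => cE.
by rewrite cE eqxx in cz.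
Qed.

Lemma upward_inj u v : (star_depth u <= size x)%N -> (star_depth v <= size x)%N ->
  upward u = upward v -> u = v.
Proof.
elim/(tree_ind star_rooted): u v => [|u uo IH] v ux vx e.
  have [rv|rv] := boolP (on_ray v); last first.
    by case: (@upward_suffix v 0%N); rewrite ?drop0.
  move: vx e; rewrite (on_rayP rv) upward_ray depth_ray => vx /(congr1 size) /=.
  rewrite size_drop; case: (star_depth v) vx => // p; move: (size x) => q; lia.
have [ru|ru] := boolP (on_ray u); have [rv|rv] := boolP (on_ray v).
- move: e ux vx; rewrite (on_rayP ru) (on_rayP rv) !upward_ray !depth_ray.
  by move=> /(congr1 size); rewrite !size_drop => e ux vx; congr ray; lia.
- by case: (@upward_suffix v (star_depth u) rv vx); rewrite -e (on_rayP ru) upward_ray depth_ray.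
- by case: (@upward_suffix u (star_depth v) ru ux); rewrite e (on_rayP rv) upward_ray depth_ray.
have [_ bu] := upward_off_ray ru; have [_ bv] := upward_off_ray rv.
have puv : starp u = starp v.
  by apply: IH; rewrite ?(depth_parent star_rooted) -?bu -?bv ?e//; lia.
case: u uo ru rv e puv {IH ux vx bu bv} => // -[a [|c w]] _; case: v => [[b [|c' w']]|]//=.
  rewrite !andbT; case: unliftP => [i ->|->//]; case: unliftP => [j ->|->//].
  by move=> _ _ [->].
move=> ru rv e [ab ww']; move: ru rv e; rewrite -ab -ww'.
case: ifP => [/andP[/eqP-> aw]|_ _ _ [->]//].
rewrite aw !andbT /= => cz c'z; rewrite (negPf cz) (negPf c'z) => -[/perm_inj->//].
Qed.

Lemma upward_adj v : v != oS -> (star_depth v <= size x)%N ->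
  tree_adj s (upward v) (upward (starp v)).
Proof.
move=> vo vx; apply/(parent_adjP (tree_root s)).
have [rv|/upward_off_ray[uv bv]] := boolP (on_ray v).
  by left; rewrite upward_on_ray_neq0// -upward_on_ray.
by right; split=> //; apply/eqP.
Qed.

Lemma upward_lift v t : (star_depth v < size x)%N -> tree_adj s (upward v) t ->
  exists2 u, tree_star_adj s v u & upward u = t.
Proof.
move=> vx.
have child u : u != oS -> starp u = v -> tree_star_adj s v u.
  by move=> uo pu; apply/(parent_adjP oS); left.
have par : v != oS -> tree_star_adj s v (starp v) := @adj_parent _ oS starp v.
have [rv|rv] := boolP (on_ray v); move=> /(parent_adjP (tree_root s)).
  have vE := on_rayP rv; have -> : upward v = drop (star_depth v) x by rewrite {1}vE upward_ray.
  move=> [[t0 bt]|[_ <-]]; last first.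
    exists (ray (star_depth v).+1); last by rewrite upward_ray behead_drop.
    by apply: child; rewrite // parent_ray -vE.
  case: t t0 bt => // c t _ /= ->.
  case dv: (star_depth v) vE => [|j] vE.
    exists (Some (lift ord0 c, [::])); last by rewrite /= liftK drop0.
    by apply: child => //; rewrite vE.
  have [->|cx] := eqVneq c (nth z x j).
    exists (ray j); last first.
      by rewrite upward_ray -drop_nth//; move: vx; rewrite dv => /ltnW.
    by rewrite -parent_ray -vE; apply: par; rewrite vE.
  exists (Some (ord0, tperm z (nth z x j) c :: nseq j z)).
    by apply: child => //=; rewrite vE.
  rewrite /= ?eqxx all_pred1_nseq ?orbT /= size_nseq tpermK ifF//.
  apply/negbTE; apply: contraNneq cx => h.
  by rewrite -(tpermK z (nth z x j) c) h tpermL.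
have [uv bv] := upward_off_ray rv.
move=> [[t0 bt]|[_ <-]]; last first.
  by exists (starp v) => //; apply: par; apply: contraNneq rv => ->.
case: t t0 bt => // c t _ /= ->.
case: v vx child par rv uv bv => // -[a w] vx child par rv uv bv.
by exists (Some (a, c :: w)); [exact: child|rewrite /= ifF//; exact: negPf rv].
Qed.

(** Adjacency is reflected by lifting an edge of the image to a neighbour in T*_sigma and using
    injectivity. The neighbour may have depth k + 1, which is why [k] must be smaller than the depth
    of [x]. *)
Lemma upward_ball_iso k : (k < size x)%N ->
  ball_iso (tree_star_adj s) (tree_adj s) k oS x upward.
Proof.
move=> kx.
have connS := tree_connected star_rooted; have connT := tree_connected tree_rooted.
have bk v : ball_at (tree_star_adj s) oS k v -> (star_depth v <= k)%N.
  by rewrite (ball_root star_rooted).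
have adjE u v : (star_depth u <= k)%N -> (star_depth v <= k)%N ->
    tree_adj s (upward u) (upward v) = tree_star_adj s u v.
  move=> uk vk; apply/idP/idP => [|/parent_adjP[[vo <-]|[uo <-]]]; last 2 first.
  - by rewrite /tree_adj parent_adj_sym; apply: upward_adj => //; lia.
  - by rewrite upward_adj//; lia.
  move=> /upward_lift[|w uw /upward_inj <-//]; try lia.
  by move/parent_adjP: uw => [[wo uE]|[uo <-]];
    [rewrite (depth_parentS star_rooted wo) uE|rewrite (depth_parent star_rooted)]; lia.
have walkT n v : (n <= k)%N -> walk_length (tree_star_adj s) oS v n ->
    walk_length (tree_adj s) x (upward v) n.
  elim: n v => [|n IH] v nk; first by rewrite !walk_length0 => <-.
  move=> h; have vn := walk_depth star_rooted h.
  move/walk_lengthS: h => [u ou uv]; apply/walk_lengthS; exists (upward u).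
    by apply: IH => //; lia.
  by rewrite adjE//; [have := walk_depth star_rooted ou; lia|lia].
have walkS n t : (n <= k)%N -> walk_length (tree_adj s) x t n ->
    exists2 v, walk_length (tree_star_adj s) oS v n & upward v = t.
  elim: n t => [|n IH] t nk.
    by move=> /walk_length0 <-; exists oS => //; apply/walk_length0.
  move=> /walk_lengthS[t' xt' tt']; have [v ov vt'] := IH _ (ltnW nk) xt'.
  have vn := walk_depth star_rooted ov; rewrite -vt' in tt'.
  have [|u vu <-] := upward_lift _ tt'; first by lia.
  by exists u => //; apply/walk_lengthS; exists v.
split=> //; last by move=> u v /bk uk /bk vk; exact: adjE.
split.
- move=> v /(ball_atP connS)[n nk ov]; apply/(ball_atP connT); exists n => //.
  exact: walkT.
- move=> u v; rewrite !inE => /bk uk /bk vk; apply: upward_inj; lia.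
- move=> t /(ball_atP connT)[n nk xt]; have [v ov <-] := walkS _ _ nk xt.
  by exists v => //; apply/(ball_atP connS); exists n.
Qed.

(* The bond of the tree that corresponds to [bond v], named by its endpoint
   farther from the root of the tree. *)
Definition upward_child v : tree s := if on_ray v then upward (starp v) else upward v.

Lemma upward_bond v : v != oS ->
  [fset upward t | t in bond starp v]%fset = bond (@behead letter) (upward_child v).
Proof.
move=> vo; rewrite /bond imfsetU !imfset_fset1 /upward_child.
have [rv|rv] := boolP (on_ray v); first by rewrite -upward_on_ray// fsetUC.
by have [_ ->] := upward_off_ray rv.
Qed.

Lemma upward_child_neq0 v : v != oS -> (star_depth v <= size x)%N ->
  upward_child v != [::].
Proof.
move=> vo vx; rewrite /upward_child; have [rv|rv] := boolP (on_ray v).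
  exact: upward_on_ray_neq0.
by have [] := upward_off_ray rv.
Qed.

Lemma upward_child_inj u v : u != oS -> v != oS ->
  (star_depth u <= size x)%N -> (star_depth v <= size x)%N ->
  upward_child u = upward_child v -> u = v.
Proof.
move=> uo vo ux vx /(congr1 (bond (@behead letter))).
rewrite -!upward_bond// => e; apply: (bond_inj star_rooted uo vo).
have sub (a b : tree_star s) : (star_depth a <= size x)%N -> (star_depth b <= size x)%N ->
    [fset upward t | t in bond starp a]%fset = [fset upward t | t in bond starp b]%fset ->
    {subset bond starp a <= bond starp b}.
  have dep (c t : tree_star s) : (star_depth c <= size x)%N -> t \in bond starp c ->
      (star_depth t <= size x)%N.
    by rewrite !inE => cx /orP[/eqP->//|/eqP->]; rewrite (depth_parent star_rooted); lia.
  move=> ax bx eab t ta.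
  have : upward t \in [fset upward t | t in bond starp b]%fset.
    by rewrite -eab in_imfset.
  by move=> /imfsetP[/= t' t'b /upward_inj ->//]; [exact: dep ta|exact: dep t'b].
by apply/fsetP => t; apply/idP/idP; apply: sub.
Qed.

Lemma upward_below v m : (star_depth v <= m)%N ->
  exists t, upward v = t ++ drop m x.
Proof.
elim/(tree_ind star_rooted): v => [|v vo IH] vm.
  by exists (take m x); rewrite cat_take_drop.
have [rv|/upward_off_ray[uv bv]] := boolP (on_ray v).
  exists (take (m - star_depth v) (drop (star_depth v) x)).
  rewrite {1}(on_rayP rv) upward_ray -{1}(cat_take_drop (m - star_depth v) (drop _ x)).
  by rewrite drop_drop subnK.
have [|t et] := IH; first by rewrite (depth_parent star_rooted); lia.
by case: (upward v) uv bv => // c u _ /= ->; exists (c :: t); rewrite et.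
Qed.

(** The letter [c] in front is the point: all bonds of the m-ball lie strictly below the ancestor
    [drop m x], hence are independent of whether this ancestor is invaded. *)
Lemma upward_child_below v m : v != oS -> (star_depth v <= m)%N ->
  (m <= size x)%N -> exists c t, upward_child v = c :: t ++ drop m x.
Proof.
move=> vo vm mx; rewrite /upward_child; have [rv|rv] := boolP (on_ray v).
  have [|[|c t] e] := @upward_below (starp v) m; last by exists c, t.
    by rewrite (depth_parent star_rooted); lia.
  move: e; rewrite (on_rayP (on_ray_parent rv)) upward_ray (depth_parent star_rooted).
  move=> /(congr1 size); rewrite /= !size_drop.
  move: vo vm mx; rewrite -(depth_gt0 star_rooted).
  by move: (star_depth v) (size x) => p q; lia.
have [[|c t] e] := upward_below vm; last by exists c, t.
by case: (upward_suffix (j := m) rv (leq_trans vm mx)).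
Qed.

End Upward.
End Trees.

(** * The shifted event does not depend on the chosen isomorphism *)

Section ExtendBallIsometry.
Variables (s : nat) (x : tree s) (k : nat).
Local Notation oS := (star_root s).
Local Notation starp := (@parent_star s).
Implicit Types (phi psi : tree_star s -> tree s).
Local Notation iso := (ball_iso (tree_star_adj s) (tree_adj s) k oS x).

Let connS := tree_connected (star_rooted s).
Let connT := tree_connected (tree_rooted s).

(** The map psi^-1 o phi. The depth bound confines the search to the ball, where [psi] is injective,
    so the choice is unique and inside the ball the default is never taken. *)
Definition transition phi psi (v : tree_star s) : tree_star s :=
  xget None [set u | (star_depth u <= k)%N /\ psi u = phi v].

(** An isomorphism of balls restricts to all smaller concentric balls, so the transition cannot
    increase depth. The reverse transition cannot either, and it is the inverse; hence depth is
    preserved. *)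
Lemma transitionP phi psi v : iso phi -> iso psi -> (star_depth v <= k)%N ->
  star_depth (transition phi psi v) = star_depth v /\
  psi (transition phi psi v) = phi v.
Proof.
have half ph ps u : iso ph -> iso ps -> (star_depth u <= k)%N ->
    (star_depth (transition ph ps u) <= star_depth u)%N /\
    ps (transition ph ps u) = ph u.
  move=> iph ips uk.
  have [_ [im _ _] _] := ball_iso_le connS connT uk iph.
  have [_ [_ _ sur] _] := ball_iso_le connS connT uk ips.
  have [t bt te] : exists2 t, (star_depth t <= star_depth u)%N & ps t = ph u.
    have /im/sur[t bt te] : ball_at (tree_star_adj s) oS (star_depth u) u.
      by rewrite (ball_root (star_rooted s)).
    by exists t => //; move: bt; rewrite (ball_root (star_rooted s)).
  rewrite /transition; case: xgetP => [_ -> [tk tE]|/(_ t)[]]; last first.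
    by split=> //; exact: leq_trans bt uk.
  split=> //; have [_ [_ inj _] _] := ips.
  suff -> : xget None [set u0 | (star_depth u0 <= k)%N /\ ps u0 = ph u] = t by [].
  apply: inj; rewrite ?inE ?(ball_root (star_rooted s))//; last by rewrite tE.
  exact: leq_trans bt uk.
move=> iph ips vk.
have [h1 e1] := half _ _ _ iph ips vk.
have tk := leq_trans h1 vk.
have [h2 e2] := half _ _ _ ips iph tk.
split=> //; apply/eqP; rewrite eqn_leq h1/=.
have [_ [_ inj _] _] := iph.
suff e : transition psi phi (transition phi psi v) = v by rewrite -{1}e.
apply: inj; rewrite ?inE ?(ball_root (star_rooted s))//; last by rewrite e2.
exact: leq_trans h2 tk.
Qed.

Lemma transitionK phi psi v : iso phi -> iso psi -> (star_depth v <= k)%N ->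
  transition psi phi (transition phi psi v) = v.
Proof.
move=> iph ips vk; have [d1 e1] := transitionP iph ips vk.
have tk : (star_depth (transition phi psi v) <= k)%N by rewrite d1.
have [d2 e2] := transitionP ips iph tk.
have [_ [_ inj _] _] := iph.
by apply: inj; rewrite ?inE ?(ball_root (star_rooted s))//= ?d2 ?d1// e2.
Qed.

Lemma transition_parent phi psi v : iso phi -> iso psi -> (star_depth v <= k)%N ->
  starp (transition phi psi v) = transition phi psi (starp v).
Proof.
move=> iph ips vk; have [d1 e1] := transitionP iph ips vk.
have [->|vo] := eqVneq v oS.
  have [d2 e2] := transitionP iph ips (leq0n k : (star_depth oS <= k)%N).
  suff -> : transition phi psi oS = oS by [].
  by apply/eqP; rewrite -(depth_eq0 (star_rooted s)) d2.
have dv := depth_parentS (star_rooted s) vo.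
have pk : (star_depth (starp v) <= k)%N by lia.
have [d2 e2] := transitionP iph ips pk.
have [_ _ adph] := iph; have [_ _ adps] := ips.
have : tree_star_adj s (transition phi psi v) (transition phi psi (starp v)).
  rewrite -adps ?(ball_root (star_rooted s)) ?d1 ?d2// e1 e2.
  rewrite adph ?(ball_root (star_rooted s))//; exact: adj_parent.
move=> /(parent_adjP oS)[[to tE]|[to tE]]; last by [].
have := depth_parentS (star_rooted s) to; rewrite tE d1 d2; lia.
Qed.

Definition graft (t : seq 'I_s) (v : tree_star s) : tree_star s :=
  if v is Some (a, w) then Some (a, t ++ w) else None.

(* A rooted automorphism extending the isometry psi^-1 o phi of the k-ball: each
   vertex outside the ball follows its ancestor at level k. *)
Definition extension phi psi (v : tree_star s) : tree_star s :=
  if v is Some (a, w) then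
    let j := (size w - k.-1)%N in
    graft (take j w) (transition phi psi (Some (a, drop j w)))
  else None.

Hypothesis k_gt0 : (0 < k)%N.

Lemma extension_ball phi psi v : iso phi -> iso psi -> (star_depth v <= k)%N ->
  extension phi psi v = transition phi psi v.
Proof.
move=> iph ips; case: v => [[a w]|] /= wk.
  have -> : (size w - k.-1 = 0)%N by move: wk; move: (size w) => q; lia.
  by rewrite take0 drop0; case: transition => [[]|].
have [/eqP + _] := transitionP iph ips (leq0n k : (star_depth oS <= k)%N).
by rewrite (depth_eq0 (star_rooted s)) => /eqP.
Qed.

Lemma extensionK phi psi : iso phi -> iso psi ->
  cancel (extension phi psi) (extension psi phi).
Proof.
move=> iph ips [[a w]|]//=; set j := (size w - k.-1)%N.
have dk : (star_depth (Some (a, drop j w) : tree_star s) <= k)%N.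
  by rewrite /= size_drop /j; move: (size w) => q; lia.
have [d _] := transitionP iph ips dk; have := transitionK iph ips dk.
case: transition d => [[a' w']|]//= [dw] tK.
have sj : size (take j w) = j by rewrite size_takel// /j leq_subr.
have -> : (size (take j w ++ w') - k.-1 = j)%N.
  by rewrite size_cat sj dw size_drop /j; move: (size w) => q; lia.
by rewrite -{1 3}sj take_size_cat// drop_size_cat// tK/= cat_take_drop.
Qed.

Lemma extension_parent phi psi v : iso phi -> iso psi ->
  starp (extension phi psi v) = extension phi psi (starp v).
Proof.
move=> iph ips; have [vk|vk] := leqP (star_depth v) k.
  rewrite !extension_ball// ?transition_parent//.
  by rewrite (depth_parent (star_rooted s)); lia.
case: v vk => [[a [|c w]]|] //= vk; first by move: vk; lia.
have -> : ((size w).+1 - k.-1 = (size w - k.-1).+1)%N.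
  by move: vk; move: (size w) => q; lia.
by rewrite /=; case: transition => [[]|].
Qed.

Lemma extension_automorphism phi psi : iso phi -> iso psi ->
  rooted_automorphism (tree_star_adj s) oS (extension phi psi).
Proof.
move=> iph ips.
apply: (parent_morphism_automorphism (extensionK iph ips) (extensionK ips iph)) => //.
by move=> v; rewrite extension_parent.
Qed.

End ExtendBallIsometry.

Lemma pullback_comp (V V' V'' : choiceType) (f : V -> V') (g : V' -> V'')
    (om : config V'') : pullback f (pullback g om) = pullback (g \o f) om.
Proof.
by apply/seteqP; split=> e; rewrite /pullback /= -imfset_comp.
Qed.

Section TauIndependent.
Variables (s : nat) (E : set (config (tree_star s))).
Hypothesis invE : automorphism_invariant (tree_star_adj s) (star_root s) E.

Lemma invariant_ball_iso (x : tree s) k (phi psi : tree_star s -> tree s) om :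
  depends_on (bonds_in_ball (tree_star_adj s) (star_root s) k) E ->
  ball_iso (tree_star_adj s) (tree_adj s) k (star_root s) x phi ->
  ball_iso (tree_star_adj s) (tree_adj s) k (star_root s) x psi ->
  E (pullback phi om) -> E (pullback psi om).
Proof.
(* A ball of radius 0 contains no bond, so [E] holds for all configurations or for none; [extension]
   handles positive radii. *)
move=> dE iph ips Eph; case: (posnP k) => [k0|k0].
  apply: dE Eph => e /(bonds_in_ballP (star_rooted s))[v [vo + _]].
  by rewrite k0 leqn0 (depth_eq0 (star_rooted s)) (negPf vo).
apply/(invE (extension_automorphism k0 iph ips)).
rewrite pullback_comp; apply: dE Eph => e /(bonds_in_ballP (star_rooted s))[v [vo vk ->]].
have pk : (star_depth (parent_star v) <= k)%N.
  by rewrite (depth_parent (star_rooted s)); lia.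
rewrite /pullback /bond/= !imfsetU !imfset_fset1 /=.
rewrite !(extension_ball k0 iph ips)//.
by have [_ ->] := transitionP iph ips vk; have [_ ->] := transitionP iph ips pk.
Qed.

(** The radius [k1] provided by [tau] is unrelated to [k]. If [k1] is the larger one, the
    isomorphism is restricted to radius [k]; otherwise [E] depends on the ball of radius [k1]
    already and the comparison takes place there. *)
Lemma tauE (z : 'I_s) (x : tree s) k om : (k < size x)%N ->
  depends_on (bonds_in_ball (tree_star_adj s) (star_root s) k) E ->
  tau x E om <-> E (pullback (upward z x) om).
Proof.
move=> kx dE; split=> [[k1 [phi [k1x dE1 iph Eph]]]|Ex]; last first.
  by exists k, (upward z x); split=> //; [rewrite tree_normE|exact: upward_ball_iso].
rewrite tree_normE in k1x.
have [kk1|/ltnW k1k] := leqP k k1.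
  apply: (invariant_ball_iso dE _ (upward_ball_iso _ kx) Eph).
  apply: (ball_iso_le _ _ kk1 iph).
  - exact: (tree_connected (star_rooted s)).
  - exact: (tree_connected (tree_rooted s)).
exact: (invariant_ball_iso dE1 iph (upward_ball_iso _ k1x) Eph).
Qed.

End TauIndependent.

(** * Invasion percolation on the tree *)

Lemma seq_minimum (R : realType) (T : eqType) (f : T -> R) (Q : T -> Prop) (l : seq T) :
  (exists2 x, x \in l & Q x) ->
  exists2 x, x \in l /\ Q x & forall y, y \in l -> Q y -> f x <= f y.
Proof.
elim: l => [|a l IH] [x]; rewrite ?in_nil// => xl Qx.
have [[y yl Qy]|no] := pselect (exists2 y, y \in l & Q y); last first.
  have xa : x = a.
    by move: xl; rewrite inE => /orP[/eqP//|xl]; case: no; exists x.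
  exists x; first by split.
  move=> y; rewrite inE -xa => /orP[/eqP->//|yl Qy].
  by case: no; exists y.
have [|m [ml Qm] mmin] := IH; first by exists y.
have [Qa|nQa] := pselect (Q a); last first.
  exists m; first by rewrite inE ml orbT.
  by move=> t; rewrite inE => /orP[/eqP->|/mmin//].
have [am|/ltW ma] := leP (f a) (f m).
  exists a; first by rewrite inE eqxx.
  move=> t; rewrite inE => /orP[/eqP->//|tl Qt].
  exact: le_trans am (mmin _ tl Qt).
exists m; first by rewrite inE ml orbT.
by move=> t; rewrite inE => /orP[/eqP->//|/mmin].
Qed.

Section Words.
Variable s : nat.

Fixpoint words (n : nat) : seq (tree s) :=
  if n is n'.+1 then [::] :: [seq i :: v | i <- enum 'I_s, v <- words n']
  else [:: [::]].

Lemma mem_words n (v : tree s) : (size v <= n)%N -> v \in words n.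
Proof.
elim: n v => [|n IH] [|i v] //= vn; rewrite inE.
apply/orP; right; apply/allpairsP; exists (i, v) => /=.
by rewrite mem_enum IH.
Qed.

Lemma parent_closed_cat (A : set (tree s)) a v :
  (forall u, A u -> A (behead u)) -> A (a ++ v) -> A v.
Proof. by move=> cA; elim: a => [//|i a IH] /cA. Qed.

Section Reach.
Variable op : tree s -> Prop.

Fixpoint reach (L : nat) (v : tree s) : Prop :=
  if L is L'.+1 then exists i : 'I_s, op (i :: v) /\ reach L' (i :: v) else True.

(** By Koenig's lemma this is the existence of an infinite open ray below [v]. As an intersection
    over finite depths it is visibly measurable, and its probability is a limit of survival
    probabilities. *)
Definition reach_infty v := forall L, reach L v.

Inductive descends (b : tree s) : tree s -> Prop :=
  | descends_refl : descends b b
  | descends_step i u : descends b u -> op (i :: u) -> descends b (i :: u).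

Lemma reachS L v : reach L.+1 v -> reach L v.
Proof.
elim: L v => [//|L IH] v [i [opi /IH ri]]; by exists i.
Qed.

Lemma reach_le L L' v : (L <= L')%N -> reach L' v -> reach L v.
Proof. by move=> /subnK <-; elim: (L' - L)%N => [//|n IH] /reachS. Qed.

Lemma descends_reach b u L : descends b u -> reach L u ->
  (size b <= size u)%N /\ reach (L + (size u - size b)) b.
Proof.
move=> bu; elim: bu L => [L rL|i u' bu' IH opu L rL].
  by rewrite subnn addn0.
have [bu] := IH L.+1 (ex_intro _ i (conj opu rL)).
move=> r; split; first exact: leqW.
by rewrite [size (i :: u')]/= subSn// -addSnnS.
Qed.

(** An open path that goes deeper than every vertex of [A] must leave [A], and its first vertex
    outside is a child of [A] reached by an open bond. This produces the light boundary bond in the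
    invasion. *)
Lemma reach_exit (A : set (tree s)) n0 L v : (forall u, A u -> (size u <= n0)%N) ->
  A v -> reach L v -> (n0 < size v + L)%N ->
  exists u, [/\ u != [::], ~ A u, A (behead u) & op u].
Proof.
move=> An0; elim: L v => [|L IH] v Av.
  by move=> _; rewrite addn0 => h; have := An0 _ Av; rewrite leqNgt h.
move=> [i [opi ri]] h.
have [Ai|nAi] := pselect (A (i :: v)); last by exists (i :: v).
by apply: IH Ai ri _; rewrite /= addSnnS.
Qed.

End Reach.

End Words.

Section InvasionTree.
Variables (R : realType) (s : nat) (z : 'I_s) (w : {fset tree s} -> R).
Local Notation rt := (tree_root s).
Local Notation parent := (@behead 'I_s).
Local Notation wt v := (w (bond parent v)).
Local Notation inv t := (invasion (tree_adj s) rt w t).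
Local Notation cluster := (IPC_vertices (tree_adj s) rt w).

Definition outer (A : set (tree s)) : set (tree s) :=
  [set v | [/\ v != rt, ~ A v & A (parent v)]].

Lemma edge_boundary_outer (A : set (tree s)) e : (forall v, A v -> A (parent v)) ->
  edge_boundary (tree_adj s) A e <-> exists2 v, outer A v & e = bond parent v.
Proof.
move=> cA; split=> [[u [v [uv Au nAv ->]]]|[v [v0 nAv Apv] ->]].
  have [[_ [u0 uE]]|[-> [v0 vE]]] := bond_eq_adj uv.
    by case: nAv; rewrite -uE; exact: cA.
  by exists v => //; split=> //; rewrite vE.
exists (parent v), v; split=> //; last by rewrite /bond fsetUC.
by rewrite /tree_adj parent_adj_sym; exact: adj_parent.
Qed.

(** The exact number [t.+1] of vertices is what the counting argument of [cluster_low_weight]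
    consumes; the depth bound makes [reach_exit] applicable. *)
Definition invasion_inv t : Prop :=
  [/\ exists l, [/\ uniq l, size l = t.+1 & forall v, (inv t).1 v <-> v \in l],
      (inv t).1 rt,
      forall v, (inv t).1 v -> (inv t).1 (parent v),
      forall v, (inv t).1 v -> (size v <= t)%N &
      forall e, (inv t).2 e <-> exists v, [/\ v != rt, (inv t).1 v & e = bond parent v]].

Definition invades t v : Prop :=
  [/\ outer (inv t).1 v, forall u, outer (inv t).1 u -> wt v <= wt u,
      (inv t.+1).1 = (inv t).1 `|` [set v] & (inv t.+1).2 = (inv t).2 `|` [set bond parent v]].

Lemma outer_nonempty (A : set (tree s)) (l : seq (tree s)) : A rt ->
  (forall v, A v <-> v \in l) -> exists v, outer A v.
Proof.
move=> A0 Al; pose n0 := \max_(u <- l) size u.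
have An0 u : A u -> (size u <= n0)%N.
  by move=> /Al ul; rewrite /n0 (big_rem u)//= leq_maxl.
have r L (v : tree s) : reach (fun=> True) L v by elim: L v => [//|L IH] v; exists z.
have [|u [u0 nAu Au _]] := @reach_exit s (fun=> True) A n0 n0.+1 rt An0 A0 (r _ _).
  exact: ltnSn.
by exists u.
Qed.

(** The boundary is finite and nonempty, so some bond is lightest and [xget] never returns its
    default. Whatever bond it picks among ties is the bond above a vertex not yet invaded whose
    parent is. *)
Lemma invasion_step_exists t : invasion_inv t -> exists v, invades t v.
Proof.
move=> [[l [ul sl Al]] A0 cA _ _].
have [v0 ov0] := outer_nonempty A0 Al.
have children v : outer (inv t).1 v -> v \in [seq i :: u | i <- enum 'I_s, u <- l].
  case: v => [[]//|i v] [_ _ /Al vl]; apply/allpairsP; exists (i, v) => /=.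
  by rewrite mem_enum.
have [|v [_ ov] vmin] := @seq_minimum R _ (fun v => wt v) (outer (inv t).1)
    [seq i :: u | i <- enum 'I_s, u <- l].
  by exists v0 => //; exact: children.
have bnd := edge_boundary_outer _ cA.
have lv : lightest w (edge_boundary (tree_adj s) (inv t).1) (bond parent v).
  split; first by apply/bnd; exists v.
  by move=> e' /bnd[u ou ->]; apply: vmin => //; exact: children.
have [e eE] : exists e, e = xget fset0 (lightest w (edge_boundary (tree_adj s) (inv t).1)).
  by eexists.
have le : lightest w (edge_boundary (tree_adj s) (inv t).1) e.
  by rewrite eE; apply: (@xgetPex _ fset0); exists (bond parent v).
have [/bnd[u ou uE] umin] := le.
exists u; split=> //.
- by move=> u' ou'; rewrite -uE; apply: umin; apply/bnd; exists u'.
- rewrite /invasion iterS -/(inv t) /invasion_step /= -eE uE.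
  apply/seteqP; split=> [a [Aa|]|a [Aa|->]]; first by left.
  + rewrite /= !inE => /orP[/eqP->|/eqP->]; first by right.
    by left; case: ou.
  + by left.
  + by right; rewrite /= !inE eqxx.
- by rewrite /invasion iterS -/(inv t) /invasion_step /= -eE uE.
Qed.

Lemma invasionP t : invasion_inv t.
Proof.
elim: t => [|t IH].
  split=> //=.
  - by exists [:: rt]; split=> // v; rewrite inE; split=> [->|/eqP->].
  - by move=> v ->.
  - by move=> v ->.
  - by move=> e; split=> // -[v [+ vE]]; rewrite vE eqxx.
have [v [[v0 nAv Apv] _ E1 E2]] := invasion_step_exists IH.
have [[l [ul sl Al]] A0 cA sA bA] := IH.
split.
- exists (v :: l); split=> [||u]; last 1 first.
    by rewrite E1 inE; split=> [[/Al->|->]|/orP[/eqP->|/Al]]; rewrite ?orbT ?eqxx//; [right|left].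
  + by rewrite /= ul andbT; apply/negP => /Al.
  + by rewrite /= sl.
- by rewrite E1; left.
- by move=> u; rewrite E1 => -[/cA|->]; left.
- move=> u; rewrite E1 => -[/sA ut|->]; first exact: leqW.
  by have := sA _ Apv; rewrite size_behead; lia.
- move=> e; rewrite E2 E1; split=> [[/bA[u [u0 Au ->]]|->]|[u [u0 [Au|->] ->]]].
  + by exists u; split=> //; left.
  + by exists v; split=> //; right.
  + by left; apply/bA; exists u.
  + by right.
Qed.

Lemma invadesP t : exists v, invades t v.
Proof. exact: invasion_step_exists (invasionP t). Qed.

Lemma invasion_mono t t' : (t <= t')%N -> (inv t).1 `<=` (inv t').1.
Proof.
move=> /subnK <-; elim: (t' - t)%N => [//|n IH] v /IH h.
by have [u [_ _ + _]] := invadesP (n + t); rewrite addSn => ->; left.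
Qed.

Lemma cluster_root : cluster rt.
Proof. by exists 0%N. Qed.

Lemma cluster_parent v : cluster v -> cluster (parent v).
Proof. by move=> [t _ h]; exists t => //; have [_ _ cA _ _] := invasionP t; exact: cA. Qed.

Lemma cluster_cat a v : cluster (a ++ v) -> cluster v.
Proof. exact: parent_closed_cat cluster_parent. Qed.

Lemma IPC_bondsE v : v != rt ->
  IPC_bonds (tree_adj s) rt w (bond parent v) <-> cluster v.
Proof.
move=> v0; split=> [[t _]|[t _ h]]; have [_ _ _ _ bA] := invasionP t.
  move=> /bA[u [u0 Au /(bond_inj (tree_rooted s) v0 u0) ->]].
  by exists t.
by exists t => //; apply/bA; exists v.
Qed.

Lemma cluster_invaded v : cluster v -> v != rt -> exists t, invades t v.
Proof.
move=> [t _]; elim: t => [|t IH] h v0; first by move: h v0 => /= ->; rewrite eqxx.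
have [u iu] := invadesP t; have [_ _ E1 _] := iu.
by move: h; rewrite E1 => -[h|->]; [exact: IH|exists t].
Qed.

Lemma invaded_weight_le t u p v : invades t u -> (inv t).1 v ->
  reach_infty (fun u => wt u <= p) v -> wt u <= p.
Proof.
move=> [_ umin _ _] Av rv; have [_ _ _ sA _] := invasionP t.
have [|u' [u'0 nA Apu opu']] := reach_exit sA Av (rv t.+1); first by lia.
by apply: le_trans opu'; exact: umin.
Qed.

(* Once v is invaded, a boundary edge of weight at most p is always available. *)
Lemma cluster_weight_le p u v a : cluster u -> u != rt -> parent u = a ++ v ->
  reach_infty (fun u => wt u <= p) v -> wt u <= p.
Proof.
move=> Cu u0 uE rv; have [t iu] := cluster_invaded Cu u0.
apply: (invaded_weight_le iu _ rv).
have [[_ _ +] _ _ _] := iu; rewrite uE; have [_ _ cA _ _] := invasionP t.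
exact: parent_closed_cat cA.
Qed.

(* If [i :: v] were not invaded, all weights invaded after v would be at most p,
   and these infinitely many bonds would percolate below one of the finitely many
   vertices invaded before. *)
Lemma cluster_low_weight p v i : (forall u, ~ reach_infty (fun u => wt u <= p) u) ->
  cluster v -> wt (i :: v) <= p -> cluster (i :: v).
Proof.
move=> noperc [T _ ATv] wi; apply: contrapT => nC.
have late t u : (T <= t)%N -> invades t u -> wt u <= p.
  move=> Tt [_ umin _ _]; apply: le_trans wi; apply: umin; split=> //.
    by move=> h; apply: nC; exists t.
  exact: invasion_mono ATv.
have desc t u : (T <= t)%N -> (inv t).1 u ->
    exists2 b, (inv T).1 b & descends (fun u => wt u <= p) b u.
  elim: t u => [|t IH] u; first by rewrite leqn0 => /eqP-> Au; exists u => //; constructor.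
  rewrite leq_eqVlt => /orP[/eqP->|Tt] Au; first by exists u => //; constructor.
  have [u' iu'] := invadesP t; have [[u'0 _ Apu'] _ E1 _] := iu'.
  move: Au; rewrite E1 => -[/(IH _ Tt)//|->].
  have [b Ab bd] := IH _ Tt Apu'; exists b => //.
  have := late _ _ Tt iu'; case: u' u'0 {iu' E1 Apu'} bd => // j u' _ bd wj.
  exact: descends_step.
have [[l [ul sl Al]] _ _ _ _] := invasionP T.
have [L HL] : exists L, forall b, b \in l -> ~ reach (fun u => wt u <= p) L b.
  elim: l {ul sl Al} => [|b l [L HL]]; first by exists 0%N.
  have [L' HL'] : exists L', ~ reach (fun u => wt u <= p) L' b.
    by apply/existsNP; exact: noperc.
  exists (maxn L L') => c; rewrite inE => /orP[/eqP->|/HL h] r.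
    by apply: HL'; apply: reach_le r; exact: leq_maxr.
  by apply: h; apply: reach_le r; exact: leq_maxl.
(* A vertex invaded by any later time descends along light bonds, in fewer than [L] steps, from a
   vertex of depth at most [T], so it has depth at most [M]. By time [t] there would be more invaded
   vertices than words of length at most [M]. *)
pose M := (T + L)%N; pose t := (T + size (words s M))%N.
have [[l' [ul' sl' Al']] _ _ _ _] := invasionP t.
suff : (size l' <= size (words s M))%N by rewrite sl' /t; lia.
apply: uniq_leq_size => // u /Al' Au; apply: mem_words.
have [b Ab bd] := desc t u (leq_addr _ _) Au.
have [bu r] := @descends_reach _ _ b u 0 bd I.
have [_ _ _ sA _] := invasionP T; have bT := sA _ Ab.
have : (size u - size b < L)%N.
  by rewrite ltnNge; apply/negP => h; apply: (HL b); [exact/Al|exact: reach_le r].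
rewrite /M; move: bu bT; move: (size u) (size b) => p1 p2; lia.
Qed.

End InvasionTree.

(** The invasion uses comparisons of weights only, and before [y] is invaded no bond strictly below
    [y] is in the boundary. Two weight functions that order the other bonds alike therefore run the
    same invasion until [y] is reached. *)
Lemma invasion_dependence (R : realType) (s : nat) (z : 'I_s)
    (w w' : {fset tree s} -> R) (y : tree s) t :
  (forall u v : tree s, (0 < size u <= t)%N -> (0 < size v <= t)%N ->
     (forall (c : 'I_s) a, u <> c :: a ++ y) -> (forall (c : 'I_s) a, v <> c :: a ++ y) ->
     (w (bond behead u) <= w (bond behead v)) =
     (w' (bond behead u) <= w' (bond behead v))) ->
  (invasion (tree_adj s) (tree_root s) w t).1 y ->
  (invasion (tree_adj s) (tree_root s) w' t).1 y.
Proof.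
move=> cmp.
pose I (w : {fset tree s} -> R) t := invasion (tree_adj s) (tree_root s) w t.
(* Coupling invariant: either [y] has been reached in both runs, after which they may differ, or the
   two states are still identical. *)
suff key n : (n <= t)%N -> ((I w n).1 y /\ (I w' n).1 y) \/ (I w n = I w' n /\ ~ (I w n).1 y).
  by case: (key t (leqnn t)) => [[]|[e]]; rewrite -/(I w t) -/(I w' t) ?e.
elim: n => [|n IH] nt.
  have [y0|y0] := pselect ((I w 0%N).1 y); by [left|right].
case: (IH (ltnW nt)) => [[yw yw']|[En yn]].
  by left; split; [exact: (invasion_mono z (leqnSn n))|exact: (invasion_mono z (leqnSn n))].
suff ES : I w n.+1 = I w' n.+1.
  by have [yS|yS] := pselect ((I w n.+1).1 y); [left; rewrite -ES|right].
rewrite /I /invasion !iterS -/(invasion _ _ w n) -/(invasion _ _ w' n) -/(I w n) -/(I w' n) -En.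
rewrite /invasion_step.
suff -> : lightest w (edge_boundary (tree_adj s) (I w n).1) =
          lightest w' (edge_boundary (tree_adj s) (I w n).1) by [].
have [_ _ cA sA _] := invasionP z w n.
have bnd := edge_boundary_outer _ cA.
have below u : outer (I w n).1 u -> (0 < size u <= t)%N /\ forall c a, u <> c :: a ++ y.
  move=> [u0 _ Au]; split=> [|c a uE].
    have := sA _ Au; rewrite size_behead; move: u0; rewrite -size_eq0.
    by move: (size u) => q; lia.
  move: Au; rewrite uE /= => Au; apply: yn.
  exact: parent_closed_cat Au.
have cmpb u v : outer (I w n).1 u -> outer (I w n).1 v ->
    (w (bond behead u) <= w (bond behead v)) = (w' (bond behead u) <= w' (bond behead v)).
  by move=> /below[? ?] /below[? ?]; exact: cmp.
apply/seteqP; split=> e [/bnd[u ou ->] emin]; split.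
- by apply/bnd; exists u.
- by move=> e' /[dup] be' /bnd[v ov e'E]; rewrite e'E -cmpb// -e'E; exact: emin.
- by apply/bnd; exists u.
- by move=> e' /[dup] be' /bnd[v ov e'E]; rewrite e'E cmpb// -e'E; exact: emin.
Qed.

(** * Survival probabilities *)

Section SurvivalProbability.
Variables (R : realType) (s : nat).
Hypothesis s2 : (2 <= s)%N.
Implicit Types (p t h : R).

(** Probability that at least one of the s children is joined by an open bond and itself survives,
    when each child survives with probability [t]. *)
Definition offspring p t : R := 1 - (1 - p * t) ^+ s.

(* Probability that the p-percolation cluster of a vertex reaches L levels down. *)
Definition theta p (L : nat) : R := iter L (offspring p) 1.

Definition theta_lim p : R := limn (theta p).

Lemma thetaS p L : theta p L.+1 = offspring p (theta p L).
Proof. by []. Qed.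

Lemma offspring_itv p t : 0 <= p <= 1 -> 0 <= t <= 1 -> 0 <= offspring p t <= 1.
Proof.
move=> /andP[p0 p1] /andP[t0 t1].
have h0 : 0 <= 1 - p * t by nra.
have h1 : 1 - p * t <= 1 by nra.
have := exprn_ge0 s h0; have := exprn_ile1 s h0 h1.
by rewrite /offspring => ? ?; apply/andP; split; lra.
Qed.

Lemma le_offspring p t t' : 0 <= p <= 1 -> 0 <= t -> t <= t' -> t' <= 1 ->
  offspring p t <= offspring p t'.
Proof.
move=> /andP[p0 p1] t0 tt' t1; rewrite /offspring lerD2l lerN2.
by apply: lerXn2r; rewrite ?nnegrE; nra.
Qed.

Lemma theta_itv p L : 0 <= p <= 1 -> 0 <= theta p L <= 1.
Proof.
move=> p01; elim: L => [|L IH]; first by rewrite ler01 lexx.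
exact: offspring_itv.
Qed.

Lemma thetaS_le p L : 0 <= p <= 1 -> theta p L.+1 <= theta p L.
Proof.
move=> p01; elim: L => [|L IH]; first by have /andP[] := theta_itv 1 p01.
by rewrite thetaS [leRHS]thetaS; apply: le_offspring => //;
  have /andP[] := theta_itv L p01; have /andP[] := theta_itv L.+1 p01.
Qed.

Lemma theta_cvg p : 0 <= p <= 1 -> theta p @ \oo --> theta_lim p.
Proof.
move=> p01; apply: nonincreasing_is_cvgn.
  by apply/nonincreasing_seqP => L; exact: thetaS_le.
by exists 0 => _ [L _ <-]; have /andP[] := theta_itv L p01.
Qed.

Lemma theta_lim_itv p : 0 <= p <= 1 -> 0 <= theta_lim p <= 1.
Proof.
move=> p01; apply/andP; split.
  apply: limr_ge; first exact: theta_cvg.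
  by apply: nearW => L; have /andP[] := theta_itv L p01.
apply: limr_le; first exact: theta_cvg.
by apply: nearW => L; have /andP[] := theta_itv L p01.
Qed.

Lemma theta_lim_fixpoint p : 0 <= p <= 1 -> theta_lim p = offspring p (theta_lim p).
Proof.
move=> p01; have c := theta_cvg p01.
have c1 : (fun L => theta p L.+1) @ \oo --> theta_lim p.
  by move: c; rewrite -(cvg_shiftS (theta p)).
have c2 : (fun L => theta p L.+1) @ \oo --> offspring p (theta_lim p).
  apply: cvgB; first exact: cvg_cst.
  apply: (@cvg_comp _ _ _ (fun L => 1 - p * theta p L) (fun t => t ^+ s)).
    by apply: cvgB; [exact: cvg_cst|apply: cvgM; [exact: cvg_cst|exact: c]].
  exact: (@exprn_continuous R s (1 - p * theta_lim p)).
exact: (cvg_unique _ c1 c2).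
Qed.

(** Extracting the factor p t allows a nonzero fixed point t to be cancelled, leaving p times a
    geometric sum equal to 1. *)
Lemma offspring_geometric p t : offspring p t = p * t * \sum_(i < s) (1 - p * t) ^+ i.
Proof. by have := subrX1 (1 - p * t) s; rewrite /offspring; lra. Qed.

Lemma sum_expr_recl t : \sum_(i < s) t ^+ i = 1 + \sum_(i < s.-1) t ^+ i.+1.
Proof. by case: s s2 => // n _; rewrite big_ord_recl expr0. Qed.

(** At p = 1/s, a nonzero fixed point would force the geometric sum of s powers of 1 - h, with h >
    0, to equal s; but the powers after the first are smaller than 1, and there is at least one of
    them. *)
Lemma theta_lim_critical : theta_lim s%:R^-1 = 0.
Proof.
have s0 : 0 < s%:R :> R by rewrite ltr0n; lia.
have p01 : 0 <= (s%:R^-1 : R) <= 1.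
  by rewrite invr_ge0 ltW//= invf_le1// ler1n; lia.
have /andP[t0 t1] := theta_lim_itv p01.
have := theta_lim_fixpoint p01; rewrite offspring_geometric.
move: (theta_lim _) t0 t1 => t t0 t1 tE.
apply/eqP/negPn/negP => tn0; have {t0} tp : 0 < t by rewrite lt_neqAle eq_sym tn0.
set h := s%:R^-1 * t in tE.
have h0 : 0 < h by rewrite mulr_gt0// invr_gt0.
have h1 : h <= 1 by case/andP: p01; rewrite /h; nra.
have sumE : \sum_(i < s) (1 - h) ^+ i = s%:R.
  apply: (@mulfI _ h); first by rewrite gt_eqF.
  by rewrite -tE /h mulrAC mulVf ?mul1r// gt_eqF.
have : \sum_(i < s) (1 - h) ^+ i <= 1 + (1 - h) *+ s.-1.
  rewrite sum_expr_recl lerD2l.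
  rewrite -[X in _ *+ X](card_ord s.-1) -sumr_const; apply: ler_sum => i _.
  by rewrite exprS ler_piMr ?exprn_ile1//; lra.
rewrite sumE -mulr_natr.
have -> : s%:R = 1 + s.-1%:R :> R.
  by rewrite -[in LHS](prednK (n := s)) ?(leq_trans _ s2)// -natr1 addrC.
have : 0 < s.-1%:R :> R by rewrite ltr0n; lia.
by nra.
Qed.

(** Once the fixed point is cancelled, p times the sum of the powers of x = 1 - p t is 1; the power
    of exponent 0 is 1 and each of the other s - 1 is at least x^(s-1). The right-hand side equals
    1/s at p = 1/s and decreases in p, so for p > 1/s it is smaller than 1/s. *)
Lemma theta_lim_dual p : 0 <= p <= 1 -> 0 < theta_lim p ->
  p * (1 - p * theta_lim p) ^+ s.-1 <= (1 - p) / s.-1%:R.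
Proof.
move=> p01; have /andP[_ t1] := theta_lim_itv p01.
have := theta_lim_fixpoint p01; rewrite offspring_geometric.
move: (theta_lim _) t1 => t t1 tE t0; have /andP[p0 p1] := p01.
set x := 1 - p * t in tE *.
have x0 : 0 <= x by rewrite /x; nra.
have x1 : x <= 1 by rewrite /x; nra.
have sumE : p * \sum_(i < s) x ^+ i = 1.
  apply: (@mulfI _ t); first by rewrite gt_eqF.
  by rewrite mulr1 [in RHS]tE mulrCA mulrA.
have : 1 + x ^+ s.-1 *+ s.-1 <= \sum_(i < s) x ^+ i.
  rewrite sum_expr_recl lerD2l.
  rewrite -[X in _ *+ X](card_ord s.-1) -sumr_const; apply: ler_sum => i _.
  by apply: ler_wiXn2l.
have sp : 0 < s.-1%:R :> R by rewrite ltr0n -subn1 subn_gt0.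
rewrite -mulr_natr ler_pdivlMr//; move: sumE.
by move: (\sum_(i < s) _) (x ^+ _) => S X; nra.
Qed.

Lemma expr_bernoulli_le1 t n : 0 <= t <= 1 -> (1 - t) ^+ n * (1 + n%:R * t) <= 1.
Proof.
move=> /andP[t0 t1]; elim: n => [|n IH]; first by rewrite expr0 mul0r addr0 mulr1.
apply: le_trans IH; rewrite exprS -natr1.
have : 0 <= (1 - t) ^+ n by apply: exprn_ge0; lra.
have : 0 <= n%:R :> R by [].
move: ((1 - t) ^+ n) (n%:R : R) => X N N0 X0.
have : 0 <= X * (t * t * (N + 1)) by rewrite !mulr_ge0//; lra.
lra.
Qed.

Lemma theta_lim_gt0 p : s%:R^-1 < p <= 1 -> 0 < theta_lim p.
Proof.
move=> /andP[sp p1]; have s0 : 0 < s%:R :> R by rewrite ltr0n; lia.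
have p0 : 0 < p by apply: lt_trans sp; rewrite invr_gt0.
have p01 : 0 <= p <= 1 by rewrite ltW.
have sp1 : 1 < s%:R * p by rewrite -ltr_pdivrMl// mulr1.
(* This is c = 1 - 1/(s p), chosen so that 1 + s (p c) = s p. The Bernoulli bound then gives (1 - p
   c)^s <= 1/(s p) = 1 - c, so c lies below its image by [offspring], and by monotonicity below
   every iterate. *)
pose c := (s%:R * p - 1) / (s%:R * p).
have c0 : 0 < c by rewrite divr_gt0; nra.
have cE : s%:R * p * c = s%:R * p - 1 by rewrite /c mulrC divfK// gt_eqF//; lra.
have c1 : c <= 1 by nra.
suff h L : c <= theta p L.
  apply: lt_le_trans c0 _; apply: limr_ge; first exact: theta_cvg.
  exact: nearW.
elim: L => [//|L IH]; rewrite thetaS.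
have /andP[t0 t1] := theta_itv L p01.
apply: le_trans (le_offspring p01 (ltW c0) IH t1).
have := @expr_bernoulli_le1 (p * c) s; rewrite /offspring.
have -> : 1 + s%:R * (p * c) = s%:R * p by lra.
move=> /(_ _)/wrap[]; first by apply/andP; split; nra.
move: ((1 - p * c) ^+ s) => X h.
by nra.
Qed.

Lemma theta_gt0 p L : 0 < p <= 1 -> 0 < theta p L.
Proof.
move=> /andP[p0 p1]; elim: L => [|L IH]; first exact: ltr01.
have /andP[_ t1] := @theta_itv p L ltac:(by rewrite ltW).
have x0 : 0 <= 1 - p * theta p L by nra.
have x1 : 1 - p * theta p L < 1 by nra.
by rewrite thetaS /offspring subr_gt0 (exprn_ilt1 s x0 x1) -lt0n; lia.
Qed.

End SurvivalProbability.

Section FieldFacts.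
Context d (Omega : measurableType d) (R : realType) (P : probability Omega R).
Context (I : Type) (F : indep_fields P I).

Lemma fldC S A : F S A -> F S (~` A).
Proof. apply: sigmaC; exact: fld_sigma. Qed.

Lemma fldU S A B : F S A -> F S B -> F S (A `|` B).
Proof. apply: sigmaU; exact: fld_sigma. Qed.

Lemma fldI S A B : F S A -> F S B -> F S (A `&` B).
Proof. apply: sigmaI; exact: fld_sigma. Qed.

Lemma fldT S : F S setT.
Proof. apply: sigmaT; exact: fld_sigma. Qed.

Lemma fld_bigcup (J : countType) S (A : J -> set Omega) :
  (forall j, F S (A j)) -> F S (\bigcup_j A j).
Proof. apply: sigma_bigcup; exact: fld_sigma. Qed.

Lemma fld_bigcap (J : countType) S (A : J -> set Omega) :
  (forall j, F S (A j)) -> F S (\bigcap_j A j).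
Proof. apply: sigma_bigcap; exact: fld_sigma. Qed.

Lemma indep_all (J : eqType) (l : seq J) (S : J -> set I) (A : J -> set Omega) :
  uniq l -> (forall j, j \in l -> F (S j) (A j)) ->
  (forall i j, i \in l -> j \in l -> i != j -> S i `&` S j = set0) ->
  F (\bigcup_(j in [set` l]) S j) [set w | forall j, j \in l -> A j w] /\
  pr P [set w | forall j, j \in l -> A j w] = \prod_(j <- l) pr P (A j).
Proof.
elim: l => [_ _ _|a l IH /= /andP[al ul] FA dis].
  have -> : [set w | forall j, j \in [::] -> A j w] = setT by apply/seteqP; split.
  by rewrite big_nil prT; split=> //; exact: fldT.
have tl j : j \in l -> j \in a :: l by rewrite inE orbC => ->.
have [Fl prl] := IH ul (fun j jl => FA j (tl j jl))
  (fun i j il jl => dis i j (tl i il) (tl j jl)).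
have -> : [set w | forall j, j \in a :: l -> A j w] =
    A a `&` [set w | forall j, j \in l -> A j w].
  apply/seteqP; split=> [w h|w [ha hl] j].
    by split=> [|j jl]; apply: h; rewrite inE ?eqxx// jl orbT.
  by rewrite inE => /orP[/eqP->|/hl].
have Fa : F (S a) (A a) by apply: FA; rewrite inE eqxx.
split.
  apply: fldI.
    by apply: fld_sub Fa => i Si; exists a => //=; rewrite inE eqxx.
  by apply: fld_sub Fl => i [j jl Si]; exists j => //=; rewrite inE jl orbT.
rewrite big_cons -prl; apply: fld_indep Fa Fl.
apply/seteqP; split=> // i [Sa [j jl Sj]].
have : (S a `&` S j) i by [].
rewrite dis//; first by rewrite inE eqxx.
  by rewrite inE (jl : j \in l) orbT.
by apply: contraNneq al => ->.
Qed.

End FieldFacts.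

Section Branches.
Variable s : nat.
Implicit Types v u : tree s.

Definition branch v (i : 'I_s) : set (tree s) := [set u | exists a, u = a ++ i :: v].
Definition below v : set (tree s) := [set u | exists i a, u = a ++ i :: v].

Lemma cat_suffix_inj (T : Type) (a b x y : seq T) : a ++ x = b ++ y ->
  size x = size y -> x = y.
Proof.
move=> e xy; have ab : size a = size b.
  by move/(congr1 size): e; rewrite !size_cat xy; lia.
by have := congr1 (drop (size a)) e; rewrite drop_size_cat// ab drop_size_cat.
Qed.

Lemma branch_disjoint v i j : i != j -> branch v i `&` branch v j = set0.
Proof.
move=> /eqP ij; apply/seteqP; split=> // u [[a ->] [b /cat_suffix_inj]].
by move=> /(_ erefl) [/ij].
Qed.

Lemma root_branch_disjoint v : [set v] `&` below v = set0.
Proof.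
apply/seteqP; split=> // u [-> [i [a /(congr1 size)]]].
by rewrite size_cat /=; lia.
Qed.

Lemma branchE v i : branch v i = [set (i :: v : tree s)] `|` below (i :: v).
Proof.
apply/seteqP; split=> [u [a ->]|u [->|[j [a ->]]]].
- case/lastP: a => [|a j]; [by left|right].
  by exists j, a; rewrite cat_rcons.
- by exists [::].
- by exists (rcons a j); rewrite cat_rcons.
Qed.

Lemma branch_below v i : branch v i `<=` below v.
Proof. by move=> u [a ->]; exists i, a. Qed.

End Branches.

Section PercolationProbability.
Context d (Omega : measurableType d) (R : realType) (P : probability Omega R).
Context (s : nat) (F : indep_fields P (tree s)).
Variables (Y : tree s -> set Omega) (p : R).
Hypothesis FY : forall v, v != [::] -> F [set v] (Y v).
Hypothesis prY : forall v, v != [::] -> pr P (Y v) = p.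

Let op w := fun v => Y v w.

Lemma reach_fld L v : F (below v) [set w | reach (op w) L v].
Proof.
elim: L v => [|L IH] v.
  by rewrite (_ : [set _ | _] = setT); [exact: fldT|apply/seteqP; split].
rewrite (_ : [set _ | _] =
    \bigcup_i (Y (i :: v) `&` [set w | reach (op w) L (i :: v)])); last first.
  by apply/seteqP; split=> [w [i [? ?]]|w [i _ [? ?]]]; exists i.
apply: fld_bigcup => i; apply: fldI.
  by apply: fld_sub (FY _) => // u ->; exists i, [::].
by apply: fld_sub (IH _) => u [j [a ->]]; exists i, (rcons a j); rewrite cat_rcons.
Qed.

Lemma reach_infty_fld v : F (below v) [set w | reach_infty (op w) v].
Proof.
rewrite (_ : [set _ | _] = \bigcap_L [set w | reach (op w) L v]).
  by apply: fld_bigcap => L; exact: reach_fld.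
by apply/seteqP; split=> w h => [L _|L]; apply: h.
Qed.

Lemma child_reach_fld i v (B : tree s -> set Omega) : (forall u, F (below u) (B u)) ->
  F (branch v i) (Y (i :: v) `&` B (i :: v)) /\
  pr P (Y (i :: v) `&` B (i :: v)) = p * pr P (B (i :: v)).
Proof.
move=> FB; split; last first.
  rewrite -(prY (v := i :: v))//; apply: fld_indep (FY _) (FB _) => //.
  exact: root_branch_disjoint.
rewrite branchE; apply: fldI.
  by apply: fld_sub (FY _) => // u; left.
by apply: fld_sub (FB _) => // u; right.
Qed.

(** Branches through distinct children are disjoint, hence independent. The list [l] consists of all
    children for the survival recursion, and of all but one for the rays leaving a given path. *)
Lemma pr_no_child (l : seq 'I_s) v (B : tree s -> set Omega) b : uniq l ->
  (forall u, F (below u) (B u)) -> (forall u, pr P (B u) = b) ->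
  F (\bigcup_(i in [set` l]) branch v i)
    [set w | forall i, i \in l -> ~ (Y (i :: v) w /\ B (i :: v) w)] /\
  pr P [set w | forall i, i \in l -> ~ (Y (i :: v) w /\ B (i :: v) w)] =
    (1 - p * b) ^+ size l.
Proof.
move=> ul FB prB.
have FA i : i \in l -> F (branch v i) (~` (Y (i :: v) `&` B (i :: v))).
  by move=> _; apply: fldC; exact: (child_reach_fld i v FB).1.
have [|Fl ->] := indep_all ul FA; first by move=> i j _ _; exact: branch_disjoint.
split=> //; rewrite (eq_bigr (fun=> 1 - p * b)).
  by rewrite big_const_seq count_predT iter_mulr mulr1.
move=> i _; have [h prE] := child_reach_fld i v FB.
by rewrite prC ?prE ?prB//; exact: fld_measurable h.
Qed.

Lemma pr_reach L v : pr P [set w | reach (op w) L v] = theta s p L.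
Proof.
elim: L v => [|L IH] v.
  by rewrite (_ : [set _ | _] = setT) ?prT//; apply/seteqP; split.
have [_] := pr_no_child v (enum_uniq 'I_s) (reach_fld L) IH.
rewrite -cardE card_ord thetaS /offspring => <-.
rewrite -prC; last first.
  by apply: fld_measurable; apply: (pr_no_child v (enum_uniq 'I_s) (reach_fld L) IH).1.
congr pr; apply/seteqP; split=> [w [i ri] h|w].
  by apply: (h i); rewrite ?mem_enum.
apply: contra_notP => /= h i _ ri; apply: h; by exists i.
Qed.

Lemma pr_reach_infty v : 0 <= p <= 1 ->
  pr P [set w | reach_infty (op w) v] = theta_lim s p.
Proof.
move=> p01; have c := @theta_cvg R s p p01; apply: (cvg_unique _ _ c) => //.
rewrite (_ : theta s p = fun L => pr P [set w | reach (op w) L v]); last first.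
  by apply/funext => L; rewrite pr_reach.
rewrite (_ : [set w | reach_infty (op w) v] = \bigcap_L [set w | reach (op w) L v]).
  apply: pr_bigcap_cvg => [L|L w]; last exact: reachS.
  exact: fld_measurable (reach_fld _ _).
by apply/seteqP; split=> w h => [L _|L]; apply: h.
Qed.

Definition off_percolation v i : set Omega :=
  [set w | exists j, [/\ j != i, Y (j :: v) w & reach_infty (op w) (j :: v)]].

Lemma off_percolation_reach v i w : off_percolation v i w -> reach_infty (op w) v.
Proof. by move=> [j [_ Yj rj]] [//|L]; exists j; split=> //; exact: rj. Qed.

Lemma pr_no_off_percolation v i : 0 <= p <= 1 ->
  F (\bigcup_(j in [set j | j != i]) branch v j) (~` off_percolation v i) /\
  pr P (~` off_percolation v i) = (1 - p * theta_lim s p) ^+ s.-1.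
Proof.
move=> p01.
have ul : uniq (rem i (enum 'I_s)) by rewrite rem_uniq ?enum_uniq.
have mem j : (j \in rem i (enum 'I_s)) = (j != i).
  by rewrite mem_rem_uniq ?enum_uniq// inE mem_enum andbT.
have := pr_no_child v ul reach_infty_fld (fun v => pr_reach_infty v p01).
rewrite size_rem ?mem_enum// -cardE card_ord.
have -> : [set` rem i (enum 'I_s)] = [set j | j != i].
  by apply/seteqP; split=> j; rewrite /= mem.
suff -> : [set w | forall j, j \in rem i (enum 'I_s) ->
    ~ (Y (j :: v) w /\ reach_infty (op w) (j :: v))] = ~` off_percolation v i by [].
apply/seteqP; split=> w h.
  by move=> [j [ji Yj rj]]; apply: (h j); rewrite ?mem.
by move=> j; rewrite mem => ji [Yj rj]; apply: h; exists j.
Qed.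

End PercolationProbability.

(** * Transfer of probabilities between two families of independent events *)

Section SameLaw.
Context d1 (Omega1 : measurableType d1) d2 (Omega2 : measurableType d2) (R : realType).
Context (P1 : probability Omega1 R) (P2 : probability Omega2 R).
Context (I1 I2 : Type) (F1 : indep_fields P1 I1) (F2 : indep_fields P2 I2).

Lemma pr_split d (Omega : measurableType d) (P : probability Omega R) (I : Type)
    (F : indep_fields P I) S S' A B1 B0 : S `&` S' = set0 ->
  F S A -> F S' B1 -> F S' B0 ->
  pr P ((A `&` B1) `|` (~` A `&` B0)) = pr P A * pr P B1 + (1 - pr P A) * pr P B0.
Proof.
move=> SS' FA FB1 FB0; have FCA := fldC FA.
have mA := fld_measurable FA; have mB1 := fld_measurable FB1.
have mB0 := fld_measurable FB0; have mCA := fld_measurable FCA.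
rewrite prU; [|exact: measurableI|exact: measurableI|]; last first.
  by apply/seteqP; split=> w /=; tauto.
by rewrite (fld_indep SS' FA FB1) (fld_indep SS' FCA FB0) prC.
Qed.

(** Induction on the list, conditioning on its first event. It serves to compare weights on T_sigma
    with statuses on T*_sigma, and statuses with their image under an automorphism. *)
Lemma same_law (J : eqType) (l : seq J) (p : R) (f1 : J -> I1) (f2 : J -> I2)
    (A1 : J -> set Omega1) (A2 : J -> set Omega2) (Phi : set J -> Prop) :
  uniq l ->
  (forall i j, i \in l -> j \in l -> f1 i = f1 j -> i = j) ->
  (forall i j, i \in l -> j \in l -> f2 i = f2 j -> i = j) ->
  (forall j, j \in l -> F1 [set f1 j] (A1 j) /\ pr P1 (A1 j) = p) ->
  (forall j, j \in l -> F2 [set f2 j] (A2 j) /\ pr P2 (A2 j) = p) ->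
  (forall a b : set J, (forall j, j \in l -> a j <-> b j) -> Phi a -> Phi b) ->
  pr P1 [set w | Phi (fun j => A1 j w)] = pr P2 [set w | Phi (fun j => A2 j w)].
Proof.
move=> ul i1 i2 h1 h2 hPhi.
(* Membership in the fields of the sites is carried through the induction, because the conditioning
   step needs independence from the first site. *)
suff [_ []] : F1 (f1 @` [set` l]) [set w | Phi (fun j => A1 j w)] /\
    F2 (f2 @` [set` l]) [set w | Phi (fun j => A2 j w)] /\
    pr P1 [set w | Phi (fun j => A1 j w)] = pr P2 [set w | Phi (fun j => A2 j w)] by [].
elim: l ul i1 i2 h1 h2 Phi hPhi => [|j l IH] /= => [_ _ _ _ _|/andP[jl ul] i1 i2 h1 h2] Phi hPhi.
  have [ph|ph] := pselect (Phi set0).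
    have e d (Om : measurableType d) (A : J -> set Om) : [set w | Phi (fun j => A j w)] = setT.
      by apply/seteqP; split=> // w _; apply: hPhi ph.
    by rewrite !e !prT; do !split; exact: fldT.
  have e d (Om : measurableType d) (A : J -> set Om) : [set w | Phi (fun j => A j w)] = set0.
    by apply/seteqP; split=> // w h; apply: ph; apply: hPhi h.
  by rewrite !e !pr0; do !split; rewrite -setCT; apply: fldC; exact: fldT.
have tl i : i \in l -> i \in j :: l by rewrite inE orbC => ->.
have jj : j \in j :: l by rewrite inE eqxx.
pose upd b (a : set J) : set J := fun i => if i == j then b else a i.
have updP b (a a' : set J) : (forall i, i \in l -> a i <-> a' i) ->
    Phi (upd b a) -> Phi (upd b a').
  by move=> h; apply: hPhi => i; rewrite /upd inE; case: eqP => //= _ /h.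
have {}IH b := IH ul (fun i i' il i'l => i1 _ _ (tl _ il) (tl _ i'l))
  (fun i i' il i'l => i2 _ _ (tl _ il) (tl _ i'l)) (fun i il => h1 _ (tl _ il))
  (fun i il => h2 _ (tl _ il)) (fun a => Phi (upd b a)) (updP b).
have dec d (Om : measurableType d) (A : J -> set Om) : [set w | Phi (fun i => A i w)] =
    (A j `&` [set w | Phi (upd True (fun i => A i w))]) `|`
    (~` A j `&` [set w | Phi (upd False (fun i => A i w))]).
  apply/seteqP; split=> [w h|w [[Aj h]|[/= Aj h]]].
  - have [Aj|Aj] := pselect (A j w); [left|right]; split=> //; apply: hPhi h => i _;
      rewrite /upd; case: eqP => // ->; tauto.
  - by apply: hPhi h => i _; rewrite /upd; case: eqP => // ->; tauto.
  - by apply: hPhi h => i _; rewrite /upd; case: eqP => // ->; tauto.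
have [FT1 [FT2 prT]] := IH True; have [FF1 [FF2 prF]] := IH False.
have [FA1 prA1] := h1 j jj; have [FA2 prA2] := h2 j jj.
have dis (I : Type) (f : J -> I) :
    (forall i i', i \in j :: l -> i' \in j :: l -> f i = f i' -> i = i') ->
    [set f j] `&` f @` [set` l] = set0.
  move=> fi; apply/seteqP; split=> // _ [-> [i il /fi ij]].
  by move: jl; rewrite -(ij (tl _ il) jj) (il : i \in l).
have fl d (Om : measurableType d) (P : probability Om R) (I : Type) (F : indep_fields P I)
    (f : J -> I) A B1 B0 : F [set f j] A -> F (f @` [set` l]) B1 -> F (f @` [set` l]) B0 ->
    F (f @` [set` j :: l]) ((A `&` B1) `|` (~` A `&` B0)).
  have s1 : [set f j] `<=` f @` [set` j :: l] by move=> _ ->; exists j.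
  have s2 : f @` [set` l] `<=` f @` [set` j :: l].
    by apply: image_subset => i /= il; exact: tl.
  move=> FA FB1 FB0; apply: fldU; apply: fldI.
  - exact: (fld_sub s1 FA).
  - exact: (fld_sub s2 FB1).
  - by apply: fldC; exact: (fld_sub s1 FA).
  - exact: (fld_sub s2 FB0).
rewrite (dec _ _ A1) (dec _ _ A2); split; [exact: fl|split; [exact: fl|]].
rewrite (pr_split (dis _ f1 i1) FA1 FT1 FF1) (pr_split (dis _ f2 i2) FA2 FT2 FF2).
by rewrite prA1 prA2 prT prF.
Qed.

End SameLaw.

Section SubFields.
Context d (Omega : measurableType d) (R : realType) (P : probability Omega R).
Context (I J : Type) (F : indep_fields P I) (g : J -> I) (g_inj : injective g).

Let sub_fld (S : set J) := F (g @` S).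

Let sub_fld_indep S S' A B : S `&` S' = set0 -> sub_fld S A -> sub_fld S' B ->
  pr P (A `&` B) = pr P A * pr P B.
Proof.
move=> SS' SA SB; refine (fld_indep _ SA SB).
apply/seteqP; split=> // _ [[j Sj <-] [j' S'j' /g_inj e]].
have : (S `&` S') j by split=> //; rewrite -e.
by rewrite SS'.
Qed.

(** Lets the results for T_sigma apply to each branch of T*_sigma issued from a neighbour of the
    root. *)
Definition sub_fields : indep_fields P J :=
  @IndepFields _ _ _ _ J sub_fld (fun S => fld_sigma F _)
    (fun S A => @fld_measurable _ _ _ _ _ F _ A)
    (fun S S' SS' => @fld_sub _ _ _ _ _ F _ _ (image_subset g SS')) sub_fld_indep.

End SubFields.

Section UniformWeights.
Variable R : realType.

Lemma uniform_prob_ray (p : R) : 0 <= p <= 1 ->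
  uniform_prob (@ltr01 R) `]-oo, p]%classic = p%:E.
Proof.
move=> /andP[p0 p1]; rewrite /uniform_prob integral_uniform_pdf.
rewrite (_ : _ `&` _ = `[0, p]%classic); last first.
  apply/seteqP; split=> t; rewrite /= !in_itv/=.
    by move=> [tp /andP[-> _]].
  by move=> /andP[-> tp]; split=> //=; exact: le_trans tp p1.
rewrite (eq_integral (fun=> 1%:E)); last first.
  move=> t; rewrite inE/= in_itv/= => /andP[t0 tp].
  by rewrite /uniform_pdf t0 (le_trans tp p1) subr0 invr1.
rewrite integral_cst//= mul1e lebesgue_measure_itv/= lte_fin oppr0 adde0.
by case: ltgtP p0 => // <-.
Qed.

End UniformWeights.

(** * Exponential decay in the absence of side percolation *)

Section InvasionProbability.
Context d (Omega : measurableType d) (R : realType) (P : probability Omega R).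
Context (s : nat) (W : {fset tree s} -> {RV P >-> R}).
Hypothesis s2 : (2 <= s)%N.
Hypothesis hW : iid_uniform01 (bonds (tree_adj s)) W.
Variable z : 'I_s.
Local Notation rt := (tree_root s).

Let bond_tree_inj (u v : tree s) : [set v | v != rt] u -> [set v | v != rt] v ->
  bond behead u = bond behead v -> u = v.
Proof. exact: (bond_inj (tree_rooted s)). Qed.

Definition weight_fields : indep_fields P (tree s) :=
  reindexed_fields hW.1 bond_tree_inj.
Local Notation F := weight_fields.

Definition wt (v : tree s) (w : Omega) : R := W (bond behead v) w.

Lemma fld_weight (S : set (tree s)) v p : S v -> v != rt -> F S [set w | wt v w <= p].
Proof.
move=> Sv v0.
rewrite (_ : [set w | wt v w <= p] = W (bond behead v) @^-1` `]-oo, p]%classic).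
  by apply: reindexed_preimage => //; exact: bonds_bond.
by apply/seteqP; split=> w; rewrite /= in_itv.
Qed.

Lemma pr_weight v p : v != rt -> 0 <= p <= 1 -> pr P [set w | wt v w <= p] = p.
Proof.
move=> v0 p01; apply: EFin_inj; rewrite -prE; last first.
  by apply: fld_measurable; apply: (@fld_weight setT).
rewrite -uniform_prob_ray// -(hW.2 (bond behead v)) => [//||//].
  exact: bonds_bond.
Qed.

Lemma fld_weight_le (S : set (tree s)) u v : S u -> S v -> u != rt -> v != rt ->
  F S [set w | wt u w <= wt v w].
Proof.
move=> Su Sv u0 v0.
rewrite (_ : [set w | _] =
  \bigcap_(r : rat) (~` [set w | wt v w <= ratr r] `|` [set w | wt u w <= ratr r])).
  by apply: fld_bigcap => r; apply: fldU; [apply: fldC|]; exact: fld_weight.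
apply/seteqP; split=> [w /= uv r _|w h] /=.
  by have [vr|vr] := pselect (wt v w <= ratr r); [right; exact: le_trans vr|left].
rewrite leNgt; apply/negP => /rat_in_itvoo[r]; rewrite in_itv/= => /andP[vr ru].
by have [|] := h r I; rewrite /= ?(ltW vr)// leNgt ru.
Qed.

Local Notation cluster w := (IPC_vertices (tree_adj s) rt (fun e => W e w)).

(** By [invasion_dependence], whether [y] is invaded by time [t] is decided by finitely many
    comparisons of weights of bonds not strictly below [y]. This makes [y] in C independent of
    everything below [y]. *)
Lemma fld_cluster y : F (~` below y) [set w | cluster w y].
Proof.
pose inv t := [set w | (invasion (tree_adj s) rt (fun e => W e w) t).1 y].
rewrite (_ : [set w | _] = \bigcup_t inv t); last first.
  by apply/seteqP; split=> w [t _ h]; exists t.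
apply: fld_bigcup => t.
pose l := [seq u <- words s t | (u != rt) && ~~ `[< below y u >]].
pose G (uv : tree s * tree s) := [set w | wt uv.1 w <= wt uv.2 w].
apply: (finite_dependence (fld_sigma F _) (l := [seq (u, v) | u <- l, v <- l]) (F := G)).
  move=> _ /allpairsP[[u v] [/= + + ->]]; rewrite !mem_filter.
  move=> /andP[/andP[u0 /asboolPn bu] _] /andP[/andP[v0 /asboolPn bv] _].
  exact: fld_weight_le.
move=> w w' ww'; apply: (invasion_dependence z) => u v /andP[u0 ut] /andP[v0 vt] bu bv.
have mem (a : tree s) : (0 < size a)%N -> (size a <= t)%N ->
    (forall (c : 'I_s) b, a <> c :: b ++ y) -> a \in l.
  move=> a0 at_ ba; rewrite mem_filter -size_eq0 -lt0n a0 mem_words// andbT.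
  apply/asboolPn => -[i [b aE]]; case: b aE => [|c b] aE; first exact: (ba i [::]).
  by apply: (ba c (rcons b i)); rewrite cat_rcons.
have := ww' (u, v) (allpairs_f _ (mem _ u0 ut bu) (mem _ v0 vt bv)).
by rewrite /G /= => h; apply/idP/idP => /h.
Qed.

Arguments fld_cluster : clear implicits.

Lemma measurable_cluster y : measurable [set w | cluster w y].
Proof. exact: (fld_measurable (fld_cluster y)). Qed.

Local Notation perc p := (off_percolation (fun v => [set w | wt v w <= p])).

Definition no_off_percolation p (v : tree s) : set Omega :=
  [set w | forall a i v', v = a ++ i :: v' -> ~ perc p v' i w].

Section Levels.
Variables (q e : R).

(** A grid of mesh [e] starting at [q] and capped at 1, so that the level index in [record_event]
    can matter only a bounded number of times. *)
Definition level (k : nat) : R := Num.min 1 (q + k%:R * e).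

(* An upper bound for "v is invaded and no ray of weights at most [level k]
   leaves the path from the root to v": reading the path upwards, k is the
   index of the largest level exceeded by a weight read so far. *)
Fixpoint record_event (v : seq 'I_s) (k : nat) : set Omega :=
  if v is i :: v' then
    ~` perc (level k) v' i `&`
    (([set w | wt v w <= level k.+1] `&` record_event v' k) `|`
     (~` [set w | wt v w <= level k.+1] `&` record_event v' k.+1))
  else setT.

(** If the bond above the current vertex exceeds level k + 1, a side ray of that level higher up
    would contradict [cluster_weight_le]; the absence of side rays thus holds at level k + 1 from
    there on, and the index may be raised. *)
Lemma cluster_record_event v k w : cluster w v -> no_off_percolation (level k) v w ->
  record_event v k w.
Proof.
elim: v k => [//|i v IH] k Cv nov; split; first exact: (nov [::] i v).
have Cv' := cluster_parent z Cv.
have [wv|wv] := pselect (wt (i :: v) w <= level k.+1); [left|right]; split=> //.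
  by apply: IH => // a j v' vE; apply: (nov (i :: a) j v'); rewrite vE.
apply: IH => // a j v' vE /off_percolation_reach rv; apply: wv.
apply: (cluster_weight_le z Cv _ (a := rcons a j) (v := v')) => //.
by rewrite cat_rcons.
Qed.

Hypotheses (q01 : s%:R^-1 < q < 1) (e_gt0 : 0 < e).

Let s_gt0 : 0 < s%:R :> R. Proof. by rewrite ltr0n; lia. Qed.
Let q_gt0 : 0 < q.
Proof. by case/andP: q01 => + _; apply: lt_trans; rewrite invr_gt0. Qed.

Lemma level_itv k : q <= level k <= 1.
Proof.
rewrite /level ge_min lexx/= andbT le_min.
have : 0 <= k%:R * e by rewrite mulr_ge0// ltW.
by case/andP: q01 => _ q1 ke; apply/andP; split; lra.
Qed.

Lemma level01 k : 0 <= level k <= 1.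
Proof. by have /andP[qk ->] := level_itv k; rewrite andbT (le_trans (ltW q_gt0)). Qed.

Lemma levelS_le k : level k.+1 <= level k + e.
Proof.
rewrite /level -natr1 mulrDl mul1r addrA ge_min.
by case: (leP 1 (q + k%:R * e)) => _; rewrite ?lexx ?orbT// lerDl ltW.
Qed.

Let perc_fld k v i := @pr_no_off_percolation _ _ _ _ s F
  (fun v => [set w | wt v w <= level k]) (level k)
  (fun v v0 => @fld_weight [set v] v (level k) erefl v0)
  (fun v v0 => pr_weight v0 (level01 k)) v i (level01 k).

Let branches v i : set (tree s) := \bigcup_(j in [set j | j != i]) branch v j.

Let branches_disjoint v i : branches v i `&` [set i :: v] = set0.
Proof.
apply/seteqP; split=> // u [[j /= ji [a ->]] /= e0].
have /cat_suffix_inj/(_ erefl)[/eqP] : a ++ j :: v = [::] ++ i :: v by rewrite e0.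
by rewrite (negPf ji).
Qed.

Let branches_below v i : branches v i `<=` below v.
Proof. by move=> u [j _]; exact: branch_below. Qed.

Let below_cons v i : below (i :: v : tree s) `<=` below v.
Proof. by move=> u [j [a ->]]; exists i, (rcons a j); rewrite cat_rcons. Qed.

Lemma record_event_fld v k : F (~` below v) (record_event v k).
Proof.
elim: v k => [|i v IH] k; first exact: fldT.
have sub : ~` below v `<=` ~` below (i :: v : tree s).
  by move=> u; apply: contra_not; exact: below_cons.
have self : (~` below (i :: v : tree s)) (i :: v).
  by move=> bv; have := root_branch_disjoint (i :: v); rewrite -subset0 => /(_ (i :: v)); apply.
have Fw : F (~` below (i :: v : tree s)) [set w | wt (i :: v) w <= level k.+1].
  exact: fld_weight.
apply: fldI; last first.
  by apply: fldU; apply: fldI; [|exact: fld_sub (IH _)|exact: fldC|exact: fld_sub (IH _)].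
apply: fld_sub (perc_fld k v i).1 => u [j /= ji [a ->]] [c [b e0]].
have /cat_suffix_inj/(_ erefl)[/eqP] : a ++ j :: v = (rcons b c) ++ i :: v.
  by rewrite cat_rcons.
by rewrite (negPf ji).
Qed.

Arguments record_event_fld : clear implicits.

Let rate : R := (1 - q) / s.-1%:R + e.

(** The side rays are controlled at level k but the bond at level k + 1; this mismatch costs at most
    the mesh [e]. The bound of [theta_lim_dual] is largest at the lowest level [q]. *)
Lemma dual_rate k : level k.+1 * (1 - level k * theta_lim s (level k)) ^+ s.-1 <= rate.
Proof.
have /andP[qk k1] := level_itv k; have /andP[sq q1] := q01.
have th0 : 0 < theta_lim s (level k).
  by apply: theta_lim_gt0 => //; rewrite k1 andbT (lt_le_trans sq).
have := theta_lim_dual s2 (level01 k) th0.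
have /andP[t0 t1] := theta_lim_itv s (level01 k).
have /andP[l0 _] := level01 k.
set x := (_ - _ * _) ^+ _ => hx.
have x1 : 0 <= x <= 1.
  have ? : 0 <= 1 - level k * theta_lim s (level k) by nra.
  by rewrite exprn_ge0// exprn_ile1//; nra.
have sp : 0 < s.-1%:R :> R by rewrite ltr0n -subn1 subn_gt0.
have : (1 - level k) / s.-1%:R <= (1 - q) / s.-1%:R.
  by rewrite ler_pM2r ?invr_gt0//; lra.
case/andP: x1 => x0 x1 hs; rewrite /rate.
have h1 : level k.+1 * x <= (level k + e) * x by rewrite ler_wpM2r// levelS_le.
have h2 : e * x <= e by rewrite ler_piMr// ltW.
by move: hx; rewrite -/x; lra.
Qed.

(** When the index is kept, the sibling branches, the bond above [i :: v] and the events higher up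
    are independent, which gives the factor [rate]. When the index rises no gain is sought, since
    this happens boundedly often. *)
Lemma pr_record_event i v k :
  pr P (record_event (i :: v) k) <= rate * pr P (record_event v k) +
    pr P (~` [set w | wt (i :: v) w <= level k.+1] `&` record_event v k.+1).
Proof.
have [Fp prp] := perc_fld k v i.
have Fw : F [set (i :: v : tree s)] [set w | wt (i :: v) w <= level k.+1] by exact: fld_weight.
have Fr k' := record_event_fld v k'.
have mp := fld_measurable Fp; have mw := fld_measurable Fw.
have mr k' := fld_measurable (Fr k').
set N := ~` perc _ v i in Fp prp mp *.
set A := [set w | wt (i :: v) w <= level k.+1] in Fw mw *.
have FNA : F (below v) (N `&` A).
  apply: fldI; first exact: (fld_sub (@branches_below v i) Fp).
  by apply: fld_sub Fw => _ ->; exists i, [::].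
have mNA := fld_measurable FNA.
have m1 := measurableI _ _ mNA (mr k).
have m2 := measurableI _ _ (measurableC mw) (mr k.+1).
have m0 := fld_measurable (record_event_fld (i :: v) k).
have sub : record_event (i :: v) k `<=`
    (N `&` A `&` record_event v k) `|` (~` A `&` record_event v k.+1).
  by move=> w [Nw [[Aw rw]|[Aw rw]]]; [left|right].
apply: le_trans (pr_le_sub2 P m0 m1 m2 sub) _.
rewrite lerD2r (fld_indep _ FNA (Fr k)) ?setICr//.
rewrite (fld_indep (@branches_disjoint v i) Fp Fw) prp pr_weight ?level01//.
by rewrite ler_wpM2r ?pr_ge0// mulrC; exact: dual_rate.
Qed.

(** Induction downwards from the first level equal to 1, where the second term of [pr_record_event]
    vanishes because weights exceed 1 with probability 0. Each lower level adds a source term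
    already bounded by C r^N, at the price of a larger constant. *)
Lemma record_event_bound r : rate < r -> exists2 C, 0 <= C &
  forall v, pr P (record_event v 0) <= C * r ^+ size v.
Proof.
move=> rr; have /andP[sq q1] := q01.
have rate0 : 0 < rate.
  by rewrite /rate; apply: ltr_wpDl => //; rewrite divr_ge0//; lra.
have r0 : 0 < r by exact: lt_trans rr.
have mr v k := fld_measurable (record_event_fld v k).
have mw i v k : measurable [set w | wt (i :: v) w <= level k].
  by apply: fld_measurable; apply: (@fld_weight setT).
have [K hK] : exists K : nat, forall k, (K <= k)%N -> level k = 1.
  exists (Num.truncn e^-1).+1 => k Kk; apply/min_idPl.
  have : 1 <= k%:R * e.
    rewrite -ler_pdivrMr// mul1r; apply: le_trans (ltW (truncnS_gt _)) _.
    by rewrite ler_nat.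
  by have := q_gt0; lra.
suff h n : (n <= K)%N -> exists2 C, 1 <= C &
    forall v, pr P (record_event v (K - n)) <= C * r ^+ size v.
  by have [C C1 HC] := h K (leqnn K); exists C; [lra|rewrite -(subnn K)].
elim: n => [|n IH] nK.
  exists 1 => //; elim=> [|i v IHv]; first by rewrite expr0 mulr1 /= prT.
  apply: le_trans (pr_record_event i v (K - 0)) _.
  have -> : pr P (~` [set w | wt (i :: v) w <= level (K - 0).+1] `&` record_event v (K - 0).+1) = 0.
    apply/eqP; rewrite eq_le pr_ge0 andbT.
    apply: (@le_trans _ _ (pr P (~` [set w | wt (i :: v) w <= level (K - 0).+1]))).
      by apply: le_pr => //; [apply: measurableI => //; exact: measurableC|exact: measurableC].
    by rewrite prC// pr_weight ?level01// hK ?subrr//; lia.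
  have b0 : 0 <= r ^+ size v by rewrite exprn_ge0// ltW.
  move: IHv b0; rewrite [size (i :: v)]/= exprS; move: (pr _ _) (r ^+ _) => a b ab b0.
  have : rate * a <= rate * (1 * b) by rewrite ler_pM2l.
  by nra.
have [C C1 HC] := IH (ltnW nK).
(* Chosen so that rate C' + C <= r C', which closes the recursion; the summand 1 covers the empty
   path. *)
pose C' := 1 + C / (r - rate).
have C'E : (r - rate) * C' = r - rate + C.
  by rewrite /C' mulrDr mulr1 mulrC divfK// gt_eqF// subr_gt0.
have C'1 : 1 <= C' by rewrite lerDl divr_ge0//; lra.
exists C' => //; elim=> [|i v IHv]; first by rewrite expr0 mulr1 /= prT.
apply: le_trans (pr_record_event i v _) _.
have -> : (K - n.+1).+1 = (K - n)%N by rewrite subnSK.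
have : pr P (~` [set w | wt (i :: v) w <= level (K - n)] `&` record_event v (K - n)) <=
    pr P (record_event v (K - n)).
  by apply: le_pr => //; apply: measurableI => //; exact: measurableC.
move/le_trans => /(_ _ (HC v)).
have b0 : 0 <= r ^+ size v by rewrite exprn_ge0// ltW.
have : rate * pr P (record_event v (K - n.+1)) <= rate * (C' * r ^+ size v) by rewrite ler_pM2l.
rewrite [size (i :: v)]/= exprS; move: (pr _ _) (pr _ _) (r ^+ _) b0 => a a' b b0 h1 h2.
apply: (le_trans (lerD h1 h2)).
have : 0 <= (r - rate) * b by rewrite mulr_ge0// subr_ge0 ltW.
have -> : C' * (r * b) = rate * (C' * b) + (r - rate) * C' * b by lra.
by rewrite C'E; lra.
Qed.

End Levels.
End InvasionProbability.

Arguments fld_cluster {d Omega R P s W} hW z y.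
Arguments record_event_fld {d Omega R P s W} s2 hW {q e} q01 e_gt0 v k.

(** * The invasion cluster near a vertex *)

Section Chains.
Variable s : nat.
Local Notation oS := (star_root s).
Local Notation starp := (@parent_star s).
Implicit Types (a b : set (tree_star s)) (v : tree_star s).

(* A set [a] of vertices encodes bond statuses: the bond from v to its parent is
   open iff [a v]. *)
Definition chain a v : Prop := forall n, iter n starp v != oS -> a (iter n starp v).

Definition chain_cluster a : config (tree_star s) :=
  [set e | exists v, [/\ v != oS, e = bond starp v & chain a v]].

Lemma chain_root a : chain a oS.
Proof. by elim=> [|n IH]; rewrite ?iterSr// => /eqP. Qed.

Lemma chainS a v : v != oS -> chain a v <-> a v /\ chain a (starp v).
Proof.
move=> vo; split=> [h|[av h] [|n]]; last 2 first.
- by move=> _; exact: av.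
- by rewrite iterSr; exact: h.
by split=> [|n]; [exact: (h 0%N)|have := h n.+1; rewrite iterSr].
Qed.

Lemma chain_dependence a b m v :
  (forall u, u != oS -> (star_depth u <= m)%N -> a u <-> b u) ->
  (star_depth v <= m)%N -> chain a v -> chain b v.
Proof.
move=> ab vm h n nv; apply/ab => //; last exact: h.
by rewrite (iter_parent_depth (star_rooted s)); lia.
Qed.

Lemma chain_cluster_bond a v : v != oS ->
  chain_cluster a (bond starp v) <-> chain a v.
Proof.
move=> vo; split=> [[u [uo /(bond_inj (star_rooted s) vo uo) ->]]//|h].
by exists v.
Qed.

Lemma open_clusterE (st : {fset tree_star s} -> bool) :
  open_cluster (tree_star_adj s) oS st = chain_cluster (fun v => st (bond starp v)).
Proof.
apply/seteqP; split=> e.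
  move=> [/[dup] be /(bondsP oS)[v vo vE] se ue]; exists v; split=> //.
  by apply/(open_cluster_bond (star_rooted s) st vo); rewrite -vE.
by move=> [v [vo -> /(open_cluster_bond (star_rooted s) st vo)]].
Qed.

Lemma depends_on_ball k (E : set (config (tree_star s))) (om om' : config (tree_star s)) :
  depends_on (bonds_in_ball (tree_star_adj s) oS k) E ->
  (forall v, v != oS -> (star_depth v <= k)%N ->
     om (bond starp v) <-> om' (bond starp v)) ->
  E om -> E om'.
Proof.
move=> dE h; apply: dE => e /(bonds_in_ballP (star_rooted s))[v [vo vk ->]].
exact: h.
Qed.

(** Under [upward z x] the vertex [ray z m] becomes the ancestor [drop m x]; read on T_sigma, the
    first condition says that this ancestor is joined to [x] by bonds of weight at most p. *)
Definition ray_event (z : 'I_s) m (E : set (config (tree_star s))) a : Prop :=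
  chain a (ray z m) /\ E (chain_cluster a).

Lemma ray_event_dependence z m k E a b : (k <= m)%N ->
  depends_on (bonds_in_ball (tree_star_adj s) oS k) E ->
  (forall u, u != oS -> (star_depth u <= m)%N -> a u <-> b u) ->
  ray_event z m E a -> ray_event z m E b.
Proof.
move=> km dE ab [ca Ea]; split.
  by apply: chain_dependence ab _ ca; rewrite depth_ray.
apply: (depends_on_ball dE _ Ea) => v vo vk; rewrite !chain_cluster_bond//.
have vm := leq_trans vk km.
by split; apply: chain_dependence vm => u uo um; [apply: ab|apply: iff_sym; apply: ab].
Qed.

Definition star_vertices (m : nat) : seq (tree_star s) :=
  undup [seq v <- [seq (Some (c, w) : tree_star s) | c <- enum 'I_s.+1, w <- words s m] |
    (v != oS) && (star_depth v <= m)%N].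

Lemma mem_star_vertices m v :
  (v \in star_vertices m) = (v != oS) && (star_depth v <= m)%N.
Proof.
rewrite mem_undup mem_filter; case vP: ((v != oS) && (star_depth v <= m)%N); rewrite ?andFb// andTb.
case: v vP => // -[c w] wm; apply: allpairs_f; first by rewrite mem_enum.
by apply: mem_words; exact: ltnW.
Qed.

End Chains.

Section LocalCluster.
Variables (R : realType) (s : nat) (z : 'I_s) (w : {fset tree s} -> R).
Local Notation rt := (tree_root s).
Local Notation oS := (star_root s).
Local Notation starp := (@parent_star s).
Local Notation wt v := (w (bond behead v)).
Local Notation cluster := (IPC_vertices (tree_adj s) rt w).
Variables (x : tree s) (m : nat) (p q : R).
Hypotheses (mx : (m <= size x)%N) (m_gt0 : (0 < m)%N).
Hypothesis no_perc : forall u, ~ reach_infty (fun u => wt u <= p) u.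
Hypothesis above_perc : exists a i y,
  drop m x = a ++ i :: y /\ reach_infty (fun u => wt u <= q) y.
Hypothesis no_middle : forall v, v != oS -> (star_depth v <= m)%N ->
  ~ (p < wt (upward_child z x v) <= q).
Hypothesis top_in : cluster (drop m x).

Local Notation uc := (upward_child z x).
Local Notation up := (upward z x).
Let a : set (tree_star s) := [set v | wt (uc v) <= p].

Let leq_size (v : tree_star s) : (star_depth v <= m)%N -> (star_depth v <= size x)%N.
Proof. by move=> vm; exact: leq_trans vm mx. Qed.

Let depth_par (v : tree_star s) : (star_depth (starp v) <= star_depth v)%N.
Proof. by rewrite (depth_parent (star_rooted s)) leq_pred. Qed.

(** The vertex that percolates at level q lies on the path above [drop m x], so every invaded bond
    of the ball has weight at most q; weights in (p, q] are excluded by [no_middle]. *)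
Lemma local_weight v : v != oS -> (star_depth v <= m)%N -> cluster (uc v) ->
  wt (uc v) <= p.
Proof.
move=> vo vm Cv; have [b [i [y [yE ry]]]] := above_perc.
have [c [t uE]] := upward_child_below z vo vm mx.
have wq : wt (uc v) <= q.
  apply: (cluster_weight_le z Cv _ (a := t ++ rcons b i) (v := y)) => //.
    by rewrite uE.
  by rewrite uE /= yE -catA cat_rcons.
rewrite leNgt; apply/negP => pw; apply: (no_middle vo vm).
by rewrite pw.
Qed.

Lemma upward_child_endpoints v : v != oS -> (star_depth v <= m)%N -> cluster (uc v) ->
  cluster (up v) /\ cluster (up (starp v)).
Proof.
move=> vo vm; rewrite /upward_child; case: ifP => [rv|/negbT rv] Cv.
  by split=> //; rewrite (upward_on_ray x vo rv); exact: cluster_parent.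
by have [_ <-] := upward_off_ray x rv; split=> //; exact: cluster_parent.
Qed.

(** Off the ray the bond leads away from the root of T_sigma, and a light bond out of an invaded
    vertex is invaded. On the ray its farther endpoint is the one already known to be invaded. *)
Lemma local_step v : v != oS -> (star_depth v <= m)%N -> cluster (up (starp v)) ->
  wt (uc v) <= p -> cluster (uc v).
Proof.
move=> vo vm; rewrite /upward_child; case: ifP => [//|/negbT rv] Cp.
have [] := upward_off_ray x rv; case: (up v) => // c u _ /= uE.
by apply: cluster_low_weight; rewrite ?uE.
Qed.

Lemma chain_in v : cluster x -> (star_depth v <= m)%N -> chain a v -> cluster (up v).
Proof.
move=> Cx; elim/(tree_ind (star_rooted s)): v => [//|v vo IH] vm.
move=> /(chainS _ vo)[av cv].
have Cp := IH (leq_trans (depth_par v) vm) cv.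
exact: (upward_child_endpoints vo vm (local_step vo vm Cp av)).1.
Qed.

Lemma drop_in j : cluster x -> cluster (drop j x).
Proof.
by move=> Cx; apply: (cluster_cat z (a := take j x)); rewrite cat_take_drop.
Qed.

Lemma upward_ray_in v : cluster x -> on_ray z v -> cluster (up v).
Proof. by move=> Cx /on_rayP ->; rewrite upward_ray; exact: drop_in. Qed.

Lemma in_chain v : cluster x -> v != oS -> (star_depth v <= m)%N -> cluster (uc v) ->
  chain a v.
Proof.
move=> Cx; elim/(tree_ind (star_rooted s)): v => [//|v vo IH] _ vm Cv.
apply/(chainS _ vo); split; first exact: local_weight.
have [->|po] := eqVneq (starp v) oS; first exact: chain_root.
apply: (IH po); first exact: leq_trans (depth_par v) vm.
rewrite /upward_child; case: ifP => [rp|_].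
  by apply: upward_ray_in => //; exact: on_ray_parent.
exact: (upward_child_endpoints vo vm Cv).2.
Qed.

Lemma cluster_chain v : cluster x -> v != oS -> (star_depth v <= m)%N ->
  cluster (uc v) <-> chain a v.
Proof.
move=> Cx vo vm; split; first exact: in_chain.
move=> cv; have [av cp] := (chainS _ vo).1 cv.
apply: local_step => //; apply: chain_in => //.
exact: leq_trans (depth_par v) vm.
Qed.

Lemma upward_child_ray j : uc (ray z j.+1) = drop j x.
Proof. by rewrite /upward_child on_ray_ray parent_ray upward_ray. Qed.

(** The invasion can only come from above: starting at [drop m x], which is invaded, light bonds
    lead down to [x] one generation at a time. Conversely, the path to an invaded [x] is invaded,
    and near [x] this forces light weights. *)
Lemma root_in_cluster : cluster x <-> chain a (ray z m).
Proof.
split=> [Cx|cm].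
  apply: in_chain => //.
  - by rewrite -(depth_gt0 (star_rooted s)) depth_ray.
  - by rewrite depth_ray.
  - by case: m m_gt0 => // m' _; rewrite upward_child_ray; exact: drop_in.
suff h j : (j <= m)%N -> chain a (ray z j) -> cluster (drop j x) -> cluster x.
  by apply: h (leqnn m) cm top_in.
elim: j => [_ _|j IH jm]; first by rewrite drop0.
have ro : ray z j.+1 != oS by [].
move=> /(chainS _ ro)[+ cj] Cj; rewrite /a /= upward_child_ray => aj.
rewrite parent_ray in cj; apply: (IH (ltnW jm) cj).
have jx : (j < size x)%N by exact: leq_trans jm mx.
rewrite (drop_nth z jx) in aj *.
exact: cluster_low_weight.
Qed.

Lemma local_event k (E : set (config (tree_star s))) : (k <= m)%N ->
  depends_on (bonds_in_ball (tree_star_adj s) oS k) E ->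
  (cluster x /\ E (pullback up (IPC_bonds (tree_adj s) rt w))) <-> ray_event z m E a.
Proof.
move=> km dE; rewrite /ray_event -root_in_cluster.
have agree v : cluster x -> v != oS -> (star_depth v <= k)%N ->
    pullback up (IPC_bonds (tree_adj s) rt w) (bond starp v) <-> chain_cluster a (bond starp v).
  move=> Cx vo vk; have vm := leq_trans vk km.
  have u0 : uc v != rt := upward_child_neq0 z vo (leq_size vm).
  rewrite chain_cluster_bond// /pullback /= upward_bond// (IPC_bondsE z w u0).
  exact: cluster_chain.
split=> -[Cx Ex]; split=> //; apply: (depends_on_ball dE _ Ex) => v vo vk.
  exact: agree.
by apply: iff_sym; exact: agree.
Qed.

End LocalCluster.

Lemma exists_nil_set0 (T : Type) (J : eqType) (A : J -> set T) :
  [set w | exists2 j, j \in [::] & A j w] = set0.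
Proof. by apply/seteqP; split=> // w []. Qed.

Lemma exists_cons_setU (T : Type) (J : eqType) (A : J -> set T) j l :
  [set w | exists2 i, i \in j :: l & A i w] =
  A j `|` [set w | exists2 i, i \in l & A i w].
Proof.
apply/seteqP; split=> [w [i]|w [Aj|[i il Ai]]].
- by rewrite inE => /orP[/eqP-> Aj|il Ai]; [left|right; exists i].
- by exists j => //; rewrite inE eqxx.
- by exists i => //; rewrite inE il orbT.
Qed.

Lemma fld_exists_le d (Omega : measurableType d) (R : realType) (P : probability Omega R)
    (I : Type) (F : indep_fields P I) (J : eqType) (l : seq J) S (A : J -> set Omega) c :
  (forall j, j \in l -> F S (A j) /\ pr P (A j) <= c) ->
  F S [set w | exists2 j, j \in l & A j w] /\
  pr P [set w | exists2 j, j \in l & A j w] <= (size l)%:R * c.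
Proof.
elim: l => [_|j l IH h].
  by rewrite exists_nil_set0 mul0r pr0; split=> //; rewrite -setCT; apply: fldC; exact: fldT.
have [|Fl prl] := IH; first by move=> i il; apply: h; rewrite inE il orbT.
have [|Fj prj] := h j; first by rewrite inE eqxx.
rewrite exists_cons_setU; split; first exact: fldU.
apply: le_trans (prU_le P (fld_measurable Fj) (fld_measurable Fl)) _.
by rewrite /= -natr1; lra.
Qed.

(** * Approximation of the cluster near x by critical percolation *)

Section TreeLimit.
Context d (Omega : measurableType d) (R : realType) (P : probability Omega R).
Context (s : nat) (W : {fset tree s} -> {RV P >-> R}).
Hypothesis s2 : (2 <= s)%N.
Hypothesis hW : iid_uniform01 (bonds (tree_adj s)) W.
Variable z : 'I_s.
Local Notation rt := (tree_root s).
Local Notation oS := (star_root s).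
Local Notation F := (weight_fields hW).
Local Notation wt := (wt W).
Local Notation cluster w := (IPC_vertices (tree_adj s) rt (fun e => W e w)).
Local Notation pc := (s%:R^-1 : R).
Local Notation NR q y := (no_off_percolation W q y).

Let s_gt0 : 0 < s%:R :> R. Proof. by rewrite ltr0n; lia. Qed.
Let pc_gt0 : 0 < pc. Proof. by rewrite invr_gt0. Qed.
Let pc_lt1 : pc < 1. Proof. by rewrite invf_lt1// ltr1n. Qed.
Let pc01 : 0 <= pc <= 1. Proof. by rewrite !ltW. Qed.

Let mA y := measurable_cluster hW z y.

Definition critical_percolation : set Omega :=
  [set w | exists u : tree s, reach_infty (fun u => wt u w <= pc) u].

Let reach_fldW p u : F (below u) [set w | reach_infty (fun u => wt u w <= p) u].
Proof.
exact: (@reach_infty_fld _ _ _ _ s F (fun v => [set w | wt v w <= p])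
  (fun v v0 => @fld_weight _ _ _ _ _ W hW [set v] v p erefl v0)).
Qed.

Lemma measurable_critical_percolation : measurable critical_percolation.
Proof.
rewrite (_ : critical_percolation =
    \bigcup_(u : seq 'I_s) [set w | reach_infty (fun u => wt u w <= pc) u]).
  by apply: countable_bigcupT_measurable => // u; exact: (fld_measurable (@reach_fldW pc u)).
by apply/seteqP; split=> [w [u ru]|w [u _ ru]]; exists u.
Qed.

Lemma pr_critical_percolation : pr P critical_percolation = 0.
Proof.
rewrite (_ : critical_percolation =
    \bigcup_(u : seq 'I_s) [set w | reach_infty (fun u => wt u w <= pc) u]).
  apply: pr_bigcup_seq_eq0 => u; first exact: (fld_measurable (@reach_fldW pc u)).
  rewrite -(theta_lim_critical R s2).
  exact: (@pr_reach_infty _ _ _ _ s F (fun v => [set w | wt v w <= pc]) pc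
    (fun v v0 => @fld_weight _ _ _ _ _ W hW [set v] v pc erefl v0)
    (fun v v0 => pr_weight hW v0 pc01)).
by apply/seteqP; split=> [w [u ru]|w [u _ ru]]; exists u.
Qed.

(** Almost surely, a bond of weight at most 1/s below an invaded vertex is itself invaded, and its
    weight is independent of that vertex being invaded. This is the rate that the exponential decay
    has to beat. *)
Lemma pr_cluster_ge y : pc ^+ size y <= pr P [set w | cluster w y].
Proof.
elim: y => [|i v IH].
  rewrite expr0 (_ : [set w | _] = setT) ?prT//.
  by apply/seteqP; split=> // w _; exact: cluster_root.
have Fw : F (below v) [set w | wt (i :: v) w <= pc].
  by apply: fld_weight => //; exists i, [::].
have mw := fld_measurable Fw.
rewrite [size _]/= exprSr; apply: (@le_trans _ _ (pr P [set w | cluster w v] * pc)).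
  by rewrite ler_wpM2r// ltW.
rewrite -{1}(pr_weight hW (v := i :: v) _ pc01)//.
rewrite -(fld_indep _ (fld_cluster hW z v) Fw) ?setICl//.
rewrite -[leRHS]addr0 -pr_critical_percolation.
apply: pr_le_sub2 => //; [exact: measurableI|exact: measurable_critical_percolation|].
move=> w [Cv wi]; have [|nc] := pselect (critical_percolation w); [by right|left].
by apply: (cluster_low_weight z (p := pc)) => // u ru; apply: nc; exists u.
Qed.

Lemma pr_middle v q : v != rt -> pc <= q <= 1 ->
  pr P [set w | pc < wt v w <= q] = q - pc.
Proof.
move=> v0 /andP[pq q1].
have m p : measurable [set w | wt v w <= p].
  by apply: fld_measurable; apply: (fld_weight hW (S := setT)).
have := prDI P (m q) (m pc).
rewrite (_ : _ `&` _ = [set w | wt v w <= pc]); last first.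
  by apply/seteqP; split=> [w []//|w h]; split=> //; exact: le_trans pq.
rewrite !(pr_weight hW)//; last by rewrite q1 (le_trans _ pq)// ltW.
rewrite (_ : _ `\` _ = [set w | pc < wt v w <= q]); first by lra.
apply/seteqP; split=> [w [wq /negP]|w /= /andP[pw wq]].
  by rewrite -ltNge => pw; apply/andP.
by split=> //; apply/negP; rewrite -ltNge.
Qed.

Lemma measurable_no_off_percolation q y : 0 <= q <= 1 -> measurable (NR q y).
Proof.
move=> q01.
have -> : NR q y = \bigcap_(t : seq 'I_s * 'I_s * seq 'I_s)
    [set w | y = t.1.1 ++ t.1.2 :: t.2 ->
       ~ off_percolation (fun v => [set w | wt v w <= q]) t.2 t.1.2 w].
  apply/seteqP; split=> [w h [[a i] v] _ /=|w h a i v]; first exact: h.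
  exact: (h (a, i, v)).
apply: (sigma_bigcap (sigma_algebra_measurable Omega)) => -[[a i] v] /=.
have [yE|yE] := pselect (y = a ++ i :: v); last first.
  rewrite (_ : [set w | _] = setT); first exact: measurableT.
  by apply/seteqP; split=> // w _ /yE.
rewrite (_ : [set w | _] = ~` off_percolation (fun v => [set w | wt v w <= q]) v i).
  apply: fld_measurable.
  apply: (@pr_no_off_percolation _ _ _ _ s F (fun v => [set w | wt v w <= q]) q
    (fun v v0 => @fld_weight _ _ _ _ _ W hW [set v] v q erefl v0)
    (fun v v0 => pr_weight hW v0 q01) v i q01).1.
by apply/seteqP; split=> [w /(_ yE)|w h _].
Qed.

Variables (x : tree s) (m k : nat) (E : set (config (tree_star s))).
Hypotheses (mx : (m <= size x)%N) (m_gt0 : (0 < m)%N) (km : (k <= m)%N).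
Hypothesis dE : depends_on (bonds_in_ball (tree_star_adj s) oS k) E.
Local Notation uc := (upward_child z x).

(** The event that [x] is in C and tau_x E holds, with the identification of balls fixed; by [tauE]
    nothing is lost for invariant [E] as soon as [x] is deep enough. *)
Definition near_event : set Omega :=
  [set w | cluster w x /\
     E (pullback (upward z x) (IPC_bonds (tree_adj s) rt (fun e => W e w)))].

Definition low_vertices w : set (tree_star s) := [set v | wt (uc v) w <= pc].

Let leq_size (v : tree_star s) : (star_depth v <= m)%N -> (star_depth v <= size x)%N.
Proof. by move=> vm; exact: leq_trans vm mx. Qed.

Lemma measurable_near_event : measurable near_event.
Proof.
pose G v := [set w | cluster w (if v is Some u then uc u else x)].
apply: (finite_dependence (sigma_algebra_measurable Omega)
  (l := None :: [seq Some v | v <- star_vertices s m]) (F := G)) => [j _|w w' h].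
  exact: mA.
move=> [Cx Ex]; split; first by apply/(h None); rewrite // inE.
apply: (depends_on_ball dE _ Ex) => v vo vk; have vm := leq_trans vk km.
have u0 : uc v != rt := upward_child_neq0 z vo (leq_size vm).
rewrite /pullback /= upward_bond// !(IPC_bondsE z _ u0).
apply: (h (Some v)); rewrite inE map_f ?orbT//.
by rewrite mem_star_vertices vo.
Qed.

Let uc_below v : v != oS -> (star_depth v <= m)%N -> below (drop m x) (uc v).
Proof.
move=> vo vm; have [c [t ->]] := upward_child_below z vo vm mx.
by exists (last c t), (belast c t); rewrite -cat_rcons -lastI.
Qed.

Lemma fld_local_event :
  F (below (drop m x)) [set w | ray_event z m E (low_vertices w)].
Proof.
apply: (finite_dependence (fld_sigma F _) (l := star_vertices s m)
   (F := fun v => [set w | wt (uc v) w <= pc])) => [v|w w' h].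
  rewrite mem_star_vertices => /andP[vo vm].
  apply: fld_weight; first exact: uc_below.
  exact: (upward_child_neq0 z vo (leq_size vm)).
apply: (ray_event_dependence km dE) => v vo vm.
by apply: h; rewrite mem_star_vertices vo.
Qed.

(** Given that the ancestor is invaded, the two events can differ only if no side ray of level q
    exists, if some bond of the ball has weight in (1/s, q], or on a null event. The second error
    keeps the factor P(y in C) because the ball lies below y. *)
Lemma local_approximation q : pc <= q <= 1 ->
  `|pr P near_event -
    pr P [set w | cluster w (drop m x)] * pr P [set w | ray_event z m E (low_vertices w)]| <=
  pr P ([set w | cluster w (drop m x)] `&` NR q (drop m x)) +
  pr P [set w | cluster w (drop m x)] * ((size (star_vertices s m))%:R * (q - pc)).
Proof.
move=> pq; set y := drop m x; set A := [set w | cluster w y].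
set K := [set w | ray_event _ _ _ _].
pose Hc := [set w | exists2 v, v \in star_vertices s m & pc < wt (uc v) w <= q].
have [FH prH] : F (below y) Hc /\ pr P Hc <= (size (star_vertices s m))%:R * (q - pc).
  apply: (fld_exists_le (A := fun v => [set w | pc < wt (uc v) w <= q])) => v.
  rewrite mem_star_vertices => /andP[vo vm].
  have u0 : uc v != rt := upward_child_neq0 z vo (leq_size vm).
  split; last by rewrite pr_middle.
  have -> : [set w | pc < wt (uc v) w <= q] =
      [set w | wt (uc v) w <= q] `&` ~` [set w | wt (uc v) w <= pc]; last first.
    by apply: fldI; [|apply: fldC]; apply: fld_weight => //; exact: uc_below.
  apply/seteqP; split=> [w /= /andP[pw wq]|w [/= wq /negP]].
    by split=> //; apply/negP; rewrite -ltNge.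
  by rewrite -ltNge => pw; apply/andP.
have FA : F (~` below y) A := fld_cluster hW z y.
have FK : F (below y) K := fld_local_event.
have mN : measurable (NR q y).
  apply: measurable_no_off_percolation; case/andP: pq => pq ->.
  by rewrite andbT (le_trans _ pq)// ltW.
have mAA := fld_measurable FA; have mK := fld_measurable FK; have mH := fld_measurable FH.
have m0 := measurable_critical_percolation.
rewrite -(fld_indep _ FA FK) ?setICl//.
pose C := (A `&` NR q y) `|` ((A `&` Hc) `|` critical_percolation).
have mC : measurable C.
  by apply: measurableU; [exact: measurableI|apply: measurableU => //; exact: measurableI].
have good w : A w -> ~ C w -> near_event w <-> K w.
  move=> Aw nC; have nN : ~ NR q y w by move=> h; apply: nC; left.
  apply: (@local_event _ _ z _ x m pc q mx m_gt0 _ _ _ _ k E km dE) => //.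
  - by move=> u ru; apply: nC; right; right; exists u.
  - apply: contrapT => h; apply: nN => a i v yE /off_percolation_reach rv.
    by apply: h; exists a, i, v.
  - move=> v vo vm h; apply: nC; right; left; split=> //; exists v => //.
    by rewrite mem_star_vertices vo.
apply: (@le_trans _ _ (pr P C)).
  apply: dist_pr => //; [exact: measurable_near_event|exact: measurableI| |].
    move=> w Xw; have Aw : A w by case: Xw => Cx _; exact: drop_in.
    have [?|nC] := pselect (C w); [by right|left]; split=> //; exact/(good w Aw nC).
  by move=> w [Aw Kw]; have [?|nC] := pselect (C w); [right|left; apply/(good w Aw nC)].
apply: le_trans (prU_le P _ _) _; [exact: measurableI| |].
  by apply: measurableU => //; exact: measurableI.
rewrite lerD2l; apply: le_trans (prU_le P _ _) _ => //; first exact: measurableI.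
rewrite pr_critical_percolation addr0 (fld_indep _ FA FH) ?setICl//.
by rewrite ler_wpM2l ?pr_ge0.
Qed.

End TreeLimit.

Section TreeLimitUniform.
Context d (Omega : measurableType d) (R : realType) (P : probability Omega R).
Context (s : nat) (W : {fset tree s} -> {RV P >-> R}).
Hypothesis s2 : (2 <= s)%N.
Hypothesis hW : iid_uniform01 (bonds (tree_adj s)) W.
Variable z : 'I_s.
Local Notation cluster w := (IPC_vertices (tree_adj s) (tree_root s) (fun e => W e w)).
Local Notation pc := (s%:R^-1 : R).
Variables (m k : nat) (E : set (config (tree_star s))) (G : R).
Hypotheses (m_gt0 : (0 < m)%N) (km : (k <= m)%N).
Hypothesis dE : depends_on (bonds_in_ball (tree_star_adj s) (star_root s) k) E.
Hypothesis prG : forall x : tree s, (m <= size x)%N ->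
  pr P [set w | ray_event z m E (low_vertices W z x w)] = G.

Lemma near_event_asymptotics eps : 0 < eps -> exists n0, forall x : tree s,
  (n0 <= size x)%N ->
  `|pr P (near_event W z x E) - pr P [set w | cluster w (drop m x)] * G| <=
    eps * pr P [set w | cluster w (drop m x)].
Proof.
move=> eps0; pose B : R := (size (star_vertices s m))%:R.
have B0 : 0 <= B by [].
have s0 : 0 < s%:R :> R by rewrite ltr0n; lia.
have pc0 : 0 < pc by rewrite invr_gt0.
have pc1 : pc < 1 by rewrite invf_lt1// ltr1n.
(* [B] counts the bonds of the m-ball, so the union bound over weights in (1/s, q] costs at most
   eps/2; the alternative value (1 + pc)/2 keeps q below 1. *)
have [q [pq q1 Bq]] : exists q, [/\ pc < q, q < 1 & B * (q - pc) <= eps / 2].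
  have pos : 0 < eps / 2 / (B + 1) by rewrite !divr_gt0//; lra.
  have BE : B * (eps / 2 / (B + 1)) <= eps / 2.
    rewrite mulrCA ler_piMr//; first by lra.
    by rewrite ler_pdivrMr; lra.
  have [h|h] := leP (pc + eps / 2 / (B + 1)) ((1 + pc) / 2).
    exists (pc + eps / 2 / (B + 1)); split; [lra|lra|].
    by rewrite (_ : _ - _ = eps / 2 / (B + 1))//; lra.
  exists ((1 + pc) / 2); split; [lra|lra|].
  by apply: le_trans BE; apply: ler_wpM2l => //; lra.
have sp : 0 < s.-1%:R :> R by rewrite ltr0n -subn1 subn_gt0.
have sE : s%:R = s.-1%:R + 1 :> R by rewrite natr1 prednK//; lia.
have gap : (1 - q) / s.-1%:R < pc.
  rewrite ltr_pdivrMr// -(ltr_pM2l s0) mulrA mulfV ?gt_eqF// mul1r.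
  have : s%:R * pc = 1 by rewrite mulfV// gt_eqF.
  have : s%:R * pc < s%:R * q by rewrite ltr_pM2l.
  by lra.
(* With the gap equal to 4e, the rate (1 - q)/(s - 1) + e is pc - 3e, so r = pc - 2e lies strictly
   between the rate and pc. *)
pose e := (pc - (1 - q) / s.-1%:R) / 4.
pose r := pc - 2 * e.
have e0 : 0 < e by rewrite /e; lra.
have [||C C0 HC] := @record_event_bound _ _ _ _ _ W s2 hW q e _ e0 r; first by rewrite pq.
  by rewrite /r /e; lra.
have r0 : 0 < r.
  have : 0 <= (1 - q) / s.-1%:R by rewrite divr_ge0//; lra.
  by rewrite /r /e; lra.
have rpc : `|r / pc| < 1.
  by rewrite ger0_norm ?divr_ge0 ?ltW// ltr_pdivrMr// mul1r /r; lra.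
have [N0 HN0] : exists N0, forall N, (N0 <= N)%N -> C * (r / pc) ^+ N <= eps / 2.
  have c : (fun N => C * (r / pc) ^+ N) @ \oo --> (C * 0).
    by apply: cvgM; [exact: cvg_cst|exact: cvg_expr].
  have : \forall N \near \oo, C * (r / pc) ^+ N < eps / 2.
    by apply: (cvgr_lt (C * 0)) => //; rewrite mulr0; lra.
  move=> [N0 _ h]; exists N0 => N NN; apply: ltW; exact: (h N NN).
exists (N0 + m)%N => x nx; have mx : (m <= size x)%N by apply: leq_trans nx; exact: leq_addl.
set y := drop m x; set A := [set w | cluster w y].
have yN : (N0 <= size y)%N by rewrite size_drop leq_subRL// addnC.
have mA : measurable A := measurable_cluster hW z y.
have := @local_approximation _ _ _ P s W s2 hW z x m k E mx m_gt0 km dE q.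
rewrite prG// -/y -/A => /(_ _)/wrap[]; first by rewrite !ltW.
move/le_trans; apply.
have Age : pc ^+ size y <= pr P A := pr_cluster_ge s2 hW z y.
have lev0 : level q e 0 = q by rewrite /level mul0r addr0 min_r// ltW.
have h1 : pr P (A `&` no_off_percolation W q y) <= C * r ^+ size y.
  apply: le_trans (HC y); apply: le_pr.
  - apply: measurableI => //; apply: measurable_no_off_percolation;
      rewrite // !ltW//; exact: lt_trans pq.
  - by apply: fld_measurable; apply: (record_event_fld s2 hW (q := q) (e := e)); rewrite ?pq.
  - by move=> w [Aw nw]; apply: (cluster_record_event z) => //; rewrite lev0.
have h2 : C * r ^+ size y <= eps / 2 * pr P A.
  have -> : C * r ^+ size y = C * (r / pc) ^+ size y * pc ^+ size y.
    by rewrite -mulrA -exprMn divfK// gt_eqF.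
  apply: (@le_trans _ _ (eps / 2 * pc ^+ size y)).
    by rewrite ler_wpM2r ?exprn_ge0 ?HN0// ltW.
  by rewrite ler_wpM2l//; lra.
have h3 : pr P A * (B * (q - pc)) <= pr P A * (eps / 2) by rewrite ler_wpM2l// pr_ge0.
rewrite -/B; lra.
Qed.

End TreeLimitUniform.

(** * The incipient infinite cluster *)

Section Bonferroni.
Context d (Omega : measurableType d) (R : realType) (P : probability Omega R).

(** Inclusion-exclusion stopped at pairs. The crude count of pairs by the square of the size is
    enough: [c] will be the square of a survival probability tending to 0, and [b] a fixed multiple
    of that probability. *)
Lemma bonferroni (J : eqType) (l : seq J) (B : J -> set Omega) (b c : R) : uniq l ->
  (forall j, j \in l -> measurable (B j) /\ pr P (B j) = b) ->
  (forall i j, i \in l -> j \in l -> i != j -> pr P (B i `&` B j) <= c) -> 0 <= c ->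
  measurable [set w | exists2 j, j \in l & B j w] /\
  (size l)%:R * b - (size l)%:R ^+ 2 * c <=
    pr P [set w | exists2 j, j \in l & B j w] <= (size l)%:R * b.
Proof.
move=> ul mB hc c0.
elim: l ul mB hc => [_ _ _|j l IH /= /andP[jl ul] mB hc].
  by rewrite exists_nil_set0 pr0 !mul0r expr0n /= mul0r subr0 lexx.
have tl i : i \in l -> i \in j :: l by rewrite inE orbC => ->.
have [||mU /andP[lo hi]] := IH ul; first by move=> i /tl; exact: mB.
  by move=> i i' /tl il /tl i'l; exact: hc.
have [mj prj] : measurable (B j) /\ pr P (B j) = b by apply: mB; rewrite inE eqxx.
rewrite exists_cons_setU; split; first exact: measurableU.
have prU2 : pr P [set w | exists2 i, i \in l & (B j `&` B i) w] <= (size l)%:R * c /\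
    measurable [set w | exists2 i, i \in l & (B j `&` B i) w].
  have: forall i, i \in l -> measurable (B j `&` B i) /\ pr P (B j `&` B i) <= c.
    move=> i il; split; first by apply: measurableI => //; have [] := mB i (tl i il).
    apply: hc; [by rewrite inE eqxx|exact: tl|].
    by apply: contraNneq jl => ->.
  elim: (l) => [|i l' IH'] h; first by rewrite exists_nil_set0 pr0 mul0r; split.
  have [|h1 m1] := IH'; first by move=> i' il'; apply: h; rewrite inE il' orbT.
  have [m2 h2] : measurable (B j `&` B i) /\ pr P (B j `&` B i) <= c by apply: h; rewrite inE eqxx.
  rewrite (exists_cons_setU (fun i => B j `&` B i)); split; last exact: measurableU.
  by apply: le_trans (prU_le P m2 m1) _; rewrite /= -natr1; lra.
have UE : [set w | exists2 i, i \in l & (B j `&` B i) w] =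
    B j `&` [set w | exists2 i, i \in l & B i w].
  apply/seteqP; split=> [w [i il [Bj Bi]]|w [Bj [i il Bi]]]; first by split=> //; exists i.
  by exists i.
have : pr P (B j `|` [set w | exists2 i, i \in l & B i w]) =
    b + pr P [set w | exists2 i, i \in l & B i w] -
    pr P (B j `&` [set w | exists2 i, i \in l & B i w]).
  rewrite -prj [X in _ + X - _](prDI P mU mj) [X in _ + (_ + pr P X) - _]setIC.
  rewrite addrA addrK -prU//; [|exact: measurableD|by rewrite setDIK].
  by congr pr; apply/seteqP; split=> w /=; have [] := pselect (B j w); tauto.
have := pr_ge0 P (B j `&` [set w | exists2 i, i \in l & B i w]).
rewrite -UE; case: prU2 => prU2 _.
move: (pr _ _) (pr _ _) lo hi prU2 => u v lo hi prU2 u0 ->.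
rewrite /= -natr1 sqrrD1 mulrDl.
have L0 : 0 <= (size l)%:R :> R by [].
by apply/andP; split; nra.
Qed.

End Bonferroni.

Section IncipientCluster.
Context d (Omega : measurableType d) (R : realType) (P : probability Omega R).
Context (s : nat) (X : {fset tree_star s} -> {RV P >-> bool}).
Hypothesis s2 : (2 <= s)%N.
Local Notation oS := (star_root s).
Local Notation starp := (@parent_star s).
Local Notation pc := (s%:R^-1 : R).
Hypothesis hX : bernoulli_percolation (tree_star_adj s) pc X.
Variable z : 'I_s.

Let s_gt0 : 0 < s%:R :> R. Proof. by rewrite ltr0n ltnW. Qed.
Let pc01 : 0 < pc <= 1.
Proof. by rewrite invr_gt0 s_gt0 invf_le1// ler1n ltnW. Qed.

Let bond_star_inj (u v : tree_star s) : [set v | v != oS] u -> [set v | v != oS] v ->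
  bond starp u = bond starp v -> u = v.
Proof. exact: (bond_inj (star_rooted s)). Qed.

Definition status_fields : indep_fields P (tree_star s) :=
  reindexed_fields hX.1 bond_star_inj.
Local Notation F := status_fields.

Definition open_vertices (w : Omega) : set (tree_star s) := [set v | X (bond starp v) w].

Lemma fld_open (S : set (tree_star s)) v : S v -> v != oS ->
  F S [set w | open_vertices w v].
Proof.
move=> Sv vo.
rewrite (_ : [set w | _] = X (bond starp v) @^-1` [set true]).
  by apply: reindexed_preimage => //; exact: bonds_bond.
by apply/seteqP; split.
Qed.

Lemma pr_open v : v != oS -> pr P [set w | open_vertices w v] = pc.
Proof. by move=> vo; rewrite /pr (hX.2 (bond starp v))//; exact: bonds_bond. Qed.

Definition shallow m : set (tree_star s) := [set v | v != oS /\ (star_depth v <= m)%N].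

Definition depends_on_shallow m (Q : set (tree_star s) -> Prop) : Prop :=
  forall a b : set (tree_star s),
    (forall v, v != oS -> (star_depth v <= m)%N -> a v <-> b v) -> Q a -> Q b.

Lemma fld_shallow m Q : depends_on_shallow m Q ->
  F (shallow m) [set w | Q (open_vertices w)].
Proof.
move=> dQ; apply: (finite_dependence (fld_sigma F _) (l := star_vertices s m)
  (F := fun v => [set w | open_vertices w v])) => [v|w w' h].
  by rewrite mem_star_vertices => /andP[vo vm]; exact: fld_open.
by apply: dQ => v vo vm; apply: h; rewrite mem_star_vertices vo.
Qed.

Lemma chain_shallow m v : (star_depth v <= m)%N -> depends_on_shallow m (fun a => chain a v).
Proof. by move=> vm a b ab; exact: chain_dependence ab vm. Qed.

Lemma pr_chain v : pr P [set w | chain (open_vertices w) v] = pc ^+ star_depth v.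
Proof.
elim/(tree_ind (star_rooted s)): v => [|v vo IH].
  rewrite (_ : [set w | _] = setT) ?prT//.
  by apply/seteqP; split=> // w _; exact: chain_root.
rewrite (depth_parentS (star_rooted s) vo) exprS -IH -(pr_open vo).
rewrite (_ : [set w | chain _ v] =
    [set w | open_vertices w v] `&` [set w | chain (open_vertices w) (starp v)]).
  have Fv : F [set v] [set w | open_vertices w v] by exact: fld_open.
  have Fp := fld_shallow (chain_shallow (leqnn (star_depth (starp v)))).
  apply: fld_indep Fv Fp; apply/seteqP; split=> // u [-> [_]].
  by rewrite {1}(depth_parentS (star_rooted s) vo) ltnn.
by apply/seteqP; split=> w /(chainS _ vo).
Qed.

Definition level_vertices m : seq (tree_star s) :=
  [seq v <- star_vertices s m | star_depth v == m].

Lemma mem_level_vertices m v : (0 < m)%N ->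
  (v \in level_vertices m) = (star_depth v == m).
Proof.
move=> m0; rewrite mem_filter mem_star_vertices -(depth_gt0 (star_rooted s)).
by case: eqP => //= ->; rewrite m0 leqnn.
Qed.

Lemma level_vertices_uniq m : uniq (level_vertices m).
Proof. exact/filter_uniq/undup_uniq. Qed.

Definition descends_to L (v : tree_star s) w : Prop :=
  if v is Some (c, u) then
    reach (fun t : tree s => open_vertices w (Some (c, t))) L u
  else False.

Lemma chain_reach (a : set (tree_star s)) c t u : chain a (Some (c, t ++ u)) ->
  chain a (Some (c, u)) /\ reach (fun v : tree s => a (Some (c, v))) (size t) u.
Proof.
elim/last_ind: t u => [//|t i IH] u; rewrite cat_rcons => /IH[+ r].
have io : (Some (c, i :: u) : tree_star s) != oS by [].
by move=> /(chainS _ io)[oi cu]; split=> //; rewrite size_rcons; exists i.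
Qed.

(** The path to a vertex at depth m + L crosses depth m exactly once. This separates the bonds of
    the m-ball, which determine [E], from those of disjoint subtrees below it. *)
Lemma connected_descends m L w : (0 < m)%N ->
  connected_to_distance (tree_star_adj s) oS (fun e => X e w) (m + L) <->
  exists2 v, v \in level_vertices m & chain (open_vertices w) v /\ descends_to L v w.
Proof.
move=> m0; split.
  move=> [v [vd /(open_connectedP (star_rooted s)) cv]].
  move: vd; rewrite (gdist_root (star_rooted s)).
  case: v cv => [[c t]|] cv /=; last by move=> e; move: m0; lia.
  move=> td.
  have {cv} : chain (open_vertices w) (Some (c, take L t ++ drop L t)) by rewrite cat_take_drop.
  have sL : size (take L t) = L by rewrite size_takel//; move: td m0; move: (size t) => n; lia.
  have sd : (size (drop L t)).+1 = m by rewrite size_drop; move: td m0; move: (size t) => n; lia.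
  move=> ct; exists (Some (c, drop L t)); first by rewrite mem_level_vertices// /= sd.
  by have := chain_reach ct; rewrite sL.
move=> [[[c u]|] + [cu //= ru]]; rewrite mem_level_vertices// => /= /eqP um.
suff [t [tE ct]] : exists t, size t = (size u + L)%N /\ chain (open_vertices w) (Some (c, t)).
  exists (Some (c, t)); split; first by rewrite (gdist_root (star_rooted s)) /= tE -um addSn.
  by apply/(open_connectedP (star_rooted s)).
elim: L u cu ru {um} => [|L IH] u cu; first by exists u; rewrite addn0.
move=> [i [oi ri]]; have [|t [tE ct]] := IH (i :: u) _ ri; last first.
  by exists t; rewrite tE addSnnS.
by apply/chainS.
Qed.

Let word_inj (c : 'I_s.+1) : injective (fun t : tree s => Some (c, t) : tree_star s).
Proof. by move=> t t' [->]. Qed.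

Let subtree (v : tree_star s) : set (tree_star s) :=
  if v is Some (c, u) then (fun t => Some (c, t)) @` below u else set0.

Lemma fld_descends L c u : F (subtree (Some (c, u))) [set w | descends_to L (Some (c, u)) w] /\
  pr P [set w | descends_to L (Some (c, u)) w] = theta s pc L.
Proof.
have FY (v : tree s) : v != [::] ->
    sub_fields F (@word_inj c) [set v] [set w | open_vertices w (Some (c, v))].
  by move=> v0; apply: fld_open => //; exists v.
have prY (v : tree s) : v != [::] -> pr P [set w | open_vertices w (Some (c, v))] = pc.
  by move=> _; exact: pr_open.
split.
  exact: (@reach_fld _ _ _ _ s (sub_fields F (@word_inj c))
    (fun v => [set w | open_vertices w (Some (c, v))]) FY L u).
exact: (@pr_reach _ _ _ _ s (sub_fields F (@word_inj c))
    (fun v => [set w | open_vertices w (Some (c, v))]) pc FY prY L u).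
Qed.

Section Limit.
Variables (m : nat) (Q : set (tree_star s) -> Prop) (G : R).
Hypotheses (m_gt0 : (0 < m)%N) (dQ : depends_on_shallow m Q).
Hypothesis prQ : forall v, star_depth v = m ->
  pr P [set w | chain (open_vertices w) v /\ Q (open_vertices w)] = G.

Definition connected_event L : set Omega :=
  [set w | connected_to_distance (tree_star_adj s) oS (fun e => X e w) (m + L) /\
           Q (open_vertices w)].

Let K v := [set w | chain (open_vertices w) v /\ Q (open_vertices w)].

(** Each vertex of depth m contributes G theta_L, and each pair at most theta_L^2 since the two
    subtrees are disjoint. After division by theta_L the pairs disappear, because theta_L tends to 0
    at criticality. *)
Lemma connected_event_cvg :
  (forall L, measurable (connected_event L)) /\
  (fun L => pr P (connected_event L) / theta s pc L) @ \oo -->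
    (size (level_vertices m))%:R * G.
Proof.
have pc01' : 0 <= pc <= 1 by case/andP: pc01 => /ltW -> ->.
have th0 L : 0 < theta s pc L := theta_gt0 s2 L pc01.
have main L : measurable (connected_event L) /\
    (size (level_vertices m))%:R * (G * theta s pc L) -
     (size (level_vertices m))%:R ^+ 2 * (theta s pc L ^+ 2) <= pr P (connected_event L)
      <= (size (level_vertices m))%:R * (G * theta s pc L).
  have -> : connected_event L =
      [set w | exists2 v, v \in level_vertices m & (K v `&` [set w | descends_to L v w]) w].
    apply/seteqP; split=> [w [/(connected_descends _ _ m_gt0)[v vl [cv dv]] Qw]|].
      by exists v.
    move=> w [v vl [[cv Qw] dv]].
    by split=> //; apply/(connected_descends _ _ m_gt0); exists v.
  have FK v : v \in level_vertices m -> F (shallow m) (K v).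
    rewrite mem_level_vertices// => /eqP vm.
    apply: fldI; last exact: (fld_shallow dQ).
    exact: (fld_shallow (chain_shallow (eq_leq vm))).
  have dis c u : (size u).+1 = m -> shallow m `&` subtree (Some (c, u)) = set0.
    move=> um; apply/seteqP; split=> // v [[_ dv] [t [i [a tE]] te]].
    by move: dv; rewrite -te /= tE size_cat /= -um; move: (size u) => n; lia.
  apply: bonferroni; [exact: level_vertices_uniq| | |by rewrite exprn_ge0// ltW].
    move=> v vl; have FKv := FK v vl; move: (vl); rewrite mem_level_vertices// => /eqP vm.
    case: v vl FKv vm => [[c u]|] vl FKv vm; last by move: vm m_gt0 => /= <-.
    have [FD prD] := fld_descends L c u.
    split; first by apply: measurableI; [exact: fld_measurable FKv|exact: fld_measurable FD].
    by rewrite (fld_indep (dis c u vm) FKv FD) prD prQ.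
  move=> v v' vl v'l vv'.
  have mKD t : t \in level_vertices m -> measurable (K t `&` [set w | descends_to L t w]).
    move=> tl; apply: measurableI; first exact: fld_measurable (FK t tl).
    case: t {tl} => [[c u]|]; first exact: fld_measurable (fld_descends L c u).1.
    by rewrite (_ : [set w | _] = set0)//; apply/seteqP; split.
  move: (mKD v vl) (mKD v' v'l).
  move: vl v'l vv'; rewrite !mem_level_vertices//.
  case: v => [[c u]|]; last by move=> /eqP e; move: m_gt0; rewrite -e.
  case: v' => [[c' u']|]; last by move=> _ /eqP e; move: m_gt0; rewrite -e.
  move=> /eqP vm /eqP v'm vv' m1 m2.
  have [FD prD] := fld_descends L c u; have [FD' prD'] := fld_descends L c' u'.
  have mD := fld_measurable FD; have mD' := fld_measurable FD'.
  rewrite expr2 -{1}prD -prD' -(fld_indep _ FD FD'); last first.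
    apply/seteqP; split=> // _ [[t [i [a ->]] <-] [t' [i' [a' ->]] [cc']]].
    rewrite -!cat_rcons => e; move: vv'; rewrite cc'.
    have -> : u = u'; last by rewrite eqxx.
    apply/esym; apply: (cat_suffix_inj e).
    by move: vm v'm => /= [<-] [->].
  by apply: le_pr; [exact: measurableI|exact: measurableI|move=> w [[_ ?] [_ ?]]].
split=> [L|]; first by have [] := main L.
have thc : theta s pc @ \oo --> (0 : R).
  by rewrite -(theta_lim_critical R s2); exact: theta_cvg.
set l := (size (level_vertices m))%:R in main *.
have lo : (fun L => l * G - l ^+ 2 * theta s pc L) @ \oo --> l * G.
  rewrite [X in _ --> X](_ : _ = l * G - l ^+ 2 * 0); last by rewrite mulr0 subr0.
  by apply: cvgB; [exact: cvg_cst|apply: cvgM; [exact: cvg_cst|exact: thc]].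
apply: (squeeze_cvgr _ lo (cvg_cst (l * G))).
apply: nearW => L; have [_ /andP[h1 h2]] := main L.
rewrite ler_pdivlMr// ler_pdivrMr//; apply/andP; split; last by rewrite -mulrA.
by apply: le_trans h1; lra.
Qed.

End Limit.
End IncipientCluster.

(** * Symmetry and conclusion *)

Section Symmetry.
Variables (s : nat) (z : 'I_s).
Local Notation oS := (star_root s).
Local Notation starp := (@parent_star s).
Variables (E : set (config (tree_star s))) (k m : nat).
Hypothesis dE : depends_on (bonds_in_ball (tree_star_adj s) oS k) E.
Hypothesis invE : automorphism_invariant (tree_star_adj s) oS E.

Lemma swap_aut_parent c u v : starp (swap_aut z c u v) = swap_aut z c u (starp v).
Proof. by case: v => [[b [|i t]]|]. Qed.

Lemma swap_aut_root c u v : (swap_aut z c u v == oS) = (v == oS).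
Proof. by rewrite -!(depth_eq0 (star_rooted s)) swap_aut_depth. Qed.

Lemma chain_swap_aut c u (a : set (tree_star s)) v :
  chain a (swap_aut z c u v) <-> chain (fun t => a (swap_aut z c u t)) v.
Proof.
have it n : iter n starp (swap_aut z c u v) = swap_aut z c u (iter n starp v).
  by elim: n => // n IH; rewrite !iterS IH swap_aut_parent.
by split=> h n; have := h n; rewrite it swap_aut_root.
Qed.

(** The involution carries the reference vertex at depth m to [Some (c, u)], and the invariance of
    [E] absorbs the relabelling of the cluster. *)
Lemma ray_event_swap_aut c u (a : set (tree_star s)) : (size u).+1 = m ->
  (chain a (Some (c, u)) /\ E (chain_cluster a)) <->
  ray_event z m E (fun t => a (swap_aut z c u t)).
Proof.
move=> um; rewrite /ray_event -chain_swap_aut -um swap_aut_ray.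
suff h : E (chain_cluster a) <-> E (chain_cluster (fun t => a (swap_aut z c u t))).
  by split=> -[ca Ea]; split=> //; apply/h.
rewrite -(invE (swap_aut_automorphism z c u)).
have agree v : v != oS -> (star_depth v <= k)%N ->
    pullback (swap_aut z c u) (chain_cluster a) (bond starp v) <->
    chain_cluster (fun t => a (swap_aut z c u t)) (bond starp v).
  move=> vo _; rewrite /pullback /= /bond imfsetU !imfset_fset1 /=.
  rewrite -swap_aut_parent -!/(bond starp _) chain_cluster_bond ?swap_aut_root//.
  by rewrite chain_cluster_bond//; exact: chain_swap_aut.
by split; apply: (depends_on_ball dE) => v vo vk; [|apply: iff_sym]; exact: agree.
Qed.

End Symmetry.

Section TransferredLaw.
Context (R : realType) (s : nat).
Hypothesis s2 : (2 <= s)%N.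
Variable z : 'I_s.
Local Notation oS := (star_root s).
Local Notation pc := (s%:R^-1 : R).
Context d' (Omega' : measurableType d') (P' : probability Omega' R).
Variable X : {fset tree_star s} -> {RV P' >-> bool}.
Hypothesis hX : bernoulli_percolation (tree_star_adj s) pc X.
Variables (E : set (config (tree_star s))) (k m : nat).
Hypotheses (km : (k <= m)%N).
Hypothesis dE : depends_on (bonds_in_ball (tree_star_adj s) oS k) E.

Definition ray_probability : R := pr P' [set w | ray_event z m E (open_vertices X w)].

Let in_star_vertices v : v \in star_vertices s m -> v != oS /\ (star_depth v <= m)%N.
Proof. by rewrite mem_star_vertices => /andP. Qed.

Let ray_event_dep (a b : set (tree_star s)) :
  (forall v, v \in star_vertices s m -> a v <-> b v) ->
  ray_event z m E a -> ray_event z m E b.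
Proof.
move=> ab; apply: (ray_event_dependence km dE) => v vo vm.
by apply: ab; rewrite mem_star_vertices vo.
Qed.

Let open_law v : v \in star_vertices s m ->
  status_fields hX [set v] [set w | open_vertices X w v] /\
  pr P' [set w | open_vertices X w v] = pc.
Proof.
by move=> /in_star_vertices[vo _]; split; [exact: fld_open|exact: (pr_open hX)].
Qed.

(** Relabelling independent statuses of equal probability by an automorphism leaves their law
    unchanged, so all vertices at depth m contribute the same amount. *)
Lemma pr_chain_level (invE : automorphism_invariant (tree_star_adj s) oS E) v :
  (0 < m)%N -> star_depth v = m ->
  pr P' [set w | chain (open_vertices X w) v /\ E (chain_cluster (open_vertices X w))] =
    ray_probability.
Proof.
case: v => [[c u]|] m0 vm; last by rewrite -vm in m0.
have -> : [set w | chain (open_vertices X w) (Some (c, u)) /\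
      E (chain_cluster (open_vertices X w))] =
    [set w | ray_event z m E (fun t => open_vertices X w (swap_aut z c u t))].
  by apply/seteqP; split=> w /(ray_event_swap_aut z dE invE c (open_vertices X w) vm).
apply: (@same_law _ _ _ _ _ _ _ _ _ (status_fields hX) (status_fields hX) _
  (star_vertices s m) pc (swap_aut z c u) id
  (fun t => [set w | open_vertices X w (swap_aut z c u t)])
  (fun t => [set w | open_vertices X w t])) => //.
- exact: undup_uniq.
- by move=> i j _ _ /(can_inj (swap_autK z c u)).
- move=> v /in_star_vertices[vo _].
  have gv : swap_aut z c u v != oS by rewrite swap_aut_root.
  by split; [exact: fld_open|exact: (pr_open hX)].
Qed.

Context d (Omega : measurableType d) (P : probability Omega R).
Variable W : {fset tree s} -> {RV P >-> R}.
Hypothesis hW : iid_uniform01 (bonds (tree_adj s)) W.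

(** In the m-ball around [x], the events of weight at most 1/s are independent of probability 1/s
    and attached to distinct bonds, exactly like the statuses in the m-ball of T*_sigma. The value
    does not depend on [x]. *)
Lemma pr_low_vertices (x : tree s) : (m <= size x)%N ->
  pr P [set w | ray_event z m E (low_vertices W z x w)] = ray_probability.
Proof.
move=> mx.
have vx (v : tree_star s) : (star_depth v <= m)%N -> (star_depth v <= size x)%N.
  by move=> /leq_trans; apply.
have pc01 : 0 <= pc <= 1.
  by rewrite invr_ge0 ler0n invf_le1 ?ltr0n ?ler1n// ltnW.
apply: (@same_law _ _ _ _ _ _ _ _ _ (weight_fields hW) (status_fields hX) _
  (star_vertices s m) pc (upward_child z x) id
  (fun v => [set w | low_vertices W z x w v])
  (fun t => [set w | open_vertices X w t])) => //.
- exact: undup_uniq.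
- move=> i j /in_star_vertices[io im] /in_star_vertices[jo jm].
  exact: upward_child_inj (vx _ im) (vx _ jm).
- move=> v /in_star_vertices[vo vm].
  have u0 := upward_child_neq0 z vo (vx _ vm).
  by split; [exact: fld_weight|exact: (pr_weight hW)].
Qed.

End TransferredLaw.

Lemma tree_infty_filter (s : nat) : Filter (tree_infty s).
Proof.
apply: filter_from_filter; first by exists 0%N.
move=> i j _ _; exists (maxn i j) => // x /=.
by rewrite geq_max => /andP[].
Qed.

Lemma cvg_tree_infty (R : realType) (s : nat) (f : tree s -> R) (l : R) :
  (forall eps, 0 < eps -> exists n0, forall x : tree s, (n0 <= size x)%N ->
     `|f x - l| <= eps) ->
  f x @[x --> tree_infty s] --> l.
Proof.
have := tree_infty_filter s => filt h.
apply/cvgrPdist_le => eps /h[n0 hn0]; exists n0 => // x /=.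
by rewrite tree_normE distrC; exact: hn0.
Qed.

Lemma cylinder_ball (s : nat) (E : set (config (tree_star s))) :
  cylinder (tree_star_adj s) E -> exists k,
    depends_on (bonds_in_ball (tree_star_adj s) (star_root s) k) E.
Proof.
move=> [B [/finite_seqP[l ->] Bb dE]].
suff [k hk] : exists k, forall e, e \in l -> bonds_in_ball (tree_star_adj s) (star_root s) k e.
  by exists k => om om' h; apply: dE => e /hk; exact: h.
elim: l Bb {dE} => [|e l IH] Bb; first by exists 0%N.
have [|k hk] := IH; first by move=> e' /= el; apply: Bb; rewrite /= inE el orbT.
have /(bondsP (star_root s))[v vo eE] : bonds (tree_star_adj s) e.
  by apply: Bb; rewrite /= inE eqxx.
exists (maxn k (star_depth v)) => e'; rewrite inE => /orP[/eqP->|/hk].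
  by apply/(bonds_in_ballP (star_rooted s)); exists v; rewrite leq_maxr.
move=> /(bonds_in_ballP (star_rooted s))[u [uo uk ->]].
apply/(bonds_in_ballP (star_rooted s)); exists u; split=> //.
by rewrite (leq_trans uk)// leq_maxl.
Qed.

Theorem theorem1p2 (R : realType) (s : nat) (hs : (2 <= s)%N)
    (d : measure_display) (Omega : measurableType d) (P : probability Omega R)
    (W : {fset tree s} -> {RV P >-> R})
    (hW : iid_uniform01 (bonds (tree_adj s)) W)
    (d' : measure_display) (Omega' : measurableType d')
    (P' : probability Omega' R) (X : {fset tree_star s} -> {RV P' >-> bool})
    (hX : bernoulli_percolation (tree_star_adj s) s%:R^-1 X)
    (Pinf : probability (config_space (tree_star_adj s)) R)
    (hPinf : is_IIC_law X Pinf)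
    (E : set (config (tree_star s)))
    (hE : cylinder (tree_star_adj s) E)
    (hinv : automorphism_invariant (tree_star_adj s) (star_root s) E) :
  cond_prob P
    [set w | tau x E (IPC_bonds (tree_adj s) (tree_root s) (fun e => W e w))]
    [set w | IPC_vertices (tree_adj s) (tree_root s) (fun e => W e w) x]
    @[x --> tree_infty s] --> fine (Pinf E).
Proof.
have z : 'I_s := Ordinal (ltnW hs).
(* The distance m stays fixed throughout: it has to cover the ball on which [E] depends and be
   positive, and no limit in m is taken. *)
have [k dE] := cylinder_ball hE; pose m := k.+1.
have m0 : (0 < m)%N by [].
have km : (k <= m)%N by [].
have dT : depends_on (bonds_in_ball (tree_star_adj s) (star_root s) k)
  [set: config (tree_star s)] by [].
have invT : automorphism_invariant (tree_star_adj s) (star_root s)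
  [set: config (tree_star s)] by [].
pose G E' := ray_probability z X E' m.
have GT : G setT = s%:R^-1 ^+ m.
  rewrite -[in RHS](depth_ray z m) -(pr_chain hX) /G /ray_probability.
  by congr pr; apply/seteqP; split=> w //= [].
have s0 : 0 < s%:R :> R by rewrite ltr0n ltnW.
have pc0 : 0 < s%:R^-1 :> R by rewrite invr_gt0.
have GT0 : G setT != 0 by rewrite GT expf_neq0// gt_eqF.
have iic E' : depends_on (bonds_in_ball (tree_star_adj s) (star_root s) k) E' ->
    automorphism_invariant (tree_star_adj s) (star_root s) E' ->
    (fun L => pr P' (connected_event X m (fun a => E' (chain_cluster a)) L) /
       theta s s%:R^-1 L) @ \oo --> (size (level_vertices s m))%:R * G E'.
  move=> dE' invE'.
  have [|v vm|_ //] := @connected_event_cvg _ _ _ _ _ _ hs hX m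
    (fun a => E' (chain_cluster a)) (G E') m0.
    move=> a b ab; apply: (depends_on_ball dE') => v vo vk.
    have vm := leq_trans vk km; rewrite !chain_cluster_bond//.
    by split; apply: chain_dependence vm => u uo um; [apply: ab|apply: iff_sym; apply: ab].
  exact: (pr_chain_level z hX km dE' invE' m0 vm).
pose lv : R := (size (level_vertices s m))%:R.
have lv0 : lv != 0.
  rewrite pnatr_eq0 size_eq0; apply/eqP => l0.
  by have := mem_level_vertices (ray z m) m0; rewrite depth_ray eqxx l0 in_nil.
(* With n = m + L, the conditional probability is the ratio of the quantities of [iic] for [E] and
   for the sure event; the survival probability and the number of vertices at depth m cancel. *)
have PinfE : fine (Pinf E) = G E / G setT.
  have c1 := cvg_comp _ _ (cvg_addnl m) (hPinf E hE).
  have c2 : (fun L => pr P' (connected_event X m (fun a => E (chain_cluster a)) L) /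
        theta s s%:R^-1 L /
      (pr P' (connected_event X m (fun a => setT (chain_cluster a)) L) /
        theta s s%:R^-1 L)) @ \oo --> lv * G E / (lv * G setT).
    apply: cvgM; first exact: iic.
    by apply: cvgV; [rewrite mulf_neq0|exact: iic].
  have -> : G E / G setT = lv * G E / (lv * G setT).
    by rewrite -mulf_div divff// mul1r.
  apply: (cvg_unique _ _ c2) => //.
  apply: cvg_trans c1; apply: near_eq_cvg; apply: nearW => L /=.
  have th0 : theta s s%:R^-1 L != 0 :> R.
    by rewrite gt_eqF// theta_gt0// pc0 invf_le1// ler1n ltnW.
  rewrite invf_div mulrA divfK// /cond_prob /pr; congr (fine (P' _) / fine (P' _)).
    apply/seteqP; split=> w; rewrite /connected_event /= open_clusterE.
      by move=> [Ew cw].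
    by move=> [cw Ew].
  by apply/seteqP; split=> w //= [].
rewrite PinfE.
(* The error in [near_event_asymptotics] is relative to P(y in C), so dividing by this positive
   probability gives a genuine limit, and it cancels in the ratio [r]. *)
have tree_side E' : depends_on (bonds_in_ball (tree_star_adj s) (star_root s) k) E' ->
    (fun x => pr P (near_event W z x E') /
      pr P [set w | IPC_vertices (tree_adj s) (tree_root s) (fun e => W e w) (drop m x)])
      x @[x --> tree_infty s] --> G E'.
  move=> dE'; apply: cvg_tree_infty => eps eps0.
  have [n0 hn0] := near_event_asymptotics hs hW m0 km dE'
    (fun x mx => pr_low_vertices hs z hX km dE' hW mx) eps0.
  exists n0 => x /hn0; set A := pr P [set w | IPC_vertices _ _ _ _].
  have A0 : 0 < A.
    by apply: (lt_le_trans _ (pr_cluster_ge hs hW z (drop m x))); rewrite exprn_gt0.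
  move=> h; rewrite -(ler_pM2r A0) -[X in _ * X](gtr0_norm A0) -normrM.
  by rewrite mulrBl divfK ?gt_eqF// [G E' * A]mulrC.
have filt := tree_infty_filter s.
pose r x := pr P (near_event W z x E) /
    pr P [set w | IPC_vertices (tree_adj s) (tree_root s) (fun e => W e w) (drop m x)] /
  (pr P (near_event W z x setT) /
    pr P [set w | IPC_vertices (tree_adj s) (tree_root s) (fun e => W e w) (drop m x)]).
have c : r x @[x --> tree_infty s] --> G E / G setT.
  by apply: cvgM; [exact: tree_side|apply: cvgV => //; exact: tree_side].
pose q x := cond_prob P
    [set w | tau x E (IPC_bonds (tree_adj s) (tree_root s) (fun e => W e w))]
    [set w | IPC_vertices (tree_adj s) (tree_root s) (fun e => W e w) x].
have rq : {near tree_infty s, r =1 q}.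
  exists k.+1 => // x; rewrite /= tree_normE => kx.
  have A0 : 0 < pr P [set w |
      IPC_vertices (tree_adj s) (tree_root s) (fun e => W e w) (drop m x)].
    by apply: (lt_le_trans _ (pr_cluster_ge hs hW z (drop m x))); rewrite exprn_gt0.
  rewrite /r invf_div mulrA divfK ?gt_eqF// /q /cond_prob /pr.
  congr (fine (P _) / fine (P _)).
    by apply/seteqP; split=> w; rewrite /near_event /= (tauE hinv z _ kx dE) => -[].
  by apply/seteqP; split=> w //= [].
exact: (cvg_trans (near_eq_cvg rq) c).
Qed.
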